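(* Let $n\ge1$, let $V=\mathbb{R}^{2n}$ be equipped with its standard symplectic form $\omega$, and let $G=\mathrm{Sp}(2n,\mathbb{R})$ act linearly on $V$. Let $v_1,\dots,v_{2n-1}$ be the canonical frame of tangent vectors and $Q$ the canonical quadratic form attached to a generic 2-jet of a hypersurface as defined in the context, let $\nabla_j$ be the invariant derivation corresponding to the horizontal field $v_j$, and let $I_{2,i}=Q(v_i,v_i)$. Then for the $G$-action on the space $J^\infty(V,2n-1)$ of infinite jets of hypersurfaces in $V$, the algebra $\mathcal{A}$ of differential invariants is generated by the differential invariants $I_{2,i}$ and the invariant derivations $\nabla_j$, where $1\le i,j\le 2n-1$.
   Context: Jets and invariants. $J^k(V,2n-1)$ is the space of $k$-jets of hypersurfaces $\Sigma\subset V$, locally written as graphs of one coordinate as a function of the others, with the partial derivatives as jet-coordinates. $G$ acts on it by prolongation. A differential invariant of order $k$ is a function on $J^k(V,2n-1)$ constant on orbits of the prolonged action; differential invariants are taken to be rational functions on the jet space, polynomial in jet-variables of sufficiently high order. $\mathcal{A}$ is the algebra of all differential invariants. An invariant derivation is a combination of total derivatives, with coefficients functions on a finite jet space, commuting with the prolonged action. A field of vectors tangent to $\Sigma$ determined by the $k$-jet of $\Sigma$ is identified with a horizontal derivation (combination of total derivatives). 'Generated' (Lie–Tresse sense) means that every element of $\mathcal{A}$ is a rational expression in finitely many functions $\nabla_J I_{2,i}$, where $\nabla_J$ are iterated compositions of the $\nabla_j$. Canonical quadratic form. Let $p\in\Sigma$ and let $v_0$ be the position vector of $p$ from the origin. If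 $q$ is a local defining function of $\Sigma$ ($\Sigma=\{q=0\}$, $dq\ne0$), then for generic 1-jets $d_pq(v_0)\neq0$, and $Q=\dfrac{d^2_pq|_{T_p\Sigma}}{d_pq(v_0)}$ (where $d^2_pq$ is the second symmetric differential, i.e. the Hessian quadratic form in linear coordinates of $V$) does not depend on the choice of $q$. Canonical frame. For a generic 2-jet, vectors $v_1,\dots,v_{2n-1}$ forming a basis of $T_p\Sigma$ are uniquely determined by the following successive choices. Put $\Pi_0=T_p\Sigma$. For $r=1,2,\dots$: (Step $2r-1$) $v_{2r-1}\in\Pi_{2r-2}$ spans the kernel of $\omega|_{\Pi_{2r-2}}$ and is normalized by $\omega(v_{2r-2},v_{2r-1})=1$; put $\Pi_{2r-1}=\{w\in\Pi_{2r-2}:\omega(v_{2r-2},w)=0\}$. (Step $2r$) put $\Pi_{2r}=\{w\in\Pi_{2r-1}: Q(v_{2r-1},w)=0\}$; $v_{2r}\in\Pi_{2r-1}$ is $Q$-orthogonal to $\Pi_{2r}$ and is normalized by $Q(v_{2r-1},v_{2r})=1$. The procedure stops after step $2n-1$; here $\Pi_m=\langle v_{m+1},\dots,v_{2n-1}\rangle$. *)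

(* Defs.v *)
From mathcomp Require Import all_boot all_order all_algebra.
From mathcomp Require Import mpoly.
From mathcomp Require Import boolp classical_sets reals topology normedtype derive.

Set Implicit Arguments.
Unset Strict Implicit.
Unset Printing Implicit Defensive.

Import Order.TTheory GRing.Theory Num.Theory.
Local Open Scope ring_scope.

(* V = R^(n+n); a chart of the jet space is the choice of an index
   c : 'I_(n+n), and consists of the (jets of) hypersurfaces on which the
   coordinate c is a function of the m = (n+n).-1 other ones, the i-th
   of these being the coordinate [lift c i] of V. *)

Definition omega (R : realType) (n : nat) (v w : 'cV[R]_(n + n)) : R :=
  \sum_(i < n) (v (lshift n i) 0 * w (rshift n i) 0
                - v (rshift n i) 0 * w (lshift n i) 0).

Definition symplectic (R : realType) (n : nat) (g : 'M[R]_(n + n)) : Prop :=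
  forall v w : 'cV[R]_(n + n), omega (g *m v) (g *m w) = omega v w.

(* Jet coordinates in a chart: [inl i] is the i-th independent variable x_i,
   [inr s] is the partial derivative u_s, s a multi-index (u itself for s = 0).
   A k-jet is represented by the coordinates of order at most k of an infinite
   jet, the functions on J^k being those depending on these coordinates only. *)
Definition jvar (m : nat) : Type := ('I_m + 'X_{1..m})%type.

Definition jord (m : nat) (z : jvar m) : nat :=
  match z with inl _ => 0%N | inr s => mdeg s end.

Definition jet (R : realType) (m : nat) : Type := jvar m -> R.

Definition jbase (R : realType) (m : nat) (th : jet R m) : 'I_m -> R :=
  fun i => th (inl i).

Definition polynomial_on (R : realType) (m k : nat) (f : jet R m -> R) : Prop :=
  exists (N : nat) (z : 'I_N -> jvar m) (P : {mpoly R[N]}),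
    (forall i, (jord (z i) <= k)%N) /\
    (forall th, f th = P.@[fun i => th (z i)]).

Definition generic (R : realType) (m : nat) (A : jet R m -> Prop) : Prop :=
  exists (k : nat) (D : jet R m -> R),
    [/\ polynomial_on k D, exists th, D th != 0
      & forall th, D th != 0 -> A th].

(* [f] represents the rational function P / D on J^k, polynomial in the jet
   variables of order > l.  The values of [f] where D vanishes are irrelevant. *)
Definition is_ratio (R : realType) (m l k : nat) (f P D : jet R m -> R) : Prop :=
  [/\ polynomial_on k P, polynomial_on l D, exists th, D th != 0
    & forall th, D th != 0 -> f th = P th / D th].

Definition rational_on (R : realType) (m k : nat) (f : jet R m -> R) : Prop :=
  exists P D : jet R m -> R, is_ratio k k f P D.

Definition chart_point (S : Type) (n : nat) (c : 'I_(n + n))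
    (x : 'I_(n + n).-1 -> S) (u : S) : 'cV[S]_(n + n) :=
  \col_j (if unlift c j is Some i then x i else u).

Definition jet_of (R : realType) (m k : nat) (f : {mpoly R[m]}) (th : jet R m)
    : Prop :=
  forall s : 'X_{1..m}, (mdeg s <= k)%N ->
    (f^`M[s]).@[jbase th] = th (inr s).

(* The k-jet th' is the image of the k-jet th under the prolongation of g:
   th and th' are the k-jets of the graphs of f and f' (any k-jet is the jet of
   a polynomial graph), h is the parametrization X |-> g (X, f(X)) of the image
   of the first graph, which starts at the base point of th', is itself a graph
   in the chart near this point (invertible Jacobian), and has there contact of
   order k with the graph of f'. *)
Definition prolong (R : realType) (n : nat) (c : 'I_(n + n)) (k : nat)
    (g : 'M[R]_(n + n)) (th th' : jet R (n + n).-1) : Prop :=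
  exists f f' : {mpoly R[(n + n).-1]},
    let h := map_mx (@mpolyC (n + n).-1 R) g *m chart_point c (fun i => 'X_i) f in
    let phi := fun i : 'I_(n + n).-1 => h (lift c i) 0 in
    let psi := h c 0 in
    [/\ jet_of k f th /\ jet_of k f' th',
        forall i, jbase th' i = (phi i).@[jbase th],
        \matrix_(i, j) ((phi i)^`M(j)).@[jbase th] \in unitmx
      & forall s : 'X_{1..(n + n).-1}, (mdeg s <= k)%N ->
          ((f' \mPo [tuple phi i | i < (n + n).-1])^`M[s]).@[jbase th]
          = (psi^`M[s]).@[jbase th]].

Definition prolong_infty (R : realType) (n : nat) (c : 'I_(n + n))
    (g : 'M[R]_(n + n)) (th th' : jet R (n + n).-1) : Prop :=
  forall k, prolong c k g th th'.

(* The algebra of the (rational) differential invariants that are polynomial in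
   the jet variables of order > l.  Its elements are considered up to equality
   at generic jets. *)
Definition diff_invariant (R : realType) (n : nat) (c : 'I_(n + n)) (l : nat)
    (f : jet R (n + n).-1 -> R) : Prop :=
  exists (k : nat) (P D : jet R (n + n).-1 -> R),
    [/\ (l <= k)%N, is_ratio l k f P D
      & forall (g : 'M[R]_(n + n)) (th th' : jet R (n + n).-1),
          symplectic g -> prolong c k g th th' ->
          D th != 0 -> D th' != 0 -> f th' = f th].

(* The value at th of the i-th total derivative
   D_i = d/dx_i + \sum_s u_(s + 1_i) d/du_s, as a tangent vector at th. *)
Definition total_dir (R : realType) (m : nat) (th : jet R m) (i : 'I_m) : jet R m :=
  fun z => match z with
           | inl j => (j == i)%:R
           | inr s => th (inr (s + U_(i))%MM)
           end.

(* The derivation \sum_i a_i D_i, as a derivative along the line of direction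
   \sum_i a_i(th) D_i|th; functions on J^k depend on finitely many coordinates. *)
Definition horizontal (R : realType) (m : nat) (a : jet R m -> 'I_m -> R)
    (f : jet R m -> R) : jet R m -> R :=
  fun th =>
    derive1 (fun t : R^o =>
      f (fun z => th z + t * \sum_(i < m) a th i * total_dir th i z) : R^o) 0.

(* The second condition says X (f o g) = (X f) o g for the prolonged action
   of g on J^oo, as rational functions, f' being f o g. *)
Definition invariant_derivation (R : realType) (n : nat) (c : 'I_(n + n))
    (a : jet R (n + n).-1 -> 'I_(n + n).-1 -> R) : Prop :=
  (exists k, forall i, rational_on k (fun th => a th i)) /\
  (forall (g : 'M[R]_(n + n)) (k : nat) (f f' : jet R (n + n).-1 -> R),
     symplectic g -> rational_on k f -> rational_on k f' ->
     generic (fun th => forall th', prolong_infty c g th th' -> f' th = f th') ->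
     generic (fun th => forall th', prolong_infty c g th th' ->
                horizontal a f' th = horizontal a f th')).

Definition position (R : realType) (n : nat) (c : 'I_(n + n))
    (th : jet R (n + n).-1) : 'cV[R]_(n + n) :=
  chart_point c (jbase th) (th (inr 0%MM)).

(* First and second differentials at the base point of the defining function
   q(z) = z_c - f(z') of the graph of a function f with jet th, z' being the
   coordinates other than z_c. *)
Definition dq (R : realType) (n : nat) (c : 'I_(n + n))
    (th : jet R (n + n).-1) (w : 'cV[R]_(n + n)) : R :=
  w c 0 - \sum_(i < (n + n).-1) th (inr U_(i)%MM) * w (lift c i) 0.

Definition d2q (R : realType) (n : nat) (c : 'I_(n + n))
    (th : jet R (n + n).-1) (w w' : 'cV[R]_(n + n)) : R :=
  - \sum_(i < (n + n).-1) \sum_(j < (n + n).-1)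
      th (inr (U_(i) + U_(j))%MM) * w (lift c i) 0 * w' (lift c j) 0.

Definition Qform (R : realType) (n : nat) (c : 'I_(n + n))
    (th : jet R (n + n).-1) (w w' : 'cV[R]_(n + n)) : R :=
  d2q c th w w' / dq c th (position c th).

Definition tangent (R : realType) (n : nat) (c : 'I_(n + n))
    (th : jet R (n + n).-1) : set 'cV[R]_(n + n) :=
  [set w | dq c th w = 0]%classic.

Definition spans_kernel (R : realType) (n : nat) (P : set 'cV[R]_(n + n))
    (w : 'cV[R]_(n + n)) : Prop :=
  forall z : 'cV[R]_(n + n),
    (P z /\ forall y, P y -> omega z y = 0) <-> exists a : R, z = a *: w.

(* The pair (v_r, Pi_r), obtained from (v_(r-1), Pi_(r-1)) by the r-th step; the
   vector v_r is the one (unique at a generic jet) subject to the stated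
   conditions. *)
Fixpoint frame_flag (R : realType) (n : nat) (c : 'I_(n + n))
    (th : jet R (n + n).-1) (r : nat)
    : 'cV[R]_(n + n) * set 'cV[R]_(n + n) :=
  match r with
  | 0%N => (position c th, tangent c th)
  | r'.+1 =>
    let v := (frame_flag c th r').1 in
    let Pi := (frame_flag c th r').2 in
    if odd r'.+1 then
      (xget (0 : 'cV[R]_(n + n))
         [set w | [/\ Pi w, spans_kernel Pi w & omega v w = 1]]%classic,
       [set w | Pi w /\ omega v w = 0]%classic)
    else
      let Pi' := [set w | Pi w /\ Qform c th v w = 0]%classic in
      (xget (0 : 'cV[R]_(n + n))
         [set w | [/\ Pi w, forall y, Pi' y -> Qform c th w y = 0
                    & Qform c th v w = 1]]%classic,
       Pi')
  end.

Definition frame (R : realType) (n : nat) (c : 'I_(n + n))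
    (r : nat) (th : jet R (n + n).-1) : 'cV[R]_(n + n) :=
  (frame_flag c th r).1.

(* An index j : 'I_(n + n).-1 stands for the (j+1)-st frame vector, v_0 being
   the position vector. *)
Definition I2 (R : realType) (n : nat) (c : 'I_(n + n)) (i : 'I_(n + n).-1)
    : jet R (n + n).-1 -> R :=
  fun th => Qform c th (frame c i.+1 th) (frame c i.+1 th).

(* A tangent vector w of the hypersurface is identified with
   \sum_i w_i D_i, w_i being its components along the independent variables. *)
Definition frame_coef (R : realType) (n : nat) (c : 'I_(n + n))
    (j : 'I_(n + n).-1) : jet R (n + n).-1 -> 'I_(n + n).-1 -> R :=
  fun th i => frame c j.+1 th (lift c i) 0.

Definition nabla (R : realType) (n : nat) (c : 'I_(n + n)) (j : 'I_(n + n).-1)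
    : (jet R (n + n).-1 -> R) -> (jet R (n + n).-1 -> R) :=
  horizontal (frame_coef c j).

Definition nablas (R : realType) (n : nat) (c : 'I_(n + n))
    (J : seq 'I_(n + n).-1) (f : jet R (n + n).-1 -> R) : jet R (n + n).-1 -> R :=
  foldr (fun j => @nabla R n c j) f J.

Definition rational_expression (R : realType) (m : nat)
    (S : set (jet R m -> R)) (f : jet R m -> R) : Prop :=
  exists (N : nat) (F : 'I_N -> jet R m -> R) (A B : {mpoly R[N]}),
    (forall s, S (F s)) /\
    generic (fun th => B.@[fun s => F s th] != 0 /\
                       f th = A.@[fun s => F s th] / B.@[fun s => F s th]).

(* Main.v *)
Require Import Defs.
From HB Require Import structures.
From mathcomp Require Import all_boot all_order all_algebra.
From mathcomp Require Import mpoly.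
From mathcomp Require Import perm.
From mathcomp Require Import boolp classical_sets reals topology normedtype derive.
From mathcomp Require Import functions realfun.
From mathcomp Require Import ring lra zify.

Set Implicit Arguments.
Unset Strict Implicit.
Unset Printing Implicit Defensive.

Import Order.TTheory GRing.Theory Num.Theory numFieldNormedType.Exports.

(** Why the basic invariants and the invariant derivations generate.

    Let V_0 be the position vector, V_1, V_2, ... the canonical frame, and let the
    structure coefficients Gam express the derivative of V_a along V_j in the basis of
    all V_b. They are subject to linear equations. The derivative of V_0 along V_j is
    V_j; the component along V_0 of the derivative of V_a is -Q(V_j, V_a), because V_a
    is tangent ([Gam_normal]); the constants omega(V_a, V_b) have zero derivative
    ([Gam_symplectic]); antisymmetrizing the derivatives of the frame gives the torsion,
    that is, the commutators of the nabla_j ([nabla_comm]); and the component along V_0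
    of these commutators applied to V_a is the Codazzi equation ([codazzi]). The matrix
    of Q in the frame has entries 0, 1 and I_{2,i}. The commutators applied to the
    I_{2,l} express the torsion by the nabla_i nabla_j I_{2,l}, as soon as the matrix of
    the nabla_k I_{2,l} is invertible. So the system for Gam has its coefficients in the
    field K generated by the iterated derivatives of the I_{2,i}. The homogeneous system
    has no solution but zero ([rigidity]), whence Gam lies in K ([gens_Gam]). Both
    nondegeneracy conditions need to be verified at one jet only ([fclass_solve]), and
    this is done at an explicit jet ([separating_jet_exists]).

    Consequently the field generated by K and the entries of the frame is closed under
    the nabla_j, hence under the total derivatives; as it contains the base point, it
    contains all jet coordinates ([gensF_total]). Let f be an invariant, written
    rationally in elements of K and the frame. Moving the frame to a fixed one by an
    element of the symplectic group, which exists as the frame is a Darboux basis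
    ([darboux_transport]), changes neither f nor the elements of K, and replaces the
    frame by constants: so f lies in K ([invariant_generated]). As the group element
    depends on the jet, the argument uses the identity expressing invariance at all jets
    at which it makes sense, and not only at generic ones; this extension is
    [cdiff_generic0].

    The first two assertions rest on the uniqueness of the frame. A frame with the
    algebraic properties imposed by the successive choices ([adapted]) is the canonical
    one ([adapted_frame]), and these properties are preserved by the prolonged action,
    since dq is multiplied by a factor and Q is invariant ([adapted_prolong]). That the
    frame is rational in the 2-jet follows from a construction by linear algebra of an
    adapted frame near a given jet ([regular_adapted]). The invariance of the nabla_j is
    then the fact that the prolonged action maps total derivatives to combinations of
    total derivatives by its Jacobian matrix ([dtot_Phimap], [horizontal_invariant]);
    it is obtained from explicit formulas for the derivatives of the image of a graph. *)


(** * Polynomial functions of jets and generic properties *)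

Section Polynomials.
Local Open Scope ring_scope.
Variables (R : realType).

Lemma mpoly_alg_ind n (X : {mpoly R[n]} -> Prop) :
  (forall a, X a%:MP) -> (forall i, X 'X_i) ->
  (forall p q, X p -> X q -> X (p + q)) ->
  (forall p q, X p -> X q -> X (p * q)) -> forall p, X p.
Proof.
move=> hC hX hD hM; elim/mpolyind => [|a s p _ _ hp]; first by rewrite -mpolyC0.
apply: (hD) => //; rewrite -mul_mpolyC; apply: (hM) => //.
rewrite mpolyXE_id; apply: (big_ind X) => [|p1 p2|i _]; [|exact: hM|].
  by rewrite -mpolyC1.
 elim: (s i) => [|e he]; first by rewrite expr0 -mpolyC1.
by rewrite exprS; apply: (hM).
Qed.

Variable m : nat.
Implicit Types (f g : jet R m -> R) (th : jet R m).

Lemma polynomial_on_const k a : polynomial_on k (fun _ : jet R m => a).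
Proof.
exists 0%N, (fun i : 'I_0 => inr 0%MM), a%:MP; split=> [[]//|th].
by rewrite mevalC.
Qed.

Lemma polynomial_on_var k (z : jvar m) : (jord z <= k)%N ->
  polynomial_on k (fun th : jet R m => th z).
Proof.
move=> hz; exists 1%N, (fun=> z), 'X_ord0; split=> // th.
by rewrite mevalXU.
Qed.

Lemma polynomial_on_op k f g (op : forall N, {mpoly R[N]} -> {mpoly R[N]} -> {mpoly R[N]})
   (op' : R -> R -> R) :
  (forall N (P Q : {mpoly R[N]}) v, (op N P Q).@[v] = op' P.@[v] Q.@[v]) ->
  polynomial_on k f -> polynomial_on k g ->
  polynomial_on k (fun th => op' (f th) (g th)).
Proof.
move=> hop [N1 [z1 [P1 [h1 e1]]]] [N2 [z2 [P2 [h2 e2]]]].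
exists (N1 + N2)%N,
  (fun i => match fintype.split i with inl j => z1 j | inr j => z2 j end),
  (op _ (P1 \mPo [tuple 'X_(lshift N2 i) | i < N1])
        (P2 \mPo [tuple 'X_(rshift N1 i) | i < N2])).
split=> [i|th]; first by case: (fintype.split i).
rewrite hop !comp_mpoly_meval e1 e2; congr (op' _ _); apply: meval_eq => i;
  rewrite tnth_mktuple mevalXU.
- by rewrite (unsplitK (inl i)).
- by rewrite (unsplitK (inr i)).
Qed.

Lemma polynomial_on_add k f g : polynomial_on k f -> polynomial_on k g ->
  polynomial_on k (fun th => f th + g th).
Proof. by apply: (polynomial_on_op (op := fun N => +%R)) => N P Q v; rewrite mevalD. Qed.

Lemma polynomial_on_mul k f g : polynomial_on k f -> polynomial_on k g ->
  polynomial_on k (fun th => f th * g th).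
Proof. by apply: (polynomial_on_op (op := fun N => *%R)) => N P Q v; rewrite mevalM. Qed.

Lemma polynomial_on_ext k f g : (forall th, f th = g th) ->
  polynomial_on k f -> polynomial_on k g.
Proof. by move=> /funext ->. Qed.

Lemma polynomial_on_le k l f : (k <= l)%N -> polynomial_on k f -> polynomial_on l f.
Proof.
move=> hkl [N [z [P [h e]]]]; exists N, z, P; split=> // i.
exact: leq_trans (h i) hkl.
Qed.

Lemma polynomial_on_ind k (X : (jet R m -> R) -> Prop) :
  (forall a, X (fun=> a)) ->
  (forall z : jvar m, (jord z <= k)%N -> X (fun th => th z)) ->
  (forall f g, X f -> X g -> X (fun th => f th + g th)) ->
  (forall f g, X f -> X g -> X (fun th => f th * g th)) ->
  forall f, polynomial_on k f -> X f.
Proof.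
move=> hC hV hD hM f [N [z [P [hz /funext ->]]]].
elim/mpoly_alg_ind: P => [a|i|p q hp hq|p q hp hq].
- by under eq_fun do rewrite mevalC; exact: hC.
- by under eq_fun do rewrite mevalXU; exact: hV.
- by under eq_fun do rewrite mevalD; exact: hD.
- by under eq_fun do rewrite mevalM; exact: hM.
Qed.

Lemma polynomial_on_opp k f : polynomial_on k f -> polynomial_on k (fun th => - f th).
Proof.
move=> hf; apply: (@polynomial_on_ext k (fun th => (-1) * f th)).
  by move=> th; rewrite mulN1r.
by apply: polynomial_on_mul => //; exact: polynomial_on_const.
Qed.

Lemma polynomial_on_eq k f th th' : polynomial_on k f ->
  (forall z, (jord z <= k)%N -> th z = th' z) -> f th = f th'.
Proof.
move=> [N [z [P [hz e]]]] h; rewrite !e; apply: meval_eq => i; exact: h.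
Qed.

Definition jline (th v : jet R m) : R -> jet R m := fun t z => th z + t * v z.

Lemma polynomial_on_line k f th v : polynomial_on k f ->
  exists p : {poly R}, forall t, f (jline th v t) = p.[t].
Proof.
move: f; apply: polynomial_on_ind => [a|z _|f g [p hp] [q hq]|f g [p hp] [q hq]].
- by exists a%:P => t; rewrite hornerC.
- by exists ((th z)%:P + 'X * (v z)%:P) => t; rewrite !hornerE.
- by exists (p + q) => t; rewrite hornerD hp hq.
- by exists (p * q) => t; rewrite hornerM hp hq.
Qed.

Definition jline_to (a b : jet R m) := jline a (fun z => b z - a z).

Lemma jline0 a v : jline a v 0 = a.
Proof. by apply/funext => z; rewrite /jline mul0r addr0. Qed.

Lemma jline_to1 a b : jline_to a b 1 = b.
Proof. by apply/funext => z; rewrite /jline_to /jline mul1r addrC subrK. Qed.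

(** Zariski neighbourhoods. They play the role of a topology: every construction
    below is carried out near one well chosen jet, and then holds generically. *)
Definition znbhd k (a : jet R m) (A : jet R m -> Prop) :=
  exists D, [/\ polynomial_on k D, D a != 0 & forall th, D th != 0 -> A th].

Lemma poly_nonroot (p : {poly R}) : p != 0 -> exists t, p.[t] != 0.
Proof.
move=> p0; apply: contrapT => h.
have hr t : root p t.
  by apply/negPn/negP => hn; apply: h; exists t.
pose rs := [seq (i%:R : R) | i <- iota 0 (size p)].
have hu : uniq rs.
  by rewrite map_inj_uniq ?iota_uniq // => i j /eqP; rewrite eqr_nat => /eqP.
have ha : all (root p) rs by apply/allP.
by have := max_poly_roots p0 ha hu; rewrite size_map size_iota ltnn.
Qed.

(** The polynomial functions form an integral domain: on a line joining a point
    where f is nonzero to one where g is, both become nonzero polynomials in one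
    variable over an infinite field. *)
Lemma polynomial_on_neq0 k l f g a b : polynomial_on k f -> polynomial_on l g ->
  f a != 0 -> g b != 0 -> exists th, f th != 0 /\ g th != 0.
Proof.
move=> hf hg fa gb.
have [p hp] := polynomial_on_line a (fun z => b z - a z) hf.
have [q hq] := polynomial_on_line a (fun z => b z - a z) hg.
have p0 : p != 0.
  by apply: contraNneq fa => p0; rewrite -(jline0 a (fun z => b z - a z)) hp p0 horner0.
have q0 : q != 0.
  by apply: contraNneq gb => q0; rewrite -(jline_to1 a b) /jline_to hq q0 horner0.
have [|t] := @poly_nonroot (p * q); first by rewrite mulf_neq0.
rewrite hornerM mulf_eq0 negb_or -hp -hq => /andP[h1 h2].
by eexists; split; [exact: h1 | exact: h2].
Qed.

Lemma genericP A : @generic R m A <-> exists k a, znbhd k a A.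
Proof.
split=> [[k [D [h1 [a h2] h3]]]|[k [a [D [h1 h2 h3]]]]].
  by exists k, a, D.
by exists k, D; split => //; exists a.
Qed.

Lemma znbhd_generic k a A : znbhd k a A -> @generic R m A.
Proof. by move=> h; apply/genericP; exists k, a. Qed.

Lemma znbhdW k l a (A B : jet R m -> Prop) : (k <= l)%N -> (forall th, A th -> B th) ->
  znbhd k a A -> znbhd l a B.
Proof.
move=> hkl hAB [D [h1 h2 h3]]; exists D; split=> //.
  exact: polynomial_on_le h1.
by move=> th /h3 /hAB.
Qed.

Lemma znbhdS k a (A B : jet R m -> Prop) : (forall th, A th -> B th) ->
  znbhd k a A -> znbhd k a B.
Proof. exact: znbhdW. Qed.

Lemma znbhdI k a A B : znbhd k a A -> znbhd k a B -> znbhd k a (fun th => A th /\ B th).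
Proof.
move=> [D [h1 h2 h3]] [E [g1 g2 g3]]; exists (fun th => D th * E th); split.
- exact: polynomial_on_mul.
- exact: mulf_neq0.
- by move=> th; rewrite mulf_eq0 negb_or => /andP[/h3 ? /g3].
Qed.

Lemma znbhdT k a (A : jet R m -> Prop) : (forall th, A th) -> znbhd k a A.
Proof. by move=> h; exists (fun=> 1); split=> //; [exact: polynomial_on_const|exact: oner_neq0]. Qed.

Lemma znbhd_center k a A : znbhd k a A -> A a.
Proof. by move=> [D [h1 h2 h3]]; exact: h3. Qed.

Lemma znbhd_forall (T : finType) k a (A : T -> jet R m -> Prop) :
  (forall i, znbhd k a (A i)) -> znbhd k a (fun th => forall i, A i th).
Proof.
move=> h.
suff : forall s : seq T, znbhd k a (fun th => forall i, i \in s -> A i th).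
  by move=> /(_ (enum T)); apply: znbhdS => th hth i; apply: hth; rewrite mem_enum.
elim=> [|i s hs]; first exact: znbhdT.
have := znbhdI (h i) hs; apply: znbhdS => th [h1 h2] j.
by rewrite inE => /orP[/eqP ->|/h2].
Qed.

Lemma genericI A B : @generic R m A -> generic B -> generic (fun th => A th /\ B th).
Proof.
move=> [k [D [h1 [a h2] h3]]] [l [E [g1 [b g2] g3]]].
have [c [c1 c2]] := polynomial_on_neq0 h1 g1 h2 g2.
apply: (@znbhd_generic (maxn k l) c); apply: znbhdI.
- by exists D; split=> //; apply: polynomial_on_le h1; rewrite leq_maxl.
- by exists E; split=> //; apply: polynomial_on_le g1; rewrite leq_maxr.
Qed.

Lemma genericS (A B : jet R m -> Prop) : (forall th, A th -> B th) -> generic A -> generic B.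
Proof.
move=> h /genericP[k [a hA]]; apply: (@znbhd_generic k a); exact: znbhdS hA.
Qed.

Lemma genericT (A : jet R m -> Prop) : (forall th, A th) -> generic A.
Proof. by move=> h; apply: (@znbhd_generic 0 (fun=> 0)); apply: znbhdT. Qed.

Lemma generic_ex (A : jet R m -> Prop) : generic A -> exists th, A th.
Proof. by move=> /genericP[k [a /znbhd_center]]; exists a. Qed.

Lemma generic_forall (T : finType) (A : T -> jet R m -> Prop) :
  (forall i, generic (A i)) -> generic (fun th => forall i, A i th).
Proof.
move=> h.
suff : forall s : seq T, generic (fun th => forall i, i \in s -> A i th).
  by move=> /(_ (enum T)); apply: genericS => th hth i; apply: hth; rewrite mem_enum.
elim=> [|i s hs]; first exact: genericT.
have := genericI (h i) hs; apply: genericS => th [h1 h2] j.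
by rewrite inE => /orP[/eqP ->|/h2].
Qed.

End Polynomials.

(** * Derivatives of functions of jets *)

HB.lock Definition dd (R : realType) (m : nat) (f : jet R m -> R) (th v : jet R m) : R :=
  derive1 (fun t : R^o => f (jline th v t) : R^o) 0%R.

Section Calculus.
Local Open Scope ring_scope.
Variables (R : realType) (m : nat).
Implicit Types (f g : jet R m -> R) (th v : jet R m).

(** [dd f th v] is the derivative of f at th along v. Differentiability is asked
    along all differentiable curves, as in [cdiff] below: this makes the chain rule
    available without a topology on the space of infinite jets. *)
Definition dcurve (ga : R -> jet R m) th v :=
  (forall z, ga 0 z = th z) /\
  forall z, is_derive (0 : R) (1 : R) (fun t : R => ga t z) (v z).

Definition cdiff f th :=
  (forall x v w, dd f th (fun z => x * v z + w z) = x * dd f th v + dd f th w) /\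
  forall ga v, dcurve ga th v ->
    is_derive (0 : R) (1 : R) (fun t : R => f (ga t)) (dd f th v).

Lemma dcurve_jline th v : dcurve (jline th v) th v.
Proof.
split=> z; first by rewrite jline0.
rewrite /jline.
have -> : (fun t : R => th z + t * v z) = cst (th z) + v z \*: id.
  by apply/funext => t; rewrite !fctE /= mulrC.
by apply: is_derive_eq; rewrite add0r /GRing.scale /= mulr1.
Qed.

(** The derivative along straight lines being a special case, the linear map L
    need not be known in advance to be [dd f th]. *)
Lemma cdiff_intro f th (L : jet R m -> R) :
  (forall x v w, L (fun z => x * v z + w z) = x * L v + L w) ->
  (forall ga v, dcurve ga th v ->
     is_derive (0 : R) (1 : R) (fun t : R => f (ga t)) (L v)) ->
  cdiff f th /\ forall v, dd f th v = L v.
Proof.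
move=> hL hd.
have e v : dd f th v = L v.
  have := hd _ _ (dcurve_jline th v).
  by move=> /(@derive_val _ _ _ _ _ _ _); rewrite unlock derive1E.
split=> //; split=> [x v w|ga v hga]; rewrite !e //; exact: hd.
Qed.

Lemma cdiff_const a th : cdiff (fun=> a) th /\ forall v, dd (fun=> a) th v = 0.
Proof.
apply: (@cdiff_intro _ _ (fun=> 0)) => [x v w|ga v _]; first by rewrite mulr0 addr0.
exact: is_derive_cst.
Qed.

Lemma cdiff_var z th : cdiff (fun th => th z) th /\
  forall v, dd (fun th => th z) th v = v z.
Proof. by apply: (@cdiff_intro _ _ (fun v => v z)) => // ga v [_]; apply. Qed.

Lemma cdiff_add f g th : cdiff f th -> cdiff g th ->
  cdiff (fun th => f th + g th) th /\
  forall v, dd (fun th => f th + g th) th v = dd f th v + dd g th v.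
Proof.
move=> [f1 f2] [g1 g2].
apply: (@cdiff_intro _ _ (fun v => dd f th v + dd g th v)) => [x v w|ga v h].
  by rewrite f1 g1; ring.
exact: is_deriveD (f2 _ _ h) (g2 _ _ h).
Qed.

Lemma cdiff_mul f g th : cdiff f th -> cdiff g th ->
  cdiff (fun th => f th * g th) th /\
  forall v, dd (fun th => f th * g th) th v = f th * dd g th v + g th * dd f th v.
Proof.
move=> [f1 f2] [g1 g2].
apply: (@cdiff_intro _ _ (fun v => f th * dd g th v + g th * dd f th v)) => [x v w|ga v h].
  by rewrite f1 g1; ring.
apply: is_derive_eq (is_deriveM (f2 _ _ h) (g2 _ _ h)) _.
by have -> : ga 0 = th by apply/funext => z; case: h.
Qed.

Lemma cdiff_inv f th : f th != 0 -> cdiff f th ->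
  cdiff (fun th => (f th)^-1) th /\
  forall v, dd (fun th => (f th)^-1) th v = - (f th) ^- 2 * dd f th v.
Proof.
move=> f0 [f1 f2].
apply: (@cdiff_intro _ _ (fun v => - (f th) ^- 2 * dd f th v)) => [x v w|ga v h].
  by rewrite f1; ring.
have e : ga 0 = th by apply/funext => z; case: h.
have hfg := f2 _ _ h.
apply: is_derive_eq (is_deriveV _ hfg) _; rewrite e //.
Qed.

Lemma cdiff_continuous f th ga v : cdiff f th -> dcurve ga th v ->
  {for 0, continuous (fun t : R => f (ga t))}.
Proof.
move=> [_ h] /h hd; apply: differentiable_continuous.
apply/derivable1_diffP; exact: ex_derive.
Qed.

Lemma cdiff_neq0_near f th ga v : cdiff f th -> dcurve ga th v -> f th != 0 ->
  \forall t \near (0 : R), f (ga t) != 0.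
Proof.
move=> hf hga f0.
have e : ga 0 = th by apply/funext => z; case: hga.
have := cdiff_continuous hf hga; rewrite /prop_for /continuous_at e => hc.
exact: (@cvgr_neq0 _ _ _ (nbhs (0:R)) _ (fun t => f (ga t)) (f th) hc f0).
Qed.

Lemma cdiff_polynomial_on k f th : polynomial_on k f -> cdiff f th.
Proof.
move: f; apply: polynomial_on_ind => [a|z _|f g hf hg|f g hf hg].
- exact: (cdiff_const _ _).1.
- exact: (cdiff_var _ _).1.
- exact: (cdiff_add hf hg).1.
- exact: (cdiff_mul hf hg).1.
Qed.

Lemma znbhd_near k a A ga v : znbhd k a A -> dcurve ga a v ->
  \forall t \near (0 : R), A (ga t).
Proof.
move=> [D [h1 h2 h3]] hga.
have := cdiff_neq0_near (cdiff_polynomial_on a h1) hga h2.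
by apply: filterS => t /h3.
Qed.

Lemma cdiff_ext f g k th : znbhd k th (fun th => f th = g th) -> cdiff f th ->
  cdiff g th /\ forall v, dd g th v = dd f th v.
Proof.
move=> hz hf; apply: cdiff_intro => [x v w|ga v hga]; first by rewrite hf.1.
have := hf.2 _ _ hga; apply: near_eq_is_derive.
exact: znbhd_near hz hga.
Qed.

Lemma znbhd_point k a A : znbhd k a A ->
  znbhd k a (fun th => znbhd k th A).
Proof.
move=> [D [h1 h2 h3]]; exists D; split=> // th hth.
by exists D.
Qed.

Lemma generic_point A : @generic R m A -> generic (fun th => exists k, znbhd k th A).
Proof.
by move=> /genericP[k [a h]]; apply: (@znbhd_generic _ _ k a);
  apply: znbhdS (znbhd_point h) => th; exists k.
Qed.

(** Identities between invariants are found on a generic set only; this extends them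
    to all jets where their members are differentiable. On the line from th to a jet b
    with D b nonzero, the polynomial D has finitely many zeros, so f vanishes on it
    arbitrarily close to th, and f th = 0 by continuity. *)
Lemma cdiff_generic0 f th : cdiff f th -> generic (fun th => f th = 0) -> f th = 0.
Proof.
move=> hf [k [D [hD [b Db] h]]].
pose v z := b z - th z.
have [p hp] := polynomial_on_line th v hD.
have p0 : p != 0.
  apply: contraNneq Db => p0.
  by rewrite -(jline_to1 th b) /jline_to -/v hp p0 horner0.
apply/eqP/negPn/negP => f0.
have := cdiff_neq0_near hf (dcurve_jline th v) f0.
move=> /nbhs_ballP[e /= e0 he].
(* infinitely many parameters in the ball *)
pose x (i : nat) : R := e / (i.+2)%:R.
have xb i : ball (0 : R) e (x i).
  rewrite /ball /= sub0r normrN /x ger0_norm; last by rewrite divr_ge0 // ltW.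
  by rewrite ltr_pdivrMr ?ltr0n // ltr_pMr // ltr1n.
have hr i : root p (x i).
  apply/negPn/negP => hn.
  have := he _ (xb i).
  by rewrite h ?eqxx // hp.
pose rs := [seq x i | i <- iota 0 (size p)].
have hu : uniq rs.
  rewrite map_inj_uniq ?iota_uniq // => i j /(mulfI (lt0r_neq0 e0)) /invr_inj /eqP.
  by rewrite eqr_nat => /eqP[].
have ha : all (root p) rs by apply/allP => _ /mapP[i _ ->].
by have := max_poly_roots p0 ha hu; rewrite size_map size_iota ltnn.
Qed.

End Calculus.

(** * Rational functions and total derivatives *)

Section Rational.
Local Open Scope ring_scope.
Variables (R : realType) (m : nat).
Implicit Types (f g : jet R m -> R) (th v a : jet R m).

(** Rational functions defined at the jet a. *)
Definition regular k a f := exists P D, [/\ polynomial_on k P, polynomial_on k D,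
  D a != 0 & forall th, D th != 0 -> f th = P th / D th].

Lemma regular_polynomial k a f : polynomial_on k f -> regular k a f.
Proof.
move=> hf; exists f, (fun=> 1); split=> //; [exact: polynomial_on_const|exact: oner_neq0|].
by move=> th _; rewrite divr1.
Qed.

Lemma regular_const k a x : regular k a (fun=> x).
Proof. exact/regular_polynomial/polynomial_on_const. Qed.

Lemma regular_var k a z : (jord z <= k)%N -> regular k a (fun th => th z).
Proof. by move=> h; apply/regular_polynomial/polynomial_on_var. Qed.

Lemma regular_le k l a f : (k <= l)%N -> regular k a f -> regular l a f.
Proof.
move=> h [P [D [h1 h2 h3 h4]]]; exists P, D; split=> //; exact: polynomial_on_le h _.
Qed.

Lemma regular_add k a f g : regular k a f -> regular k a g ->
  regular k a (fun th => f th + g th).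
Proof.
move=> [P [D [h1 h2 h3 h4]]] [P' [D' [g1 g2 g3 g4]]].
exists (fun th => P th * D' th + P' th * D th), (fun th => D th * D' th); split.
- by apply: polynomial_on_add; apply: polynomial_on_mul.
- exact: polynomial_on_mul.
- exact: mulf_neq0.
- move=> th; rewrite mulf_eq0 negb_or => /andP[d d']; rewrite h4 // g4 //.
  by field; rewrite d d'.
Qed.

Lemma regular_mul k a f g : regular k a f -> regular k a g ->
  regular k a (fun th => f th * g th).
Proof.
move=> [P [D [h1 h2 h3 h4]]] [P' [D' [g1 g2 g3 g4]]].
exists (fun th => P th * P' th), (fun th => D th * D' th); split.
- exact: polynomial_on_mul.
- exact: polynomial_on_mul.
- exact: mulf_neq0.
- move=> th; rewrite mulf_eq0 negb_or => /andP[d d']; rewrite h4 // g4 //.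
  by field; rewrite d d'.
Qed.

Lemma regular_inv k a f : f a != 0 -> regular k a f -> regular k a (fun th => (f th)^-1).
Proof.
move=> fa [P [D [h1 h2 h3 h4]]].
have Pa : P a != 0 by apply: contraNneq fa => e; rewrite h4 // e mul0r.
exists (fun th => D th * D th), (fun th => P th * D th); split.
- exact: polynomial_on_mul.
- exact: polynomial_on_mul.
- exact: mulf_neq0.
- move=> th; rewrite mulf_eq0 negb_or => /andP[d d']; rewrite h4 //.
  by field; rewrite d d'.
Qed.

Lemma regular_ext k a f g : znbhd k a (fun th => f th = g th) ->
  regular k a f -> regular k a g.
Proof.
move=> [E [g1 g2 g3]] [P [D [h1 h2 h3 h4]]].
exists (fun th => P th * E th), (fun th => D th * E th); split.
- exact: polynomial_on_mul.
- exact: polynomial_on_mul.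
- exact: mulf_neq0.
- move=> th; rewrite mulf_eq0 negb_or => /andP[d d']; rewrite -g3 // h4 //.
  by field; rewrite d d'.
Qed.

Lemma regular_eq k a f g : (forall th, f th = g th) -> regular k a f -> regular k a g.
Proof. by move=> /funext ->. Qed.

Lemma regular_opp k a f : regular k a f -> regular k a (fun th => - f th).
Proof.
move=> h; apply: (@regular_eq _ _ (fun th => -1 * f th)).
  by move=> th; rewrite mulN1r.
by apply: regular_mul => //; exact: regular_const.
Qed.

Lemma regular_sub k a f g : regular k a f -> regular k a g ->
  regular k a (fun th => f th - g th).
Proof. by move=> hf hg; apply: regular_add => //; exact: regular_opp. Qed.

Lemma regular_div k a f g : g a != 0 -> regular k a f -> regular k a g ->
  regular k a (fun th => f th / g th).
Proof. by move=> g0 hf hg; apply: regular_mul => //; exact: regular_inv. Qed.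

Lemma regular_sum (T : Type) (s : seq T) (p : pred T) k a (F : T -> jet R m -> R) :
  (forall i, regular k a (F i)) -> regular k a (fun th => \sum_(i <- s | p i) F i th).
Proof.
move=> h; elim: s => [|i s hs].
  by under eq_fun do rewrite big_nil; exact: regular_const.
under eq_fun do rewrite big_cons; case: (p i) => //.
exact: regular_add.
Qed.

Lemma regular_prod (T : Type) (s : seq T) (p : pred T) k a (F : T -> jet R m -> R) :
  (forall i, regular k a (F i)) -> regular k a (fun th => \prod_(i <- s | p i) F i th).
Proof.
move=> h; elim: s => [|i s hs].
  by under eq_fun do rewrite big_nil; exact: regular_const.
under eq_fun do rewrite big_cons; case: (p i) => //.
exact: regular_mul.
Qed.

Lemma regular_near k a f : regular k a f -> znbhd k a (fun th => regular k th f).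
Proof.
move=> [P [D [h1 h2 h3 h4]]]; exists D; split=> // th d.
by exists P, D.
Qed.

Lemma regular_neq0 k a f : regular k a f -> f a != 0 -> znbhd k a (fun th => f th != 0).
Proof.
move=> [P [D [h1 h2 h3 h4]]] fa.
have Pa : P a != 0 by apply: contraNneq fa => e; rewrite h4 // e mul0r.
exists (fun th => P th * D th); split; first exact: polynomial_on_mul.
  exact: mulf_neq0.
move=> th; rewrite mulf_eq0 negb_or => /andP[d d']; rewrite h4 //.
by rewrite mulf_neq0 // invr_neq0.
Qed.

Lemma regular_cdiff_quot k a f P D : polynomial_on k P -> polynomial_on k D ->
  D a != 0 -> (forall th, D th != 0 -> f th = P th / D th) ->
  cdiff f a /\ forall v, dd f a v = (D a * dd P a v - P a * dd D a v) / (D a) ^+ 2.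
Proof.
move=> h1 h2 h3 h4.
have c1 := cdiff_polynomial_on a h1.
have c2 := cdiff_polynomial_on a h2.
have [c3 e3] := cdiff_inv h3 c2.
have [c4 e4] := cdiff_mul c1 c3.
have [|c5 e5] := @cdiff_ext _ _ (fun th => P th / D th) f k a _ c4.
  by exists D; split=> // th /h4 ->.
split=> // v; rewrite e5 e4 e3; by field.
Qed.

Lemma regular_cdiff k a f : regular k a f -> cdiff f a.
Proof.
by move=> [P [D [h1 h2 h3 h4]]]; case: (regular_cdiff_quot h1 h2 h3 h4).
Qed.

Definition jeqk k th th' := forall z : jvar m, (jord z <= k)%N -> th z = th' z.

Lemma dd_polynomial_jeqk k f th th' v v' : polynomial_on k f ->
  jeqk k th th' -> jeqk k v v' -> dd f th v = dd f th' v'.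
Proof.
move=> hf h1 h2; rewrite unlock; congr (derive1 _ 0); apply/funext => t.
apply: polynomial_on_eq hf _ => z hz; by rewrite /jline h1 ?h2.
Qed.

(** The coordinates of order > k of a jet, or of a direction at it, may be changed
    freely: this is used to compute derivatives at the base jet on simpler jets. *)
Lemma regular_jeqk k f th th' : regular k th f -> jeqk k th th' ->
  [/\ regular k th' f, f th' = f th &
      forall v v', jeqk k v v' -> dd f th v = dd f th' v'].
Proof.
move=> [P [D [h1 h2 h3 h4]]] h.
have eP := polynomial_on_eq h1 h; have eD := polynomial_on_eq h2 h.
have h3' : D th' != 0 by rewrite -eD.
split; first by exists P, D.
  by rewrite !h4 // eP eD.
move=> v v' hv.
have [_ ->] := regular_cdiff_quot h1 h2 h3 h4.
have [_ ->] := regular_cdiff_quot h1 h2 h3' h4.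
by rewrite eP eD (dd_polynomial_jeqk h1 h hv) (dd_polynomial_jeqk h2 h hv).
Qed.

Definition dtot (i : 'I_m) f : jet R m -> R := fun th => dd f th (total_dir th i).

Lemma polynomial_on_dtot k i f : polynomial_on k f -> polynomial_on k.+1 (dtot i f).
Proof.
suff H : polynomial_on k f -> (forall th, cdiff f th) /\ (polynomial_on k f) /\
    polynomial_on k.+1 (dtot i f) by move=> /H[_ []].
have hle g : polynomial_on k g -> polynomial_on k.+1 g by exact: polynomial_on_le.
move: f; apply: polynomial_on_ind.
- move=> x; split=> [th|]; first exact: (cdiff_const _ _).1.
  split; first exact: polynomial_on_const.
  apply: polynomial_on_ext (polynomial_on_const _ _ 0) => th.
  by rewrite /dtot (cdiff_const _ _).2.
- move=> z hz; split=> [th|]; first exact: (cdiff_var _ _).1.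
  split; first exact: polynomial_on_var.
  apply: (@polynomial_on_ext _ _ _ (fun th => total_dir th i z)) => [th|].
    by rewrite /dtot (cdiff_var _ _).2.
  case: z hz => [j|s] /= hz; first exact: polynomial_on_const.
  by apply: polynomial_on_var; rewrite /= mdegD mdeg1 addn1.
- move=> f g [f1 [f2 f3]] [g1 [g2 g3]]; split=> [th|]; first exact: (cdiff_add _ _).1.
  split; first exact: polynomial_on_add.
  apply: polynomial_on_ext (polynomial_on_add f3 g3) => th.
  by rewrite /dtot (cdiff_add _ _).2.
- move=> f g [f1 [f2 f3]] [g1 [g2 g3]]; split=> [th|]; first exact: (cdiff_mul _ _).1.
  split; first exact: polynomial_on_mul.
  apply: polynomial_on_ext (polynomial_on_add (polynomial_on_mul (hle _ f2) g3)
    (polynomial_on_mul (hle _ g2) f3)) => th.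
  by rewrite /dtot (cdiff_mul _ _).2.
Qed.

Lemma regular_dtot k a i f : regular k a f -> regular k.+1 a (dtot i f).
Proof.
move=> [P [D [h1 h2 h3 h4]]].
have hle g : polynomial_on k g -> polynomial_on k.+1 g by exact: polynomial_on_le.
exists (fun th => D th * dtot i P th + - (P th * dtot i D th)), (fun th => D th * D th).
split.
- by apply: polynomial_on_add; [|apply: polynomial_on_opp]; apply: polynomial_on_mul;
    auto; apply: polynomial_on_dtot.
- by apply: polynomial_on_mul; auto.
- exact: mulf_neq0.
- move=> th; rewrite mulf_eq0 orbb => d.
  by rewrite /dtot (regular_cdiff_quot h1 h2 d h4).2 expr2.
Qed.

Lemma cdiff_lin (T : Type) (s : seq T) (x : T -> R) (w : T -> jet R m) f th : cdiff f th ->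
  dd f th (fun z => \sum_(i <- s) x i * w i z) = \sum_(i <- s) x i * dd f th (w i).
Proof.
move=> [h _].
have h0 : dd f th (fun=> 0) = 0.
  have := h 1 (fun=> 0) (fun=> 0).
  under eq_fun do rewrite mulr0 addr0.
  by set y := dd _ _ _; lra.
elim: s => [|i s hs].
  by under eq_fun do rewrite big_nil; rewrite big_nil.
by under eq_fun do rewrite big_cons; rewrite big_cons h hs.
Qed.

Lemma horizontal_dd (b : jet R m -> 'I_m -> R) f th :
  horizontal b f th = dd f th (fun z => \sum_i b th i * total_dir th i z).
Proof. by rewrite unlock. Qed.

Lemma horizontalE (b : jet R m -> 'I_m -> R) f th : cdiff f th ->
  horizontal b f th = \sum_i b th i * dtot i f th.
Proof.
move=> h; rewrite horizontal_dd.
exact: (cdiff_lin (index_enum 'I_m) (b th) (total_dir th) h).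
Qed.

Lemma regular_horizontal k a (b : jet R m -> 'I_m -> R) f :
  regular k a f -> (forall i, regular k.+1 a (b ^~ i)) -> regular k.+1 a (horizontal b f).
Proof.
move=> hf ha; apply: (@regular_ext _ _ (fun th => \sum_i b th i * dtot i f th)).
  apply: znbhdW (regular_near hf) => // th h.
  by rewrite horizontalE //; exact: regular_cdiff h.
apply: regular_sum => i; apply: regular_mul => //; exact: regular_dtot.
Qed.

Lemma dtot_var i z th : dtot i (fun th => th z) th = total_dir th i z.
Proof. by rewrite /dtot (cdiff_var _ _).2. Qed.

Lemma dtot_add i f g th : cdiff f th -> cdiff g th ->
  dtot i (fun th => f th + g th) th = dtot i f th + dtot i g th.
Proof. by move=> h1 h2; rewrite /dtot (cdiff_add h1 h2).2. Qed.

Lemma dtot_mul i f g th : cdiff f th -> cdiff g th ->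
  dtot i (fun th => f th * g th) th = f th * dtot i g th + g th * dtot i f th.
Proof. by move=> h1 h2; rewrite /dtot (cdiff_mul h1 h2).2. Qed.

Lemma dtot_ext k i f g th : znbhd k th (fun th => f th = g th) -> cdiff f th ->
  dtot i f th = dtot i g th.
Proof. by move=> h1 h2; rewrite /dtot (cdiff_ext h1 h2).2. Qed.

Lemma dtotE i f th : dtot i f th = dd f th (total_dir th i).
Proof. by []. Qed.

Lemma dtot_comm_polynomial k i j f th : polynomial_on k f ->
  dtot i (dtot j f) th = dtot j (dtot i f) th.
Proof.
suff H : polynomial_on k f -> polynomial_on k f /\
    forall th, dtot i (dtot j f) th = dtot j (dtot i f) th by move=> /H[_].
have cd l g : polynomial_on l g -> forall th, cdiff g th.
  by move=> h th'; exact: cdiff_polynomial_on h.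
move: f; apply: polynomial_on_ind => [x|z hz|f g [f1 f2] [g1 g2]|f g [f1 f2] [g1 g2]].
- split=> [|th']; first exact: polynomial_on_const.
  have e l : dtot l (fun=> x) = fun=> 0.
    by apply/funext => th''; rewrite dtotE (cdiff_const _ _).2.
  by rewrite !e !dtotE !(cdiff_const _ _).2.
- split=> [|th']; first exact: polynomial_on_var.
  have e l : dtot l (fun th => th z) = fun th => total_dir th l z.
    by apply/funext => th''; rewrite dtot_var.
  rewrite (e i) (e j); case: z {hz e} => [q|s] /=.
    by rewrite !dtotE !(cdiff_const _ _).2.
  by rewrite !dtot_var /= -!addmA [(U_(j) + _)%MM]addmC.
- split=> [|th']; first exact: polynomial_on_add.
  have e l : dtot l (fun th => f th + g th) = fun th => dtot l f th + dtot l g th.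
    by apply/funext => th''; rewrite (@dtot_add l f g) //; exact: (cd k).
  have cf l : cdiff (dtot l f) th' by apply: (cd k.+1); apply: polynomial_on_dtot.
  have cg l : cdiff (dtot l g) th' by apply: (cd k.+1); apply: polynomial_on_dtot.
  rewrite (e i) (e j) (@dtot_add i (dtot j f) (dtot j g)) // (@dtot_add j (dtot i f) (dtot i g)) //.
  by rewrite f2 g2.
- split=> [|th']; first exact: polynomial_on_mul.
  have e l : dtot l (fun th => f th * g th) =
             fun th => f th * dtot l g th + g th * dtot l f th.
    by apply/funext => th''; rewrite (@dtot_mul l f g) //; exact: (cd k).
  have cf l : polynomial_on k.+1 (dtot l f) by apply: polynomial_on_dtot.
  have cg l : polynomial_on k.+1 (dtot l g) by apply: polynomial_on_dtot.
  have hle (p : jet R m -> R) : polynomial_on k p -> polynomial_on k.+1 p by exact: polynomial_on_le.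
  have cF := cd _ _ (hle _ f1) th'; have cG := cd _ _ (hle _ g1) th'.
  have cFl l := cd _ _ (cf l) th'; have cGl l := cd _ _ (cg l) th'.
  have E l l' : dtot l (dtot l' (fun th => f th * g th)) th' =
    f th' * dtot l (dtot l' g) th' + dtot l' g th' * dtot l f th'
    + (g th' * dtot l (dtot l' f) th' + dtot l' f th' * dtot l g th').
    rewrite e (@dtot_add l (fun th => f th * dtot l' g th) (fun th => g th * dtot l' f th)).
    - by rewrite (@dtot_mul l f (dtot l' g)) // (@dtot_mul l g (dtot l' f)).
    - exact: (cdiff_mul cF (cGl l')).1.
    - exact: (cdiff_mul cG (cFl l')).1.
  by rewrite !E f2 g2; ring.
Qed.

(** For f = P / D, the equation D_i D_j P = D_j D_i P is expanded by the product rule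
    from P = f D, and all terms but D (D_i D_j f - D_j D_i f) cancel. *)
Lemma dtot_comm k i j f th : regular k th f ->
  dtot i (dtot j f) th = dtot j (dtot i f) th.
Proof.
move=> hf; have [P [D [h1 h2 h3 h4]]] := hf.
have hD := cdiff_polynomial_on th h2.
have cf l : znbhd k.+1 th (fun th => dtot l P th = f th * dtot l D th + D th * dtot l f th).
  exists D; split=> //; first exact: polynomial_on_le h2.
  move=> th' d; rewrite -dtot_mul; last 2 first.
  - by case: (regular_cdiff_quot h1 h2 d h4).
  - exact: cdiff_polynomial_on h2.
  apply: (@dtot_ext k); last exact: cdiff_polynomial_on h1.
  exists D; split=> // th'' d''; rewrite h4 //; by rewrite mulfVK.
have cdt g k' l : regular k' th g -> cdiff (dtot l g) th.
  by move=> /(regular_dtot l)/regular_cdiff.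
have hrP := regular_polynomial th h1; have hrD := regular_polynomial th h2.
have e i1 i2 : dtot i1 (dtot i2 P) th =
   dtot i2 D th * dtot i1 f th + f th * dtot i1 (dtot i2 D) th
   + (dtot i2 f th * dtot i1 D th + D th * dtot i1 (dtot i2 f) th).
  have cF := regular_cdiff hf.
  have cDF := (cdiff_mul cF (cdt _ _ i2 hrD)).1.
  have cFD := (cdiff_mul hD (cdt _ _ i2 hf)).1.
  rewrite (dtot_ext i1 (cf i2) (cdt _ _ _ hrP)).
  rewrite (@dtot_add i1 (fun th => f th * dtot i2 D th) (fun th => D th * dtot i2 f th)) //.
  rewrite (@dtot_mul i1 f (dtot i2 D)) ?(@dtot_mul i1 D (dtot i2 f)) //; last 2 first.
  - exact: cdt hf.
  - exact: cdt hrD.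
  by ring.
have := dtot_comm_polynomial i j th h1; rewrite !e (dtot_comm_polynomial i j th h2) => E.
apply: (mulfI h3); move: E; lra.
Qed.

Definition ratfun f := exists k a, regular k a f.

Lemma rational_onP k f : rational_on k f <-> exists a, regular k a f.
Proof.
split=> [[P [D [h1 h2 [a h3] h4]]]|[a [P [D [h1 h2 h3 h4]]]]].
  by exists a, P, D.
by exists P, D; split=> //; exists a.
Qed.

Lemma ratfun_generic f : ratfun f -> generic (fun th => exists k, regular k th f).
Proof.
move=> [k [a h]]; apply: (@znbhd_generic _ _ k a).
by apply: znbhdS (regular_near h) => th; exists k.
Qed.

Lemma ratfun2 f g : ratfun f -> ratfun g ->
  generic (fun th => exists k, regular k th f /\ regular k th g).
Proof.
move=> /ratfun_generic hf /ratfun_generic hg; apply: genericS (genericI hf hg) => th.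
move=> [[k h] [l h']]; exists (maxn k l); split.
  by apply: regular_le h; exact: leq_maxl.
by apply: regular_le h'; exact: leq_maxr.
Qed.

Lemma ratfun_const x : ratfun (fun=> x).
Proof. by exists 0%N, (fun=> 0); exact: regular_const. Qed.

Lemma ratfun_add f g : ratfun f -> ratfun g -> ratfun (fun th => f th + g th).
Proof.
move=> hf hg; have [a [k [h1 h2]]] := generic_ex (ratfun2 hf hg).
by exists k, a; exact: regular_add.
Qed.

Lemma ratfun_mul f g : ratfun f -> ratfun g -> ratfun (fun th => f th * g th).
Proof.
move=> hf hg; have [a [k [h1 h2]]] := generic_ex (ratfun2 hf hg).
by exists k, a; exact: regular_mul.
Qed.

Lemma generic_maxn (A B : nat -> jet R m -> Prop) :
  (forall k l th, (k <= l)%N -> A k th -> A l th) ->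
  (forall k l th, (k <= l)%N -> B k th -> B l th) ->
  generic (fun th => exists k, A k th) -> generic (fun th => exists k, B k th) ->
  generic (fun th => exists k, A k th /\ B k th).
Proof.
move=> hA hB h1 h2; apply: genericS (genericI h1 h2) => th.
move=> [[k h] [l h']]; exists (maxn k l); split.
  by apply: hA h; exact: leq_maxl.
by apply: hB h'; exact: leq_maxr.
Qed.

Lemma ratfun_ext f g : generic (fun th => f th = g th) -> ratfun f -> ratfun g.
Proof.
move=> /generic_point h /ratfun_generic hf.
have [a [k [h1 h2]]] := generic_ex (generic_maxn
  (fun k l th hkl hk => regular_le hkl hk)
  (fun k l th hkl hk => znbhdW hkl (fun _ x => x) hk) hf h).
by exists k, a; exact: regular_ext h1.
Qed.

(** A rational function is either zero or invertible in the field of rational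
    functions, its inverse being defined generically. *)
Lemma ratfun_dichotomy f : ratfun f ->
  generic (fun th => f th = 0) \/ generic (fun th => f th != 0).
Proof.
move=> [k [a [P [D [h1 h2 h3 h4]]]]].
have [h|] := pselect (exists b, P b != 0).
  have [b Pb] := h; right.
  have [c [c1 c2]] := polynomial_on_neq0 h1 h2 Pb h3.
  apply: (@znbhd_generic _ _ k c); apply: regular_neq0; first by exists P, D.
  by rewrite h4 // mulf_neq0 // invr_neq0.
move=> h; left; apply: (@znbhd_generic _ _ k a); exists D; split=> // th d.
rewrite h4 //; suff -> : P th = 0 by rewrite mul0r.
by apply/eqP/negPn/negP => p; apply: h; exists th.
Qed.

Lemma ratfun_neq0 k a f : regular k a f -> f a != 0 -> generic (fun th => f th != 0).
Proof. by move=> h1 h2; apply: (@znbhd_generic _ _ k a); exact: regular_neq0. Qed.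

Lemma ratfun_inv f : ratfun f -> ratfun (fun th => (f th)^-1).
Proof.
move=> hf; case: (ratfun_dichotomy hf) => h.
  by apply: ratfun_ext (ratfun_const 0); apply: genericS h => th ->; rewrite invr0.
have [a [[k h1] h2]] := generic_ex (genericI (ratfun_generic hf) h).
by exists k, a; exact: regular_inv.
Qed.

End Rational.

(** * Order of vanishing and composition of polynomials *)

Section Vanishing.
Local Open Scope ring_scope.
Variables (R : realType) (m : nat).
Implicit Types (p q : {mpoly R[m]}) (x y : 'I_m -> R).

(** Membership of the k-th power of the maximal ideal at x. The recursion on the
    first derivatives fits the recursive chain rule below. *)
Fixpoint van x k p : Prop :=
  match k with
  | 0 => True
  | k'.+1 => p.@[x] = 0 /\ forall j, van x k' p^`M(j)
  end.

Lemma vanS x k p : van x k.+1 p -> van x k p.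
Proof. by elim: k p => // k IH p [h1 h2]; split=> // j; apply: IH. Qed.

Lemma van_le x k l p : (k <= l)%N -> van x l p -> van x k p.
Proof.
by elim: l => [|l IH]; rewrite leq_eqVlt => /orP[/eqP ->|] // /IH h /vanS /h.
Qed.

Lemma van0 x k : van x k 0.
Proof. by elim: k => //= k IH; rewrite meval0; split=> // j; rewrite mderiv0. Qed.

Lemma vanD x k p q : van x k p -> van x k q -> van x k (p + q).
Proof.
elim: k p q => //= k IH p q [h1 h2] [g1 g2]; split; first by rewrite mevalD h1 g1 addr0.
by move=> j; rewrite mderivD; apply: IH.
Qed.

Lemma vanMr x k p q : van x k p -> van x k (p * q).
Proof.
elim: k p q => // k IH p q h; have h' := vanS h; case: h => h1 h2.
split; first by rewrite mevalM h1 mul0r.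
move=> j; rewrite mderivM; apply: vanD; apply: IH => //; exact: h2.
Qed.

Lemma vanMl x k p q : van x k q -> van x k (p * q).
Proof. by rewrite mulrC; exact: vanMr. Qed.

Lemma vanN x k p : van x k p -> van x k (- p).
Proof. by move=> h; rewrite -mulN1r; exact: vanMl. Qed.

Lemma vanB x k p q : van x k p -> van x k q -> van x k (p - q).
Proof. by move=> h1 h2; apply: vanD => //; apply: vanN. Qed.

Lemma van_sum (T : Type) (s : seq T) (P : pred T) x k (F : T -> {mpoly R[m]}) :
  (forall i, van x k (F i)) -> van x k (\sum_(i <- s | P i) F i).
Proof. by move=> h; elim/big_ind: _ => //; [exact: van0|exact: vanD]. Qed.

Lemma vanM x a b p q : van x a p -> van x b q -> van x (a + b) (p * q).
Proof.
have [N hN] : exists N, (a + b <= N)%N by exists (a + b)%N.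
elim: N a b hN p q => [|N IH] [|a] [|b] // hN p q.
- by move=> _; rewrite add0n; exact: vanMl.
- by rewrite addn0 => h _; exact: vanMr.
- move=> hp hq; rewrite addSn; split; first by rewrite mevalM hp.1 mul0r.
  move=> j; rewrite mderivM; apply: vanD.
    by apply: IH (hp.2 j) hq; rewrite addSn in hN.
  by rewrite -addSnnS; apply: IH hp (hq.2 j); rewrite addSnnS.
Qed.

(** A polynomial not vanishing at x is a unit modulo the powers of the maximal ideal. *)
Lemma van_cancel x k p q : p.@[x] != 0 -> van x k (p * q) -> van x k q.
Proof.
move=> p0; elim: k q => // k IH q h; have h' := IH _ (vanS h); case: h => h1 h2.
split; first by move: h1; rewrite mevalM => /eqP; rewrite mulf_eq0 (negbTE p0) => /eqP.
move=> j; apply: IH.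
have := h2 j; rewrite mderivM => h3.
have -> : p * q^`M(j) = p^`M(j) * q + p * q^`M(j) - p^`M(j) * q by ring.
by apply: vanB => //; exact: vanMl.
Qed.

Lemma vanP x k p : van x k.+1 p <->
  forall s : 'X_{1..m}, (mdeg s <= k)%N -> (p^`M[s]).@[x] = 0.
Proof.
elim: k p => [|k IH] p.
  split=> [[h _] s|h].
    by rewrite leqn0 mdeg_eq0 => /eqP ->; rewrite mderivm0m.
  by split=> //; have := h 0%MM; rewrite mdeg0 mderivm0m; apply.
split=> [[h1 h2] s hs|h].
  have [->|s0] := eqVneq s 0%MM; first by rewrite mderivm0m.
  have [i hi] : exists i, (s i != 0)%N.
    apply: contrapT => hn; case/eqP: s0; apply/mnmP => i; rewrite mnm0E.
    by apply/eqP/negPn/negP => hi; apply: hn; exists i.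
  have e : s = (U_(i) + (s - U_(i)))%MM.
    by rewrite addmC submK // lep1mP.
  rewrite e mderivmDm mderivmU1m; apply: (IH _).1; first exact: h2.
  by move: hs; rewrite {1}e mdegD mdeg1 add1n ltnS.
split; first by have := h 0%MM; rewrite mdeg0 mderivm0m; apply.
move=> j; apply/IH => s hs; rewrite -mderivmU1m -mderivmDm; apply: h.
by rewrite mdegD mdeg1 add1n ltnS.
Qed.

End Vanishing.

Section Composition.
Local Open Scope ring_scope.
Variables (R : realType).

Lemma mderiv_comp n m (p : {mpoly R[n]}) (F : n.-tuple {mpoly R[m]}) j :
  (p \mPo F)^`M(j) = \sum_i (p^`M(i) \mPo F) * (tnth F i)^`M(j).
Proof.
elim/mpoly_alg_ind: p => [a|i|p q hp hq|p q hp hq].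
- rewrite comp_mpolyC mderivC big1 // => i _.
  by rewrite mderivC comp_mpoly0 mul0r.
- rewrite comp_mpolyXU -tnth_nth (bigD1 i) //= big1 ?addr0.
    have -> : ('X_i : {mpoly R[n]})^`M(i) = 1.
      by rewrite mderivX mnm1E eqxx scale1r -mpolyX0; congr 'X_[_]; apply/mnmP => k;
         rewrite mnmBE subnn mnm0E.
    by rewrite comp_mpoly1 mul1r.
  move=> k ki; rewrite mderivX mnm1E eq_sym (negbTE ki) scale0r comp_mpoly0 mul0r //.
- rewrite comp_mpolyD mderivD hp hq -big_split /=; apply: eq_bigr => i _.
  by rewrite mderivD comp_mpolyD mulrDl.
- rewrite rmorphM /= mderivM hp hq big_distrl big_distrr -big_split /=.
  apply: eq_bigr => i _.
  by rewrite mderivM rmorphD !rmorphM /=; ring.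
Qed.

Lemma van_comp n m (p : {mpoly R[n]}) (F : n.-tuple {mpoly R[m]}) x y k :
  (forall i, y i = (tnth F i).@[x]) -> van y k p -> van x k (p \mPo F).
Proof.
move=> hy; elim: k p => //= k IH p [h1 h2]; split.
  rewrite comp_mpoly_meval -h1; apply: meval_eq => i; by rewrite hy.
move=> j; rewrite mderiv_comp; apply: van_sum => i; apply: vanMr; apply: IH; exact: h2.
Qed.

Lemma van_comp_sub n m (p : {mpoly R[n]}) (F G : n.-tuple {mpoly R[m]}) x k :
  (forall i, van x k (tnth F i - tnth G i)) -> van x k ((p \mPo F) - (p \mPo G)).
Proof.
move=> h; elim/mpoly_alg_ind: p => [a|i|p q hp hq|p q hp hq].
- by rewrite !comp_mpolyC subrr; exact: van0.
- by rewrite !comp_mpolyXU -!tnth_nth.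
- rewrite !comp_mpolyD.
  have -> : (p \mPo F) + (q \mPo F) - ((p \mPo G) + (q \mPo G)) =
    ((p \mPo F) - (p \mPo G)) + ((q \mPo F) - (q \mPo G)) by ring.
  exact: vanD.
- rewrite !rmorphM /=.
  have -> : (p \mPo F) * (q \mPo F) - (p \mPo G) * (q \mPo G) =
    ((p \mPo F) - (p \mPo G)) * (q \mPo F) + (p \mPo G) * ((q \mPo F) - (q \mPo G)) by ring.
  by apply: vanD; [exact: vanMr|exact: vanMl].
Qed.

(** F is the identity to first order at x, so composing with it changes the
    Taylor expansion of p only one order higher. *)
Lemma van_comp_id m (p : {mpoly R[m]}) (F : m.-tuple {mpoly R[m]}) x k :
  (forall i, van x 2 (tnth F i - 'X_i)) -> van x k p -> van x k.+1 ((p \mPo F) - p).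
Proof.
move=> hF.
have hx i : x i = (tnth F i).@[x].
  by have := (hF i).1; rewrite mevalB mevalXU => /eqP; rewrite subr_eq0 => /eqP.
elim: k p => [|k IH] p.
  move=> _; split=> //; rewrite mevalB comp_mpoly_meval.
  by apply/eqP; rewrite subr_eq0; apply/eqP/meval_eq => i; rewrite -hx.
move=> [h1 h2]; split.
  rewrite mevalB comp_mpoly_meval; apply/eqP; rewrite subr_eq0; apply/eqP/meval_eq => i.
  by rewrite -hx.
move=> j; rewrite mderivB mderiv_comp.
have -> : \sum_i (p^`M(i) \mPo F) * (tnth F i)^`M(j) - p^`M(j) =
  \sum_i (p^`M(i) \mPo F) * (tnth F i - 'X_i)^`M(j) + ((p^`M(j) \mPo F) - p^`M(j)).
  have -> : \sum_i (p^`M(i) \mPo F) * (tnth F i - 'X_i)^`M(j) =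
     \sum_i (p^`M(i) \mPo F) * (tnth F i)^`M(j) - \sum_i (p^`M(i) \mPo F) * ('X_i)^`M(j).
    by rewrite -sumrB; apply: eq_bigr => i _; rewrite mderivB mulrBr.
  have -> : \sum_i (p^`M(i) \mPo F) * ('X_i)^`M(j) = p^`M(j) \mPo F.
    rewrite (bigD1 j) //= big1 ?addr0.
      have -> : ('X_j : {mpoly R[m]})^`M(j) = 1.
        by rewrite mderivX mnm1E eqxx scale1r -mpolyX0; congr 'X_[_]; apply/mnmP => k';
           rewrite mnmBE subnn mnm0E.
      by rewrite mulr1.
    by move=> i ij; rewrite mderivX mnm1E (negbTE ij) scale0r mulr0.
  by ring.
apply: vanD; last by apply: IH; exact: h2.
apply: van_sum => i; rewrite -addn1; apply: vanM.
  by apply: van_comp (h2 i).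
exact: (hF i).2.
Qed.

Lemma comp_mpolyA n m k (p : {mpoly R[n]}) (F : n.-tuple {mpoly R[m]})
    (G : m.-tuple {mpoly R[k]}) :
  (p \mPo F) \mPo G = p \mPo [tuple (tnth F i) \mPo G | i < n].
Proof.
elim/mpoly_alg_ind: p => [a|i|u v hu hv|u v hu hv].
- by rewrite !comp_mpolyC.
- by rewrite !comp_mpolyXU -!tnth_nth [RHS]tnth_mktuple.
- by rewrite !comp_mpolyD hu hv.
- by rewrite !rmorphM /= hu hv.
Qed.

(** By the chain rule the gradient of p o F is that of p, composed with F, times
    the Jacobian matrix of F, whose determinant can be cancelled at x. *)
Lemma van_comp_inj m (p : {mpoly R[m]}) (F : m.-tuple {mpoly R[m]}) x y k :
  (forall i, y i = (tnth F i).@[x]) ->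
  \matrix_(i, j) ((tnth F i)^`M(j)).@[x] \in unitmx ->
  van x k (p \mPo F) -> van y k p.
Proof.
move=> hy hJ; elim: k p => // k IH p [h1 h2]; split.
  by rewrite -h1 comp_mpoly_meval; apply: meval_eq.
move=> a; apply: IH.
pose J : 'M[{mpoly R[m]}]_m := \matrix_(i, j) (tnth F i)^`M(j).
have dJ : (\det J).@[x] != 0.
  move: hJ; rewrite unitmxE unitfE; apply: contra_neq => h0.
  rewrite -[RHS]h0 -[RHS](det_map_mx (meval x)); congr (\det _).
  by apply/matrixP => i j; rewrite !mxE.
apply: (van_cancel dJ).
have -> : \det J * (p^`M(a) \mPo F) = \sum_j (p \mPo F)^`M(j) * (\adj J) j a.
  have := congr1 (fun M : 'M_m => ((\row_i (p^`M(i) \mPo F)) *m M) 0 a) (mul_mx_adj J).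
  rewrite mulmxA mul_mx_scalar !mxE => <-.
  apply: eq_bigr => j _; rewrite mderiv_comp !mxE; congr (_ * _).
  by apply: eq_bigr => i _; rewrite !mxE.
by apply: van_sum => j; apply: vanMr; exact: h2.
Qed.

(** The inverse function theorem for Taylor expansions. An error r = p o F - q of
    order k is corrected by subtracting r o G from p, with G the affine map inverse
    to F to first order: by [van_comp_id], r o G o F - r has order k + 1. *)
Lemma van_comp_surj m (q : {mpoly R[m]}) (F : m.-tuple {mpoly R[m]}) x k :
  \matrix_(i, j) ((tnth F i)^`M(j)).@[x] \in unitmx ->
  exists p : {mpoly R[m]}, van x k ((p \mPo F) - q).
Proof.
move=> hJ; elim: k => [|k [p hp]]; first by exists 0.
pose y i := (tnth F i).@[x].
pose K := invmx (\matrix_(i, j) ((tnth F i)^`M(j)).@[x]).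
pose G : m.-tuple {mpoly R[m]} :=
  [tuple (x i)%:MP + \sum_j (K i j)%:MP * ('X_j - (y j)%:MP) | i < m].
pose r := (p \mPo F) - q.
pose H : m.-tuple {mpoly R[m]} := [tuple tnth G i \mPo F | i < m].
exists (p - (r \mPo G)).
have eH : (r \mPo G) \mPo F = (r \mPo H) by exact: comp_mpolyA.
have -> : ((p - (r \mPo G)) \mPo F) - q = - ((r \mPo H) - r).
  by rewrite comp_mpolyB eH /r; ring.
apply/vanN/van_comp_id => // i; rewrite !tnth_mktuple.
have eHi : (tnth G i) \mPo F = (x i)%:MP + \sum_j (K i j)%:MP * (tnth F j - (y j)%:MP).
  rewrite tnth_mktuple comp_mpolyD comp_mpolyC; congr (_ + _).
  rewrite raddf_sum /=; apply: eq_bigr => j _.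
  by rewrite rmorphM /= comp_mpolyC comp_mpolyB comp_mpolyC comp_mpolyXU -tnth_nth.
move: eHi; rewrite tnth_mktuple => ->; split.
  rewrite mevalB mevalD mevalXU mevalC raddf_sum /= big1 ?addr0 ?subrr // => j _.
  by rewrite mevalM mevalB !mevalC subrr mulr0.
move=> j; split=> //.
rewrite mderivB mderivD mderivC add0r raddf_sum /= mevalB raddf_sum /=.
have := congr1 (fun M : 'M_m => M i j) (mulVmx hJ); rewrite !mxE => e.
have -> : (('X_i : {mpoly R[m]})^`M(j)).@[x] = (i == j)%:R.
  rewrite mderivX mnm1E mevalZ.
  have [->|ij] := eqVneq i j; last by rewrite mul0r.
  by rewrite mul1r -[RHS](meval1 x) -mpolyX0; congr ('X_[_].@[_]); apply/mnmP => k';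
    rewrite mnmBE subnn mnm0E.
rewrite -e; apply/eqP; rewrite subr_eq0; apply/eqP; apply: eq_bigr => l _.
by rewrite mderivM mderivC mul0r add0r mderivB mderivC subr0 mevalM mevalC !mxE.
Qed.

End Composition.

(** * Jets of polynomials *)

Section JetsOfPolynomials.
Local Open Scope ring_scope.
Variables (R : realType) (m : nat).
Implicit Types (f p : {mpoly R[m]}) (x : 'I_m -> R).

Definition jetf f x : jet R m :=
  fun z => match z with inl i => x i | inr s => (f^`M[s]).@[x] end.

Lemma mderiv_XU (i j : 'I_m) : ('X_i : {mpoly R[m]})^`M(j) = (i == j)%:R%:MP.
Proof.
rewrite mderivX mnm1E; have [->|ij] := eqVneq i j; last by rewrite scale0r mpolyC0.
rewrite scale1r mpolyC1 -mpolyX0; congr 'X_[_]; apply/mnmP => k.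
by rewrite mnmBE subnn mnm0E.
Qed.

Lemma is_derive_meval p x j : is_derive (0 : R) (1 : R)
  (fun t : R => p.@[fun i => x i + t * (i == j)%:R]) (p^`M(j)).@[x].
Proof.
have e0 q : q.@[fun i => x i + 0 * (i == j)%:R] = q.@[x] :> R.
  by apply: meval_eq => i; rewrite mul0r addr0.
elim/mpoly_alg_ind: p => [a|i|p q hp hq|p q hp hq].
- under eq_fun do rewrite mevalC; rewrite mderivC meval0; exact: is_derive_cst.
- under eq_fun do rewrite mevalXU; rewrite mderiv_XU mevalC.
  have -> : (fun t : R => x i + t * (i == j)%:R) = cst (x i) + (i == j)%:R \*: id.
    by apply/funext => t; rewrite !fctE /= mulrC.
  by apply: is_derive_eq; rewrite add0r /GRing.scale /= mulr1.
- under eq_fun do rewrite mevalD; rewrite mderivD mevalD; exact: is_deriveD.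
- under eq_fun do rewrite mevalM.
  apply: is_derive_eq (is_deriveM hp hq) _.
  by rewrite !e0 mderivM mevalD !mevalM addrC mulrC.
Qed.

Lemma dcurve_jetf f x j :
  dcurve (fun t => jetf f (fun i => x i + t * (i == j)%:R)) (jetf f x)
         (total_dir (jetf f x) j).
Proof.
split=> [[i|s]|[i|s]] /=.
- by rewrite mul0r addr0.
- by apply: meval_eq => i; rewrite mul0r addr0.
- have -> : (fun t : R => x i + t * (i == j)%:R) = cst (x i) + (i == j)%:R \*: id.
    by apply/funext => t; rewrite !fctE /= mulrC.
  by apply: is_derive_eq; rewrite add0r /GRing.scale /= mulr1.
- rewrite mderivmDm mderivmU1m; exact: is_derive_meval.
Qed.

(** Differentiating along the graph of f is applying the total derivative to the
    jets of f: the curve of jets above a coordinate line has velocity [total_dir]. *)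
Lemma meval_dtot p (q : jet R m -> R) f x j : (forall y, p.@[y] = q (jetf f y)) ->
  cdiff q (jetf f x) -> (p^`M(j)).@[x] = dtot j q (jetf f x).
Proof.
move=> h [_ /(_ _ _ (dcurve_jetf f x j)) hd].
have := is_derive_meval p x j.
under eq_fun do rewrite h.
by move=> /(@derive_val _ _ _ _ _ _ _) <-; rewrite (@derive_val _ _ _ _ _ _ _ hd).
Qed.

Lemma meval_at0 p : p.@[fun=> 0] = p@_0.
Proof.
elim/mpoly_alg_ind: p => [a|i|p q hp hq|p q hp hq].
- by rewrite mevalC mcoeffC eqxx mulr1.
- by rewrite mevalXU mcoeffX mnm1_eq0.
- by rewrite mevalD mcoeffD hp hq.
- by rewrite mevalM hp hq -(rmorphM (mcoeff 0%MM)).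
Qed.

(** The Taylor polynomial. *)
Lemma jet_of_exists k (th : jet R m) : exists f, jet_of k f th.
Proof.
pose a (s : 'X_{1..m}) : R := th (inr s) / (\prod_(i < m) (s i)`!)%:R.
pose g : {mpoly R[m]} := \sum_(s : 'X_{1..m < k.+1}) a s *: 'X_[s].
pose T : m.-tuple {mpoly R[m]} := [tuple 'X_i - (jbase th i)%:MP | i < m].
exists (g \mPo T) => s hs.
have hT q i : (q \mPo T)^`M(i) = q^`M(i) \mPo T.
  rewrite mderiv_comp (bigD1 i) //= big1 ?addr0 => [|j ji];
    rewrite tnth_mktuple mderivB mderivC subr0 mderiv_XU.
    by rewrite eqxx mpolyC1 mulr1.
  by rewrite (negbTE ji) mpolyC0 mulr0.
have hTs q : (q \mPo T)^`M[s] = q^`M[s] \mPo T.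
  rewrite !mderivm_foldr; elim: (flatten _) => //= i l ->; exact: hT.
rewrite hTs comp_mpoly_meval.
under meval_eq do rewrite tnth_mktuple mevalB mevalXU mevalC subrr.
rewrite meval_at0 mcoeff_mderivm addm0 raddf_sum /=.
rewrite (bigD1 (BMultinom (hs : mdeg s < k.+1)%N)) //= big1 ?addr0 => [|s' hs'].
  rewrite mcoeffZ mcoeffX eqxx mulr1 /a.
  have -> : (\prod_(i < m) s i ^_ s i = \prod_(i < m) (s i)`!)%N.
    by apply: eq_bigr => i _; rewrite ffactnn.
  rewrite -[LHS]mulr_natr divfK // pnatr_eq0 -lt0n; apply/prodn_gt0 => i; exact: fact_gt0.
rewrite mcoeffZ mcoeffX; have [e|] := eqVneq (s' : 'X_{1..m}) s; last by rewrite mulr0.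
by case/eqP: hs'; apply/val_inj.
Qed.

End JetsOfPolynomials.

Section PolynomialClosure.
Local Open Scope ring_scope.
Variables (R : realType) (m : nat).

Lemma polynomial_on_sum (T : Type) (s : seq T) (p : pred T) k (F : T -> jet R m -> R) :
  (forall i, polynomial_on k (F i)) -> polynomial_on k (fun th => \sum_(i <- s | p i) F i th).
Proof.
move=> h; elim: s => [|i s hs].
  by under eq_fun do rewrite big_nil; exact: polynomial_on_const.
under eq_fun do rewrite big_cons; case: (p i) => //.
exact: polynomial_on_add.
Qed.

Lemma polynomial_on_prod (T : Type) (s : seq T) (p : pred T) k (F : T -> jet R m -> R) :
  (forall i, polynomial_on k (F i)) -> polynomial_on k (fun th => \prod_(i <- s | p i) F i th).
Proof.
move=> h; elim: s => [|i s hs].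
  by under eq_fun do rewrite big_nil; exact: polynomial_on_const.
under eq_fun do rewrite big_cons; case: (p i) => //.
exact: polynomial_on_mul.
Qed.

Lemma polynomial_on_exp k f e : polynomial_on k f ->
  polynomial_on k (fun th : jet R m => f th ^+ e).
Proof.
move=> h; elim: e => [|e he].
  by under eq_fun do rewrite expr0; exact: polynomial_on_const.
by under eq_fun do rewrite exprS; exact: polynomial_on_mul.
Qed.

Lemma polynomial_on_det k d (A : jet R m -> 'M[R]_d) :
  (forall i j, polynomial_on k (fun th => A th i j)) ->
  polynomial_on k (fun th => \det (A th)).
Proof.
move=> h; apply: polynomial_on_sum => s; apply: polynomial_on_mul.
  exact: polynomial_on_const.
by apply: polynomial_on_prod => i; exact: h.
Qed.

Lemma polynomial_on_adj k d (A : jet R m -> 'M[R]_d) i j :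
  (forall i j, polynomial_on k (fun th => A th i j)) ->
  polynomial_on k (fun th => (\adj (A th)) i j).
Proof.
move=> h; under eq_fun do rewrite mxE /cofactor; apply: polynomial_on_mul.
  exact: polynomial_on_const.
by apply: polynomial_on_det => a b; under eq_fun do rewrite !mxE; exact: h.
Qed.

End PolynomialClosure.

(** * Derivatives of the image of a graph *)

Section Words.
Local Open Scope ring_scope.
Variable m : nat.

(** Multi-indices as words, so that derivatives can be taken one at a time. *)
Definition mword (w : seq 'I_m) : 'X_{1..m} := foldr (fun i s => (s + U_(i))%MM) 0%MM w.

Lemma mdeg_mword w : mdeg (mword w) = size w.
Proof. by elim: w => [|i w IH] /=; rewrite ?mdeg0 // mdegD mdeg1 IH addn1. Qed.

Lemma mword_surj (s : 'X_{1..m}) : exists w, mword w = s.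
Proof.
have [d hd] : exists d, mdeg s = d by exists (mdeg s).
elim: d s hd => [|d IH] s hd.
  by exists [::]; apply/eqP; rewrite eq_sym -mdeg_eq0 hd.
have [i hi] : exists i, (s i != 0)%N.
  apply: contrapT => hn; suff : s = 0%MM by move=> e; rewrite e mdeg0 in hd.
  apply/mnmP => i; rewrite mnm0E.
  by apply/eqP/negPn/negP => hi; apply: hn; exists i.
have e : (s - U_(i) + U_(i))%MM = s by rewrite submK // lep1mP.
have [|w hw] := IH (s - U_(i))%MM.
  by move: hd; rewrite -e mdegD mdeg1 addn1 => -[]; rewrite e.
by exists (i :: w); rewrite /= hw.
Qed.

Definition wordof (s : 'X_{1..m}) : seq 'I_m := sval (cid (mword_surj s)).

Lemma wordofK s : mword (wordof s) = s.
Proof. exact: (svalP (cid (mword_surj s))). Qed.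

End Words.

Section Prolongation.
Local Open Scope ring_scope.
Variables (R : realType) (n : nat) (c : 'I_(n + n)).
Local Notation m := (n + n).-1.
Implicit Types (f : {mpoly R[m]}) (g h : 'M[R]_(n + n)) (th : jet R m).

Lemma sum_chart (V : nmodType) (F : 'I_(n + n) -> V) :
  \sum_k F k = F c + \sum_i F (lift c i).
Proof. by rewrite (bigD1_ord c). Qed.

Lemma chart_point_c (S : Type) (x : 'I_m -> S) (u : S) : chart_point c x u c 0 = u.
Proof. by rewrite mxE unlift_none. Qed.

Lemma chart_point_lift (S : Type) (x : 'I_m -> S) (u : S) i :
  chart_point c x u (lift c i) 0 = x i.
Proof. by rewrite mxE liftK. Qed.

(** The components of g (X, f(X)), as polynomials in X. *)
Definition gcomp g f (k : 'I_(n + n)) : {mpoly R[m]} :=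
  (map_mx (@mpolyC m R) g *m chart_point c (fun i => 'X_i) f) k 0.

Lemma gcompE g f k :
  gcomp g f k = (g k c)%:MP * f + \sum_i (g k (lift c i))%:MP * 'X_i.
Proof.
rewrite /gcomp mxE sum_chart chart_point_c !mxE; congr (_ + _).
by apply: eq_bigr => i _; rewrite chart_point_lift !mxE.
Qed.

(** The map induced by g on the independent variables. *)
Definition Phi g f : m.-tuple {mpoly R[m]} := [tuple gcomp g f (lift c i) | i < m].

(** The order of contact of the image of the graph of f with the graph of f'. *)
Definition contact g f f' x k := van x k ((f' \mPo Phi g f) - gcomp g f c).

Lemma prolongP k g th th' : prolong c k g th th' <->
  exists f f', [/\ jet_of k f th /\ jet_of k f' th',
    forall i, jbase th' i = (gcomp g f (lift c i)).@[jbase th],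
    \matrix_(i, j) ((gcomp g f (lift c i))^`M(j)).@[jbase th] \in unitmx
    & contact g f f' (jbase th) k.+1].
Proof.
split=> -[f [f' [h1 h2 h3 h4]]]; exists f, f'; split=> //.
  apply/vanP => s hs; rewrite mderivmB mevalB; apply/eqP; rewrite subr_eq0; apply/eqP.
  exact: h4 s hs.
move=> s hs; have /vanP/(_ s hs) := h4.
by rewrite mderivmB mevalB => /eqP; rewrite subr_eq0 => /eqP.
Qed.

(** The Jacobian matrix of [Phi], as a function of the 1-jet and as a polynomial. *)
Definition gJ g th : 'M[R]_m :=
  \matrix_(i, j) (g (lift c i) (lift c j) + g (lift c i) c * th (inr U_(j)%MM)).

Definition pJ g f : 'M[{mpoly R[m]}]_m :=
  \matrix_(i, j) (gcomp g f (lift c i))^`M(j).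

Lemma mderiv_gcomp g f k j :
  (gcomp g f k)^`M(j) = (g k c)%:MP * f^`M(j) + (g k (lift c j))%:MP.
Proof.
rewrite gcompE mderivD mderiv_mulC; congr (_ + _).
rewrite raddf_sum /= (bigD1 j) //= big1 ?addr0 => [|i ij];
  rewrite mderiv_mulC mderiv_XU ?eqxx ?mpolyC1 ?mulr1 //.
by rewrite (negbTE ij) mpolyC0 mulr0.
Qed.

Lemma pJ_meval g f x : map_mx (meval x) (pJ g f) = gJ g (jetf f x).
Proof.
apply/matrixP => i j; rewrite !mxE mderiv_gcomp mevalD mevalM !mevalC /= mderivmU1m.
by rewrite addrC.
Qed.

Lemma gJ_jeq g th th' : jeqk 1 th th' -> gJ g th = gJ g th'.
Proof. by move=> h; apply/matrixP => i j; rewrite !mxE h //= mdeg1. Qed.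

Lemma polynomial_on_gJ k g i j : (0 < k)%N -> polynomial_on k (fun th => gJ g th i j).
Proof.
move=> hk; under eq_fun do rewrite mxE; apply: polynomial_on_add.
  exact: polynomial_on_const.
apply: polynomial_on_mul; first exact: polynomial_on_const.
by apply: polynomial_on_var; rewrite /= mdeg1.
Qed.

(** Implicit differentiation of f' o Phi = g_c(X, f(X)): each derivative of f', composed
    with Phi, is a polynomial divided by det(J)^(2|w|), J the Jacobian matrix of Phi.
    [pderiv] is this numerator, and [jderiv] its expression in the jet of f. The
    derivative in the direction i uses J^-1 = adj(J) / det(J), whence two more factors
    det(J) in the denominator at each step. *)
Fixpoint pderiv g f (w : seq 'I_m) : {mpoly R[m]} :=
  if w is i :: w' then
    \sum_j (\adj (pJ g f)) j i *
      (\det (pJ g f) * (pderiv g f w')^`M(j)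
       - (size w').*2%:R * (\det (pJ g f))^`M(j) * pderiv g f w')
  else gcomp g f c.

Fixpoint jderiv g (w : seq 'I_m) : jet R m -> R :=
  if w is i :: w' then fun th =>
    \sum_j (\adj (gJ g th)) j i *
      (\det (gJ g th) * dtot j (jderiv g w') th
       + - ((size w').*2%:R * dtot j (fun th => \det (gJ g th)) th * jderiv g w' th))
  else fun th => g c c * th (inr 0%MM) + \sum_i g c (lift c i) * th (inl i).

Lemma polynomial_on_detgJ k g : (0 < k)%N -> polynomial_on k (fun th => \det (gJ g th)).
Proof. by move=> hk; apply: polynomial_on_det => i j; apply: polynomial_on_gJ. Qed.

Lemma polynomial_on_jderiv g w : polynomial_on (size w).+1 (jderiv g w).
Proof.
elim: w => [|i w IH] /=.
  apply: polynomial_on_add.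
    apply: polynomial_on_mul; first exact: polynomial_on_const.
    by apply: polynomial_on_var; rewrite /= mdeg0.
  apply: polynomial_on_sum => i; apply: polynomial_on_mul; first exact: polynomial_on_const.
  exact: polynomial_on_var.
apply: polynomial_on_sum => j; apply: polynomial_on_mul.
  by apply: polynomial_on_adj => a b; apply: polynomial_on_gJ.
apply: polynomial_on_add.
  apply: polynomial_on_mul; first exact: polynomial_on_detgJ.
  by apply: polynomial_on_dtot; exact: IH.
apply: polynomial_on_opp; apply: polynomial_on_mul; last exact: polynomial_on_le IH.
apply: polynomial_on_mul; first exact: polynomial_on_const.
apply: (@polynomial_on_le _ _ 2) => //; apply: polynomial_on_dtot; exact: polynomial_on_detgJ.
Qed.

Lemma pdet_meval g f x : (\det (pJ g f)).@[x] = \det (gJ g (jetf f x)).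
Proof. by rewrite -pJ_meval det_map_mx. Qed.

Lemma pderiv_meval g f w x : (pderiv g f w).@[x] = jderiv g w (jetf f x).
Proof.
elim: w x => [|i w IH] x.
  rewrite /= gcompE mevalD mevalM mevalC mderivm0m raddf_sum; congr (_ + _).
  by apply: eq_bigr => i _; rewrite /= mevalM mevalC mevalXU.
rewrite /= raddf_sum; apply: eq_bigr => j _; rewrite /= mevalM; congr (_ * _).
  by rewrite -pJ_meval -map_mx_adj [RHS]mxE.
rewrite mevalB !mevalM pdet_meval IH.
rewrite (meval_dtot j IH); last by apply: cdiff_polynomial_on (polynomial_on_jderiv _ _).
rewrite (meval_dtot (q := fun th => \det (gJ g th)) (f := f) j); last 2 first.
- by move=> y; exact: pdet_meval.
- exact: cdiff_polynomial_on (@polynomial_on_detgJ 1 _ _).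
by rewrite rmorph_nat.
Qed.

Lemma mderiv_exp k (d : {mpoly R[k]}) N j :
  d * (d ^+ N)^`M(j) = N%:R * d^`M(j) * d ^+ N.
Proof.
elim: N => [|N IH]; first by rewrite expr0 -mpolyC1 mderivC mulr0 mul0r mul0r.
by rewrite exprS mderivM mulrDr [d * (d * _)]mulrCA IH -natr1; ring.
Qed.

(** Contact of order K gives, after clearing denominators, the derivatives of f' up
    to order K, with a loss of one order of contact for each derivative. *)
Lemma contact_pderiv g f f' x K w : (size w <= K)%N -> contact g f f' x K ->
  van x (K - size w) (\det (pJ g f) ^+ (size w).*2 * (f'^`M[mword w] \mPo Phi g f)
                      - pderiv g f w).
Proof.
elim: w K => [|i w IH] K hK hc.
  by rewrite /= subn0 expr0 mul1r mderivm0m.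
have hK' : (size w <= K)%N by apply: leq_trans hK; rewrite /= leqW.
have := IH K hK' hc.
have -> : (K - size w = (K - size (i :: w)).+1)%N by rewrite /= subnSK.
set k := (K - _)%N; set d := \det _; set q := _ \mPo _; set P := pderiv g f w.
set N := (size w).*2; set E := _ - _ => hEE.
have hE' := vanS hEE; have hE := hEE.2.
have eq j : q^`M(j) = \sum_a (f'^`M[mword (a :: w)] \mPo Phi g f) * (pJ g f) a j.
  rewrite mderiv_comp; apply: eq_bigr => a _.
  by rewrite /= mderivmDm mderivmU1m tnth_mktuple mxE.
rewrite [size (i :: w)]/= doubleS.
have -> : d ^+ N.+2 * (f'^`M[mword (i :: w)] \mPo Phi g f) - pderiv g f (i :: w) =
  \sum_j \adj (pJ g f) j i * (d * E^`M(j) - N%:R * d^`M(j) * E).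
  have hadj : \sum_j q^`M(j) * \adj (pJ g f) j i = d * (f'^`M[mword (i :: w)] \mPo Phi g f).
    have := congr1 (fun M : 'M_m => ((\row_a (f'^`M[mword (a :: w)] \mPo Phi g f)) *m M) 0 i)
       (mul_mx_adj (pJ g f)).
    rewrite mulmxA mul_mx_scalar [LHS]mxE [RHS]mxE [X in _ = _ * X]mxE => <-.
    apply: eq_bigr => j _; rewrite eq [X in _ = X * _]mxE; congr (_ * _).
    by apply: eq_bigr => a _; rewrite [X in _ = X * _]mxE.
  rewrite [pderiv g f (i :: w)]/=; set X := _ \mPo _ in hadj *.
  have -> : d ^+ N.+2 * X = d ^+ N.+1 * (d * X) by rewrite !exprS; ring.
  rewrite -hadj mulr_sumr -sumrB; apply: eq_bigr => j _.
  have -> : d * E^`M(j) = d * (d ^+ N)^`M(j) * q + d * d ^+ N * q^`M(j) - d * P^`M(j).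
    by rewrite /E mderivB mderivM; ring.
  rewrite mderiv_exp -/P -/d -/N /E exprS.
  by ring.
apply: van_sum => j; apply: vanMl; apply: vanB; first by apply: vanMl; exact: hE.
exact: vanMl.
Qed.

End Prolongation.

(** * The prolonged action in jet coordinates *)

Section TransformedJets.
Local Open Scope ring_scope.
Variables (R : realType) (n : nat) (c : 'I_(n + n)).
Local Notation m := (n + n).-1.
Implicit Types (f : {mpoly R[m]}) (g h : 'M[R]_(n + n)) (th : jet R m).

(** The k-th coordinate of g applied to the base point of the jet. *)
Definition grow g k th : R :=
  g k c * th (inr 0%MM) + \sum_i g k (lift c i) * th (inl i).

Lemma gcomp_meval g f k x : (gcomp c g f k).@[x] = grow g k (jetf f x).
Proof.
rewrite gcompE mevalD mevalM mevalC /grow /= mderivm0m raddf_sum; congr (_ + _).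
by apply: eq_bigr => i _; rewrite /= mevalM mevalC mevalXU.
Qed.

Lemma jet_of_jeqk k f th : jet_of k f th -> jeqk k (jetf f (jbase th)) th.
Proof. by move=> h [i|s] hz //=; apply: h. Qed.

Lemma grow_jeqk k g a th th' : jeqk k th th' -> grow g a th = grow g a th'.
Proof.
move=> h; rewrite /grow h /= ?mdeg0 //; congr (_ + _).
by apply: eq_bigr => i _; rewrite h.
Qed.

Lemma prolong_base k g th th' i : prolong c k g th th' ->
  th' (inl i) = grow g (lift c i) th.
Proof.
move=> /prolongP[f [f' [[h1 _] h2 _ _]]].
have -> : th' (inl i) = jbase th' i by [].
by rewrite h2 gcomp_meval; apply: grow_jeqk (jet_of_jeqk h1).
Qed.

Lemma prolong_det k g th th' : (0 < k)%N -> prolong c k g th th' -> \det (gJ c g th) != 0.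
Proof.
move=> hk /prolongP[f [f' [[h1 _] h2 h3 _]]].
move: h3; rewrite unitmxE unitfE.
have -> : \matrix_(i, j) ((gcomp c g f (lift c i))^`M(j)).@[jbase th] = gJ c g th.
  rewrite -(gJ_jeq c g (th := jetf f (jbase th))); last first.
    by move=> z hz; apply: jet_of_jeqk h1 _ _; exact: leq_trans hz hk.
  by rewrite -pJ_meval; apply/matrixP => i j; rewrite !mxE.
by [].
Qed.

Lemma prolong_jderiv k g th th' w : (size w < k)%N -> prolong c k g th th' ->
  th' (inr (mword w)) = jderiv c g w th / \det (gJ c g th) ^+ (size w).*2.
Proof.
move=> hw hp; have d0 := prolong_det (leq_ltn_trans (leq0n _) hw) hp.
have /prolongP[f [f' [[h1 h1'] h2 h3 h4]]] := hp.
have h1k := jet_of_jeqk h1.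
have := contact_pderiv (leqW (ltnW hw)) h4.
have -> : (k.+1 - size w = (k - size w).+1)%N by rewrite subSn // ltnW.
move=> [+ _]; rewrite mevalB mevalM rmorphXn /= comp_mpoly_meval pdet_meval pderiv_meval.
rewrite (@gJ_jeq _ _ _ _ _ th) => [|z hz]; last first.
  by apply: h1k; apply: leq_trans hz _; exact: leq_ltn_trans (leq0n _) hw.
rewrite (@polynomial_on_eq _ _ _ _ _ th (polynomial_on_jderiv _ _ _)) => [|z hz]; last first.
  by apply: h1k; exact: leq_trans hz _.
move=> /eqP; rewrite subr_eq0 => /eqP <-.
rewrite mulrAC mulfV ?mul1r ?expf_neq0 //.
rewrite -h1'; last by rewrite mdeg_mword ltnW.
by apply: meval_eq => i; rewrite h2 tnth_mktuple.
Qed.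

(** The prolonged action of g in jet coordinates: a rational map, total by the
    convention x / 0 = 0. A word is chosen for each multi-index; [prolong_infty_jderiv]
    shows that its order is irrelevant where the action is defined. *)
Definition Phimap g th : jet R m := fun z => match z with
  | inl i => grow g (lift c i) th
  | inr s => jderiv c g (wordof s) th / \det (gJ c g th) ^+ (size (wordof s)).*2
  end.

Lemma prolong_infty_det g th th' : prolong_infty c g th th' -> \det (gJ c g th) != 0.
Proof. by move=> /(_ 1%N); apply: prolong_det. Qed.

Lemma prolong_infty_jderiv g th th' w : prolong_infty c g th th' ->
  th' (inr (mword w)) = jderiv c g w th / \det (gJ c g th) ^+ (size w).*2.
Proof. by move=> /(_ (size w).+1); apply: prolong_jderiv. Qed.

Lemma prolong_infty_eq g th th' : prolong_infty c g th th' -> th' = Phimap g th.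
Proof.
move=> h; apply/funext => -[i|s] /=; first exact: prolong_base (h 0%N).
by rewrite -{1}(wordofK s) (prolong_infty_jderiv _ h).
Qed.

(** The image of the graph of a Taylor polynomial f is, to the required order, the
    graph of a polynomial f' by [van_comp_surj], and the derivatives of f' are given
    by the formulas for its jet. *)
Lemma prolong_infty_Phimap g th : \det (gJ c g th) != 0 ->
  prolong_infty c g th (Phimap g th).
Proof.
move=> d0 k; apply/prolongP.
have [f hf] := jet_of_exists k.+1 th.
have hfk := jet_of_jeqk hf.
have eJ : map_mx (meval (jbase th)) (pJ c g f) = gJ c g th.
  rewrite pJ_meval; apply: gJ_jeq => z hz; apply: hfk; exact: leq_trans hz _.
have hJ : \matrix_(i, j) ((gcomp c g f (lift c i))^`M(j)).@[jbase th] \in unitmx.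
  rewrite unitmxE unitfE.
  have -> : \matrix_(i, j) ((gcomp c g f (lift c i))^`M(j)).@[jbase th] = gJ c g th.
    by rewrite -eJ; apply/matrixP => i j; rewrite !mxE.
  by [].
have hJ' : \matrix_(i, j) ((tnth (Phi c g f) i)^`M(j)).@[jbase th] \in unitmx.
  rewrite (_ : \matrix_(i, j) _ = \matrix_(i, j) ((gcomp c g f (lift c i))^`M(j)).@[jbase th]) //.
  by apply/matrixP => i j; rewrite !mxE tnth_mktuple.
have [f' hf'] := van_comp_surj (gcomp c g f c) k.+2 hJ'.
have hb i : jbase (Phimap g th) i = (gcomp c g f (lift c i)).@[jbase th].
  by rewrite gcomp_meval; symmetry; apply: grow_jeqk hfk.
exists f, f'; split=> //; last exact: van_le hf'.
split=> s hs; first by rewrite hf // (leq_trans hs).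
have hw : size (wordof s) = mdeg s by rewrite -mdeg_mword wordofK.
have hw' : (size (wordof s) <= k)%N by rewrite hw.
have := contact_pderiv (w := wordof s) (leqW (leqW hw')) hf'.
have -> : (k.+2 - size (wordof s) = (k.+1 - size (wordof s)).+1)%N.
  by rewrite -subSn // leqW.
move=> [+ _]; rewrite mevalB mevalM rmorphXn /= comp_mpoly_meval pdet_meval pderiv_meval.
rewrite -pJ_meval eJ.
rewrite (@polynomial_on_eq _ _ _ _ _ th (polynomial_on_jderiv _ _ _)) => [|z hz]; last first.
  by apply: hfk; apply: leq_trans hz _.
move=> /eqP; rewrite subr_eq0 => /eqP <-.
rewrite mulrAC mulfV ?mul1r ?expf_neq0 // wordofK.
by apply: meval_eq => i; rewrite hb tnth_mktuple.
Qed.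

Lemma regular_Phimap g th z : \det (gJ c g th) != 0 ->
  regular (jord z).+1 th (fun th => Phimap g th z).
Proof.
move=> d0; case: z => [i|s] /=.
  apply: regular_add.
    apply: regular_mul; first exact: regular_const.
    by apply: regular_var; rewrite /= mdeg0.
  apply: regular_sum => j; apply: regular_mul; first exact: regular_const.
  exact: regular_var.
have hw : size (wordof s) = mdeg s by rewrite -mdeg_mword wordofK.
apply: regular_div; first exact: expf_neq0.
  by rewrite -hw; apply: regular_polynomial; exact: polynomial_on_jderiv.
by apply: regular_polynomial; apply: polynomial_on_exp; exact: polynomial_on_detgJ.
Qed.

(** The prolonged action preserves the Cartan distribution: it maps the total
    derivative D_j to the combination of the D_i given by the Jacobian matrix of the
    induced map on the independent variables. *)
Lemma dtot_Phimap g th z j : \det (gJ c g th) != 0 ->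
  dtot j (fun th => Phimap g th z) th =
  \sum_i gJ c g th i j * total_dir (Phimap g th) i z.
Proof.
move=> d0; case: z => [a|s].
  rewrite [RHS](bigD1 a) //= eqxx mulr1 big1 ?addr0; last first.
    by move=> i ia; rewrite eq_sym (negbTE ia) mulr0.
  have cv z : cdiff (fun th : jet R m => th z) th by exact: (cdiff_var _ _).1.
  have e l : dd (grow g (lift c a)) th l =
     g (lift c a) c * l (inr 0%MM) + \sum_i g (lift c a) (lift c i) * l (inl i).
    have hp : polynomial_on 0 (grow g (lift c a)).
      apply: polynomial_on_add.
        apply: polynomial_on_mul; first exact: polynomial_on_const.
        by apply: polynomial_on_var; rewrite /= mdeg0.
      apply: polynomial_on_sum => i; apply: polynomial_on_mul; first exact: polynomial_on_const.
      exact: polynomial_on_var.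
    have [_ /(_ _ _ (dcurve_jline th l)) hd] := cdiff_polynomial_on th hp.
    rewrite -(@derive_val _ _ _ _ _ _ _ hd).
    have -> : (fun t => grow g (lift c a) (jline th l t)) =
       cst (grow g (lift c a) th) +
       (g (lift c a) c * l (inr 0%MM) + \sum_i g (lift c a) (lift c i) * l (inl i)) \*: id.
      apply/funext => t; rewrite !fctE /= /grow /jline /GRing.scale /=.
      rewrite mulrDl mulr_suml mulrDr -!addrA; congr (_ + _).
      under eq_bigr do rewrite mulrDr.
      rewrite big_split /=.
      have -> : \sum_i g (lift c a) (lift c i) * (t * l (inl i)) =
                \sum_i g (lift c a) (lift c i) * l (inl i) * t.
        by apply: eq_bigr => i _; ring.
      by ring.
    by rewrite derive_val add0r /GRing.scale /= mulr1.
  rewrite dtotE e /= add0m !mxE addrC; congr (_ + _).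
  rewrite (bigD1 j) //= eqxx mulr1 big1 ?addr0 // => i ij.
  by rewrite (negbTE ij) mulr0.
set w := wordof s; set P := jderiv c g w; set d := fun th => \det (gJ c g th).
have cP : cdiff P th by apply: cdiff_polynomial_on (polynomial_on_jderiv _ _ _).
have pd : polynomial_on 1 d by exact: polynomial_on_detgJ.
have cd' : cdiff d th by exact: cdiff_polynomial_on pd.
have cdN N : cdiff (fun th => d th ^+ N) th.
  exact: cdiff_polynomial_on (polynomial_on_exp N pd).
have eN N : d th * dtot j (fun th => d th ^+ N) th = N%:R * dtot j d th * d th ^+ N.
  elim: N => [|N IH].
    have -> : (fun th => d th ^+ 0) = fun=> 1 by apply/funext => ?; rewrite expr0.
    by rewrite dtotE (cdiff_const _ _).2 !mulr0 !mul0r.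
  have -> : (fun th => d th ^+ N.+1) = fun th => d th * d th ^+ N.
    by apply/funext => ?; rewrite exprS.
  by rewrite (dtot_mul _ cd' (cdN N)) mulrDr mulrCA IH exprS -natr1; ring.
have [cI eI] := cdiff_inv (expf_neq0 (size w).*2 d0) (cdN (size w).*2).
rewrite /Phimap -/w (@dtot_mul _ _ j P (fun th => (d th ^+ (size w).*2)^-1) th cP cI).
rewrite [dtot j (fun th => (d th ^+ _)^-1) th]dtotE eI -dtotE.
have hp := prolong_infty_Phimap d0.
have eR i : total_dir (Phimap g th) i (inr s) = jderiv c g (i :: w) th / d th ^+ (size w).*2.+2.
  rewrite /total_dir -{1}(wordofK s) -/w.
  by rewrite -[(mword w + U_(i))%MM]/(mword (i :: w)) (prolong_infty_jderiv _ hp).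
under eq_bigr do rewrite eR /=.
set N := (size w).*2.
pose B l := d th * dtot l P th + - (N%:R * dtot l d th * P th).
have -> : \sum_i gJ c g th i j * ((\sum_l (\adj (gJ c g th)) l i * B l) / d th ^+ N.+2) =
   \sum_l (\adj (gJ c g th) *m gJ c g th) l j * B l / d th ^+ N.+2.
  under eq_bigr do rewrite mulr_suml mulr_sumr.
  rewrite exchange_big /=; apply: eq_bigr => l _.
  rewrite mxE !mulr_suml; apply: eq_bigr => i _.
  by ring.
rewrite mul_adj_mx (bigD1 j) //= !mxE eqxx mulr1n big1 ?addr0; last first.
  by move=> l lj; rewrite mxE (negbTE lj) mulr0n !mul0r.
rewrite /B -/(d th) -/N; have dN : d th ^+ N != 0 by exact: expf_neq0.
apply: (mulfI d0).
have := eN N; rewrite -/N => e1.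
have -> : d th * (P th * (- (d th ^+ N) ^- 2 * dtot j (fun th0 => d th0 ^+ N) th)
    + (d th ^+ N)^-1 * dtot j P th) =
    - P th * (d th ^+ N) ^- 2 * (d th * dtot j (fun th0 => d th0 ^+ N) th)
    + d th * (d th ^+ N)^-1 * dtot j P th by ring.
have -> : d th ^+ N.+2 = d th * (d th * d th ^+ N) by rewrite 2!exprS.
rewrite e1 -[\det _]/(d th); field.
by rewrite dN d0.
Qed.

End TransformedJets.

(** * Transport along the prolonged action *)

Section Equivariance.
Local Open Scope ring_scope.
Variables (R : realType) (n : nat) (c : 'I_(n + n)).
Local Notation m := (n + n).-1.
Implicit Types (f : {mpoly R[m]}) (g h : 'M[R]_(n + n)) (th : jet R m).

Lemma gcomp_comp g h f f' a : h *m g = 1%:M ->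
  (gcomp c h f' a) \mPo (Phi c g f) =
  chart_point c (fun i => 'X_i) f a 0
  + (h a c)%:MP * ((f' \mPo Phi c g f) - gcomp c g f c).
Proof.
move=> hg; rewrite gcompE comp_mpolyD rmorphM /= comp_mpolyC.
have -> : ((\sum_i (h a (lift c i))%:MP * 'X_i) \mPo Phi c g f) =
   \sum_i (h a (lift c i))%:MP * gcomp c g f (lift c i).
  rewrite raddf_sum /=; apply: eq_bigr => i _.
  by rewrite rmorphM /= comp_mpolyC comp_mpolyXU -tnth_nth tnth_mktuple.
have : (map_mx (@mpolyC m R) h *m (map_mx (@mpolyC m R) g *m
    chart_point c (fun i => 'X_i) f)) a 0 = chart_point c (fun i => 'X_i) f a 0.
  by rewrite mulmxA -map_mxM hg map_mx1 mul1mx.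
rewrite mxE (sum_chart c) => <-; rewrite [X in _ = X * _ + _ + _]mxE.
under [X in _ = _ + X + _]eq_bigr do rewrite [X in X * _]mxE.
rewrite -/(gcomp c g f c); under [X in _ = _ + X + _]eq_bigr => i _ do
  rewrite -/(gcomp c g f (lift c i)).
by ring.
Qed.

(** [gcomp_comp] says that the two induced maps on independent variables, for g and
    h = g^-1, are inverse to each other to the order of contact of the two graphs;
    composing with a local diffeomorphism reflects this order. *)
Lemma prolong_sym k g h th th' : h *m g = 1%:M -> prolong c k.+1 g th th' ->
  prolong c k h th' th.
Proof.
move=> hg /prolongP[f [f' [[h1 h1'] h2 h3 h4]]].
set x := jbase th in h2 h3 h4; set y := jbase th' in h2.
have hyx i : y i = (tnth (Phi c g f) i).@[x] by rewrite h2 tnth_mktuple.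
have hJ : \matrix_(i, j) ((tnth (Phi c g f) i)^`M(j)).@[x] \in unitmx.
  rewrite (_ : \matrix_(i, j) _ = \matrix_(i, j) ((gcomp c g f (lift c i))^`M(j)).@[x]) //.
  by apply/matrixP => i j; rewrite !mxE tnth_mktuple.
have hlift i : van x k.+2 (((gcomp c h f' (lift c i)) \mPo (Phi c g f)) - 'X_i).
  by rewrite gcomp_comp // chart_point_lift addrC addKr; exact: vanMl.
have hc : van x k.+2 (((gcomp c h f' c) \mPo (Phi c g f)) - f).
  by rewrite gcomp_comp // chart_point_c addrC addKr; exact: vanMl.
apply/prolongP; exists f', f; split.
- split=> s hs; [apply: h1'|apply: h1]; exact: leq_trans hs _.
- move=> i; rewrite -[jbase th]/x -[jbase th']/y; have [+ _] := hlift i.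
  rewrite mevalB mevalXU comp_mpoly_meval => /eqP; rewrite subr_eq0 => /eqP <-.
  by apply: meval_eq => j; rewrite hyx.
- apply: (mulmx1_unit (B := \matrix_(i, j) ((tnth (Phi c g f) i)^`M(j)).@[x]) _).1.
  apply/matrixP => i j; rewrite !mxE.
  have [_ /(_ j)[+ _]] := hlift i.
  rewrite mderivB mderiv_comp mevalB raddf_sum /= mderiv_XU mevalC => /eqP.
  rewrite subr_eq0 => /eqP <-; apply: eq_bigr => a _.
  rewrite !mxE mevalM comp_mpoly_meval; congr (_ * _); apply: meval_eq => b; exact: hyx.
- apply: (van_comp_inj hyx hJ).
  rewrite comp_mpolyB.
  pose F := [tuple (tnth (Phi c h f') i) \mPo (Phi c g f) | i < m].
  have -> : (f \mPo Phi c h f') \mPo Phi c g f = f \mPo F.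
    exact: comp_mpolyA.
  have -> : (f \mPo F) - ((gcomp c h f' c) \mPo Phi c g f) =
     ((f \mPo F) - (f \mPo [tuple 'X_i | i < m]))
     - (((gcomp c h f' c) \mPo Phi c g f) - f) by rewrite comp_mpoly_id; ring.
  apply: vanB; last exact: vanS.
  apply: van_comp_sub => i; rewrite !tnth_mktuple; exact: vanS.
Qed.

Lemma prolong_infty_sym g h th th' : h *m g = 1%:M -> prolong_infty c g th th' ->
  prolong_infty c h th' th.
Proof. by move=> hg hp k; exact: prolong_sym hg (hp k.+1). Qed.

(** Let w = g^-1 e_c. If the tangent hyperplane u does not contain w, its image does
    not contain the vertical direction e_c, so it is the tangent space of a graph. *)
Lemma gJ_neq0 g : g \in unitmx -> exists th, \det (gJ c g th) != 0.
Proof.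
move=> ug; pose w := col c (invmx g).
have hgw : g *m w = delta_mx c 0.
  by rewrite /w -[col c _]mulmx1 colE !mulmxA mulmxV // mul1mx mulmx1.
have [u hu] : exists u : 'I_m -> R, w c 0 - \sum_i u i * w (lift c i) 0 != 0.
  have [wc|wc] := eqVneq (w c 0) 0; last first.
    by exists (fun=> 0); rewrite big1 ?subr0 // => i _; rewrite mul0r.
  have [i wi] : exists i, w (lift c i) 0 != 0.
    apply: contrapT => hn.
    have w0 : w = 0.
      apply/matrixP => k l; rewrite ord1 [RHS]mxE; case: (unliftP c k) => [j ->|-> //].
      by apply/eqP/negPn/negP => hj; apply: hn; exists j.
    have := congr1 (fun M : 'cV_(n + n) => M c 0) hgw.
    by rewrite w0 mulmx0 !mxE !eqxx => /eqP; rewrite eq_sym oner_eq0.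
  exists (fun j => (j == i)%:R); rewrite wc sub0r oppr_eq0 (bigD1 i) //= eqxx mul1r.
  by rewrite big1 ?addr0 // => j ji; rewrite (negbTE ji) mul0r.
pose th : jet R m := fun z => if z is inr s then \sum_i u i * (s == U_(i)%MM)%:R else 0.
have thU j : th (inr U_(j)%MM) = u j.
  rewrite /th (bigD1 j) //= eqxx mulr1 big1 ?addr0 // => i ij.
  by rewrite eq_mnm1 eq_sym (negbTE ij) mulr0.
exists th; rewrite -det_tr; apply/negP => /det0P[v v0 hv].
pose t : 'cV[R]_(n + n) := chart_point c (v 0) (\sum_j u j * v 0 j).
have hgt i : (g *m t) (lift c i) 0 = 0.
  have := congr1 (fun M : 'rV_m => M 0 i) hv; rewrite !mxE => e.
  rewrite (sum_chart c) chart_point_c -[RHS]e mulr_sumr -big_split /=.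
  apply: eq_bigr => j _; rewrite chart_point_lift !mxE thU; ring.
have ht : t = (g *m t) c 0 *: w.
  rewrite -[LHS](mulKmx ug) /w [in RHS]colE scalemxAr; congr (_ *m _).
  apply/matrixP => k l; rewrite ord1 [RHS]mxE; case: (unliftP c k) => [j ->|->].
    by rewrite hgt [delta_mx _ _ _ _]mxE eq_sym (negbTE (neq_lift _ _)) mulr0.
  by rewrite [delta_mx _ _ _ _]mxE !eqxx mulr1.
have dt : t c 0 - \sum_i u i * t (lift c i) 0 = 0.
  rewrite chart_point_c; under [X in _ - X]eq_bigr do rewrite chart_point_lift.
  by rewrite subrr.
move: dt; set mu := (g *m t) c 0 in ht.
have -> : t c 0 - \sum_i u i * t (lift c i) 0 = mu * (w c 0 - \sum_i u i * w (lift c i) 0).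
  rewrite ht !mxE mulrBr mulr_sumr; congr (_ - _).
  by apply: eq_bigr => i _; rewrite !mxE mulrCA.
move/eqP; rewrite mulf_eq0 (negbTE hu) orbF => /eqP mu0.
case/eqP: v0; apply/rowP => j; rewrite mxE.
by rewrite -(chart_point_lift c (v 0) (\sum_j u j * v 0 j)) -/t ht mu0 scale0r mxE.
Qed.

Lemma generic_gJ g : g \in unitmx -> generic (fun th => \det (gJ c g th) != 0).
Proof.
move=> /gJ_neq0[th h]; apply: (@znbhd_generic _ _ 1 th).
exists (fun th => \det (gJ c g th)); split=> //; exact: polynomial_on_detgJ.
Qed.

Lemma regular_comp_Phimap k g th D : polynomial_on k D -> \det (gJ c g th) != 0 ->
  regular k.+1 th (fun th => D (Phimap c g th)).
Proof.
move=> hD d0; move: D hD; apply: polynomial_on_ind => [a|z hz|u v hu hv|u v hu hv].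
- exact: regular_const.
- by apply: regular_le (regular_Phimap _ d0); exact: hz.
- exact: regular_add.
- exact: regular_mul.
Qed.

(** The exceptional set D = 0 is pulled back by the rational map th |-> g th. The
    pullback is not everything: D is nonzero at some jet t which g^-1 maps to a jet s,
    and then g s = t. *)
Lemma generic_pull g A : g \in unitmx -> @generic R m A ->
  generic (fun th => forall th', prolong_infty c g th th' -> A th').
Proof.
move=> ug [k [D [hD [a Da] hA]]].
have uh : invmx g \in unitmx by rewrite unitmx_inv.
have [b hb] := gJ_neq0 uh.
have [t [Dt dt]] := polynomial_on_neq0 hD (@polynomial_on_detgJ _ _ _ 1 _ isT) Da hb.
have hp := prolong_infty_Phimap dt; set s := Phimap _ _ _ in hp.
have hps : prolong_infty c g s t by apply: prolong_infty_sym hp; rewrite mulmxV.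
have ds := prolong_infty_det hps.
have es := prolong_infty_eq hps.
have hr := regular_comp_Phimap hD ds.
apply: (@znbhd_generic _ _ k.+1 s).
have := regular_neq0 hr; rewrite -es => /(_ Dt); apply: znbhdS => th hth th' /prolong_infty_eq e.
by apply: hA; rewrite e.
Qed.

(** A horizontal field whose coefficients transform like tangent vectors is
    invariant: by [dtot_Phimap] the differential of the action maps it to itself. *)
Lemma horizontal_invariant g (a : jet R m -> 'I_m -> R) (u u' : jet R m -> R) :
  g \in unitmx -> ratfun u -> ratfun u' ->
  generic (fun th => forall th', prolong_infty c g th th' ->
    forall i, a th' i = \sum_j gJ c g th i j * a th j) ->
  generic (fun th => forall th', prolong_infty c g th th' -> u' th = u th') ->
  generic (fun th => forall th', prolong_infty c g th th' ->
                horizontal a u' th = horizontal a u th').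
Proof.
move=> ug ru ru' ha huu'.
have hu := generic_pull ug (ratfun_generic ru).
have := genericI (genericI (generic_point huu') (ratfun_generic ru'))
  (genericI ha (genericI hu (generic_gJ ug))).
apply: genericS => th [[[k1 e1] [k2 ru'th]] [hath [hth d0]]] th' hp.
have [k3 ruth] := hth _ hp; have cu := regular_cdiff ruth; have cu' := regular_cdiff ru'th.
have eth' := prolong_infty_eq hp.
have cP z := regular_cdiff (@regular_Phimap _ _ c g th z d0).
have comp ga v : dcurve ga th v ->
   dcurve (fun t => Phimap c g (ga t)) th' (fun z => dd (fun th => Phimap c g th z) th v).
  move=> hga; split=> z; last exact: (cP z).2 _ _ hga.
  by rewrite eth'; congr (Phimap _ _ _ _); apply/funext => z'; case: hga.
have [cuP eP] : cdiff (fun th => u (Phimap c g th)) th /\ forall v,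
   dd (fun th => u (Phimap c g th)) th v = dd u th' (fun z => dd (fun th => Phimap c g th z) th v).
  apply: cdiff_intro => [x v w|ga v hga]; last exact: cu.2 _ _ (comp _ _ hga).
  by under eq_fun do rewrite (cP _).1; rewrite cu.1.
have ez : znbhd (maxn k1 1) th (fun th => u (Phimap c g th) = u' th).
  have h1 : znbhd (maxn k1 1) th (fun th => \det (gJ c g th) != 0).
    exists (fun th => \det (gJ c g th)); split=> //.
    by apply: polynomial_on_detgJ; rewrite leq_max orbT.
  have := znbhdI (znbhdW (leq_maxl k1 1) (fun _ x => x) e1) h1.
  by apply: znbhdS => s [hs ds]; rewrite (hs _ (prolong_infty_Phimap ds)).
have [_ e'] := cdiff_ext ez cuP.
rewrite !horizontal_dd e' eP.
congr (dd u th' _); apply/funext => z.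
rewrite (cdiff_lin _ _ _ (cP z)).
under eq_bigr do rewrite -dtotE dtot_Phimap // -eth' mulr_sumr.
rewrite exchange_big /=; apply: eq_bigr => i _.
rewrite hath // mulr_suml; apply: eq_bigr => j _; ring.
Qed.

End Equivariance.

(** * Adapted frames *)

Section LinearForms.
Local Open Scope ring_scope.
Variables (R : realType) (N : nat).

Definition linform (L : 'cV[R]_N -> R) := forall a v w, L (a *: v + w) = a * L v + L w.

Lemma linform0 L : linform L -> L 0 = 0.
Proof. by move=> h; have := h 1 0 0; rewrite scaler0 addr0 mul1r => e; set y := L 0 in e *; lra. Qed.

Lemma linformZ L a v : linform L -> L (a *: v) = a * L v.
Proof. by move=> h; have := h a v 0; rewrite addr0 (linform0 h) addr0. Qed.

Lemma linformD L v w : linform L -> L (v + w) = L v + L w.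
Proof. by move=> h; have := h 1 v w; rewrite scale1r mul1r. Qed.

Lemma linformN L v : linform L -> L (- v) = - L v.
Proof. by move=> h; rewrite -scaleN1r linformZ // mulN1r. Qed.

Lemma linformB L v w : linform L -> L (v - w) = L v - L w.
Proof. by move=> h; rewrite linformD // linformN. Qed.

Lemma linform_sum (T : Type) (s : seq T) (P : pred T) (x : T -> R) v L : linform L ->
  L (\sum_(i <- s | P i) x i *: v i) = \sum_(i <- s | P i) x i * L (v i).
Proof.
move=> h; elim: s => [|i s IH]; first by rewrite !big_nil linform0.
rewrite !big_cons; case: (P i) => //.
by rewrite h IH.
Qed.

Lemma linform_delta L v : linform L -> L v = \sum_k v k 0 * L (delta_mx k 0).
Proof.
move=> h; rewrite -(linform_sum _ _ _ _ h); congr L.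
rewrite [LHS]matrix_sum_delta; apply: eq_bigr => k _; by rewrite big_ord1.
Qed.

End LinearForms.

Section Frames.
Local Open Scope ring_scope.
Variables (R : realType) (n : nat) (c : 'I_(n + n)).
Local Notation m := (n + n).-1.
Local Notation N := (n + n)%N.
Implicit Types (th : jet R m) (u w y z : 'cV[R]_N).

Lemma omega_linl w : linform (fun v : 'cV[R]_N => omega v w).
Proof.
move=> a v v'; rewrite /omega mulr_sumr -big_split; apply: eq_bigr => i _ /=.
by rewrite !mxE; ring.
Qed.

Lemma omegaC v w : omega v w = - omega w v :> R.
Proof. by rewrite /omega -sumrN; apply: eq_bigr => i _; ring. Qed.

Lemma omega_linr v : linform (fun w : 'cV[R]_N => omega v w).
Proof. by move=> a w w'; rewrite omegaC omega_linl [omega v w]omegaC [omega v w']omegaC; ring. Qed.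

Lemma omegavv (v : 'cV[R]_N) : omega v v = 0 :> R.
Proof. have := omegaC v v; lra. Qed.

Lemma dq_lin th : linform (dq c th).
Proof.
move=> a v w; rewrite /dq.
have -> : \sum_i th (inr U_(i)%MM) * (a *: v + w) (lift c i) 0 =
    a * (\sum_i th (inr U_(i)%MM) * v (lift c i) 0) + \sum_i th (inr U_(i)%MM) * w (lift c i) 0.
  by rewrite mulr_sumr -big_split; apply: eq_bigr => i _ /=; rewrite !mxE; ring.
by rewrite !mxE; ring.
Qed.

Lemma d2qC th v w : d2q c th v w = d2q c th w v.
Proof.
rewrite /d2q; congr (- _); rewrite exchange_big; apply: eq_bigr => i _; apply: eq_bigr => j _.
by rewrite [(U_(i) + _)%MM]addmC /=; ring.
Qed.

Lemma d2q_linl th w : linform (fun v => d2q c th v w).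
Proof.
move=> a v v'; rewrite /d2q mulrN -opprD mulr_sumr -big_split; congr (- _).
apply: eq_bigr => i _; rewrite mulr_sumr -big_split; apply: eq_bigr => j _ /=.
by rewrite !mxE; ring.
Qed.

Lemma QformC th v w : Qform c th v w = Qform c th w v.
Proof. by rewrite /Qform d2qC. Qed.

Lemma Qform_linl th w : linform (fun v => Qform c th v w).
Proof. by move=> a v v'; rewrite /Qform d2q_linl; ring. Qed.

Lemma Qform_linr th v : linform (fun w => Qform c th v w).
Proof. by move=> a w w'; rewrite QformC Qform_linl ![Qform c th _ v]QformC. Qed.

(** The a-th coordinate in a Darboux basis with conjugate pairs (v_0, v_1),
    (v_2, v_3), ... *)
Definition dual (v : nat -> 'cV[R]_N) (a : nat) (w : 'cV[R]_N) : R :=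
  if odd a then omega (v a.-1) w else omega w (v a.+1).

Lemma dual_lin v a : linform (dual v a).
Proof. by rewrite /dual; case: (odd a); [exact: omega_linr|exact: omega_linl]. Qed.

Definition darboux r (v : nat -> 'cV[R]_N) := forall a b, (a < b < r)%N ->
  omega (v a) (v b) = (~~ odd a && (b == a.+1))%:R.

Lemma odd_dim : odd N = false.
Proof. by rewrite oddD addbb. Qed.

Lemma dual_basis r v a b : ~~ odd r -> darboux r v -> (a < r)%N -> (b < r)%N ->
  dual v a (v b) = (a == b)%:R.
Proof.
move=> er hv ha hb; rewrite /dual; case: ifPn => oa.
  have a0 : (0 < a)%N by case: (a) oa.
  have oa1 : ~~ odd a.-1 by case: (a) oa a0 => //= k; rewrite negbK.
  have [hlt|hgt|<-] := ltngtP a.-1 b.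
  - by rewrite hv ?hlt // oa1 prednK // eq_sym.
  - rewrite omegaC hv; last by rewrite hgt (leq_ltn_trans (leq_pred _) ha).
    have -> : (a == b) = false by apply/eqP => e; move: hgt; rewrite -e; case: (a) a0 => //= k _; rewrite ltnNge leqnSn.
    case: (boolP (odd b)) => ob; rewrite ?oppr0 //=.
    have -> : (a.-1 == b.+1) = false; last by rewrite oppr0.
    by apply/eqP => e; move: oa1; rewrite e /= ob.
  - rewrite omegavv; have -> // : (a == a.-1) = false.
    by apply/eqP; case: (a) a0 => //= k _ /esym/n_Sn.
have ha1 : (a.+1 < r)%N.
  rewrite ltn_neqAle ha andbT; apply/eqP => e; move: er; rewrite -e /= oa //.
have [hlt|hgt|->] := ltngtP b a.+1.
- rewrite hv ?hlt // eqSS; have [<-|_] := eqVneq a b; first by rewrite oa.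
  by rewrite andbF.
- rewrite omegaC hv ?hgt //= oa /= oppr0; have -> // : (a == b) = false.
  by apply/eqP => e; move: hgt; rewrite e ltnNge leqnSn.
- rewrite omegavv; have -> // : (a == a.+1) = false by apply/eqP/n_Sn.
Qed.

Lemma darboux_expand v w : darboux N v -> w = \sum_(a < N) dual v a w *: v a.
Proof.
move=> hv.
pose F : 'M[R]_N := \matrix_(k, a) v a k 0.
pose H : 'M[R]_N := \matrix_(a, k) dual v a (delta_mx k 0).
have HF : H *m F = 1%:M.
  apply/matrixP => a b; rewrite !mxE.
  rewrite -(@dual_basis N v a b) ?odd_dim //.
  rewrite (linform_delta (v b) (dual_lin v a)); apply: eq_bigr => k _.
  by rewrite !mxE mulrC.
have FH := mulmx1C HF.
rewrite -[LHS]mul1mx -FH -mulmxA; apply/matrixP => k l; rewrite ord1 mxE summxE.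
apply: eq_bigr => a _; rewrite !mxE mulrC; congr (_ * _).
by rewrite (linform_delta w (dual_lin v a)); apply: eq_bigr => j _; rewrite !mxE mulrC.
Qed.

Lemma darboux_eq v w w' : darboux N v -> (forall a, (a < N)%N -> dual v a w = dual v a w') ->
  w = w'.
Proof.
move=> hv h; rewrite (darboux_expand w hv) (darboux_expand w' hv).
by apply: eq_bigr => a _; rewrite h.
Qed.

Lemma linform_expand v w L : darboux N v -> linform L ->
  L w = \sum_(a < N) dual v a w * L (v a).
Proof. by move=> hv hL; rewrite {1}(darboux_expand w hv) linform_sum. Qed.

(** The algebraic properties which the successive choices impose on the position
    vector and the frame: they are conjugate in pairs for omega, starting from v_0,
    and, off the diagonal, in pairs for Q, starting from v_1. *)
Definition adapted th (v : nat -> 'cV[R]_N) :=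
  [/\ v 0%N = position c th /\ dq c th (v 0%N) != 0,
      forall a, (0 < a < N)%N -> dq c th (v a) = 0,
      darboux N v
    & forall a b, (0 < a)%N -> (a < b < N)%N ->
        Qform c th (v a) (v b) = (odd a && (b == a.+1))%:R].

Definition Qdiag th (v : nat -> 'cV[R]_N) a := Qform c th (v a) (v a).

(** Nondegeneracy of Q on the span of v_s, v_(s+1), ... for every odd s >= 3: the
    matrix of Q there consists of blocks with rows (I_a, 1), (1, I_(a+1)), followed by
    the number I_(2n-1). *)
Definition nondeg th v :=
  (forall a, odd a -> (2 < a)%N -> (a.+1 < N)%N -> Qdiag th v a * Qdiag th v a.+1 != 1)
  /\ ((2 < N.-1)%N -> Qdiag th v N.-1 != 0).

Lemma sum_delta_nat (x : nat -> R) (M k : nat) :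
  \sum_(b < M) x b * (b == k :> nat)%:R = if (k < M)%N then x k else 0.
Proof.
case: ltnP => hk.
  rewrite (bigD1 (Ordinal hk)) //= eqxx mulr1 big1 ?addr0 // => b hb.
  by rewrite (_ : (b == k :> nat) = false) ?mulr0 //; apply/negbTE; move: hb; apply: contraNneq => e; apply/eqP/val_inj.
rewrite big1 // => b _; rewrite (_ : (b == k :> nat) = false) ?mulr0 //.
by apply/eqP => e; move: (ltn_ord b); rewrite e ltnNge hk.
Qed.

(** The rows of the block diagonal matrix of Q in an adapted frame. *)
Lemma Q_row th v a w : adapted th v -> (0 < a < N)%N -> dual v 0 w = 0 ->
  Qform c th w (v a) = dual v a w * Qdiag th v a
    + (if odd a then (if (a.+1 < N)%N then dual v a.+1 w else 0) else dual v a.-1 w).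
Proof.
move=> [h1 h2 hv h4] /andP[a0 aN] w0.
rewrite (linform_expand w hv (Qform_linl th (v a))).
have e (b : 'I_N) : dual v b w * Qform c th (v b) (v a) =
   dual v b w * Qdiag th v a * (b == a :> nat)%:R
   + (dual v b w * (odd a)%:R * (b == a.+1 :> nat)%:R
      + dual v b w * (~~ odd a)%:R * (b == a.-1 :> nat)%:R).
  have [b0|b0] := posnP b.
    rewrite b0 w0 !mul0r; ring.
  have [hlt|hgt|heq] := ltngtP b a.
  - rewrite h4 ?hlt ?b0 //.
    rewrite (_ : (b == a.+1 :> nat) = false); last first.
      by apply/eqP => e; move: hlt; rewrite e ltnNge leqnSn.
    have [e|ne] := eqVneq a b.+1.
      by rewrite e /= eqxx negbK andbT [true%:R]mulr1n; ring.
    rewrite (_ : (b == a.-1 :> nat) = false) ?andbF; first by rewrite /=; ring.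
    by apply/eqP => e; case/eqP: ne; rewrite e prednK.
  - rewrite QformC h4 ?hgt ?a0 //=.
    rewrite (_ : (b == a.-1 :> nat) = false); last first.
      by apply/eqP => e; move: hgt; rewrite e ltnNge leq_pred.
    by rewrite -mulnb natrM /=; ring.
  - rewrite heq (_ : (a == a.+1) = false); last by apply/eqP/n_Sn.
    rewrite (_ : (a == a.-1) = false); last by apply/eqP; case: (a) a0 => //= k _ /esym/n_Sn.
    by rewrite /Qdiag -heq /= [true%:R]mulr1n; ring.
rewrite (eq_bigr _ (fun b _ => e b)) !big_split /=.
rewrite (sum_delta_nat (fun b => dual v b w * Qdiag th v a)) aN; congr (_ + _).
rewrite (sum_delta_nat (fun b => dual v b w * (odd a)%:R)).
rewrite (sum_delta_nat (fun b => dual v b w * (~~ odd a)%:R)).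
rewrite (leq_ltn_trans (leq_pred a) aN).
by case: (odd a); case: ifP => _; rewrite ?mulr1n ?mulr0n /=; ring.
Qed.

(** A vector d of the tail which is Q-orthogonal to the tail vanishes, each block of
    the matrix of Q being invertible. *)
Lemma adapted_tail th v s d : adapted th v -> nondeg th v -> odd s -> (2 < s)%N ->
  (forall a, (a < s)%N -> dual v a d = 0) ->
  (forall a, (s <= a < N)%N -> Qform c th d (v a) = 0) -> d = 0.
Proof.
move=> hA [nd1 nd2] os s2 hlow hQ; have [_ _ hv _] := hA.
have d0 : dual v 0 d = 0 by apply: hlow; exact: leq_ltn_trans s2.
have key a : odd a -> (s <= a < N)%N -> dual v a d = 0 /\ ((a.+1 < N)%N -> dual v a.+1 d = 0).
  move=> oa /andP[sa aN].
  have a0 : (0 < a)%N by apply: leq_trans sa; exact: leq_ltn_trans s2.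
  have := Q_row hA (w := d) (a := a); rewrite a0 aN oa hQ ?sa // => /(_ isT d0).
  case: ltnP => [a1N|a1N] E1.
    have := Q_row hA (w := d) (a := a.+1).
    rewrite a1N /= oa /= hQ ?a1N ?(leqW sa) // => /(_ isT d0) E2.
    have hn := nd1 a oa (leq_trans s2 sa) a1N.
    set p := dual v a d in E1 E2 *; set q := dual v a.+1 d in E1 E2 *.
    set I := Qdiag th v a in E1 hn; set J := Qdiag th v a.+1 in E2 hn.
    have hp : p * (1 - I * J) = 0.
      have eq : q = - (p * I) by apply/eqP; rewrite -addr_eq0 addrC -E1.
      by rewrite eq in E2; rewrite [RHS]E2; ring.
    move/eqP: hp; rewrite mulf_eq0 subr_eq0 [1 == _]eq_sym (negbTE hn) orbF => /eqP p0.
    by split=> // _; move: E1; rewrite p0 mul0r add0r => <-.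
  have ea : a = N.-1 by apply/eqP; rewrite eqn_leq -ltnS prednK ?aN ?(leq_ltn_trans (leq0n _) aN) //= -ltnS prednK ?(leq_ltn_trans (leq0n _) aN).
  split=> //; move/eqP: E1; rewrite addr0 eq_sym mulf_eq0 => /orP[/eqP //|].
  by rewrite ea (negbTE (nd2 _)) // -ea; exact: leq_trans s2 sa.
apply: (darboux_eq hv) => a aN; rewrite (linform0 (dual_lin v a)).
have [alts|sa] := ltnP a s; first exact: hlow.
case: (boolP (odd a)) => oa; first by have [|->] := key a oa; rewrite ?sa.
have a0 : (0 < a)%N by apply: leq_trans sa; exact: leq_ltn_trans s2.
have sa1 : (s <= a.-1)%N.
  by rewrite -ltnS prednK // ltn_neqAle sa andbT; apply: contraNneq oa => <-.
have oa1 : odd a.-1 by case: (a) oa a0 => //= k; rewrite negbK.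
have hr : (s <= a.-1 < N)%N by rewrite sa1 (leq_ltn_trans (leq_pred _) aN).
by have [_] := key a.-1 oa1 hr; rewrite prednK // => /(_ aN).
Qed.

(** Pi_r is cut out by the vanishing of the first r + 1 coordinates in the adapted
    frame. There v_(r+1) satisfies the conditions of the next step; it is the only such
    vector because, in odd steps, the kernel is a line, and, in even steps, the
    difference of two candidates is Q-orthogonal to the tail. *)
Lemma adapted_frame_flag th v : (0 < n)%N -> adapted th v -> nondeg th v ->
  forall r, (r < N)%N -> frame_flag c th r =
    (v r, [set w | forall a, (a <= r)%N -> dual v a w = 0]%classic).
Proof.
move=> n0 hA hnd; have [[h0 dq0] h2 hv h4] := hA.
have N0 : (0 < N)%N by rewrite addn_gt0 n0.
have db a b : (a < N)%N -> (b < N)%N -> dual v a (v b) = (a == b)%:R.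
  by apply: dual_basis => //; rewrite odd_dim.
elim=> [|r IH] hr.
  congr (_, _); first by rewrite h0.
  apply/seteqP; split=> w /=.
    rewrite /tangent /= (linform_expand w hv (dq_lin th)) => e a; rewrite leqn0 => /eqP ->.
    move/eqP: e; rewrite (bigD1 (Ordinal N0)) //= big1 ?addr0 => [|b hb].
      by rewrite mulf_eq0 (negbTE dq0) orbF => /eqP.
    by rewrite h2 ?mulr0 // ltn_ord andbT lt0n; apply: contra hb => /eqP e; apply/eqP/val_inj.
  move=> h; rewrite /tangent /= (linform_expand w hv (dq_lin th)) big1 // => b _.
  have [->|b0] := posnP b; first by rewrite h ?mul0r.
  by rewrite h2 ?mulr0 // ltn_ord b0.
have hrN : (r < N)%N by exact: ltnW.
have PiS w : (forall a, (a <= r.+1)%N -> dual v a w = 0) <->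
   (forall a, (a <= r)%N -> dual v a w = 0) /\ dual v r.+1 w = 0.
  split=> [h|[h h'] a]; first by split=> [a ha|]; apply: h; rewrite // leqW.
  by rewrite leq_eqVlt ltnS => /orP[/eqP ->|/h].
rewrite [LHS]/= IH //=; case: ifPn => or.
  congr (_, _); last first.
    apply/seteqP; split=> w /=; rewrite PiS /dual /= or //.
  have Pv : (forall a, (a <= r)%N -> dual v a (v r.+1) = 0).
    move=> a ha; rewrite db // ?(leq_ltn_trans ha) //.
    by rewrite (_ : (a == r.+1) = false) //; apply/eqP => e; move: ha; rewrite e ltnn.
  have hvr : omega (v r) (v r.+1) = 1 by rewrite hv ?ltnSn ?hr // or eqxx.
  have hk : spans_kernel [set w | forall a, (a <= r)%N -> dual v a w = 0]%classic (v r.+1).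
    move=> z; split=> /= [[hz hy]|[a ->]].
      exists (dual v r.+1 z); apply: (darboux_eq hv) => a aN.
      rewrite (linformZ _ _ (dual_lin v a)) db //.
      have [alt|agt|->] := ltngtP a r.+1.
      - by rewrite mulr0 hz.
      - rewrite mulr0 /dual; case: ifPn => oa.
          rewrite omegaC hy ?oppr0 // => b hb; rewrite db ?(leq_ltn_trans (leq_pred _) aN) //.
            have ne : (b == a.-1) = false; last by rewrite ne.
            apply/eqP => e; move: hb; rewrite e leqNgt.
            have a0 : (0 < a)%N by case: (a) agt.
            by rewrite -ltnS prednK // agt.
          exact: leq_ltn_trans hb hrN.
        have a1N : (a.+1 < N)%N.
          by rewrite ltn_neqAle aN andbT; apply/eqP => e; move: odd_dim; rewrite -e /= oa.
        apply: hy => b hb; rewrite db // ?(leq_ltn_trans hb hrN) //.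
        have ne : (b == a.+1) = false; last by rewrite ne.
        apply/eqP => e; move: hb; rewrite e leqNgt.
        by rewrite (ltn_trans _ (ltnSn a)) // (ltn_trans (ltnSn r) agt).
      - by rewrite mulr1.
    split=> [b hb|y hy]; first by rewrite (linformZ _ _ (dual_lin v b)) Pv ?mulr0.
    rewrite (linformZ _ _ (omega_linl y)) omegaC.
    have := hy r (leqnn r); rewrite /dual (negbTE or) => ->; by rewrite oppr0 mulr0.
  apply: xget_unique => //= z [hz1 hz2 hz3].
  have [hz4 _] := hz2 (v r.+1); have [|a hva] := hz4.
    by apply: (hk (v r.+1)).2; exists 1; rewrite scale1r.
  have a1 : a = 1 by move: hvr; rewrite hva (linformZ _ _ (omega_linr (v r))) hz3 mulr1.
  by rewrite hva a1 scale1r.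
rewrite negbK in or.
have r0 : (0 < r)%N by case: (r) or.
have hQ w : (forall a, (a <= r)%N -> dual v a w = 0) -> Qform c th (v r) w = dual v r.+1 w.
  move=> h; rewrite QformC (Q_row hA); last 2 first.
  - by rewrite r0 hrN.
  - exact: h.
  by rewrite h // mul0r add0r or hr.
have ePi : [set w | (forall a, (a <= r)%N -> dual v a w = 0) /\ Qform c th (v r) w = 0]%classic
   = [set w | forall a, (a <= r.+1)%N -> dual v a w = 0]%classic.
  apply/seteqP; split=> w /=; rewrite PiS => -[h h']; split=> //.
    by rewrite -hQ.
  by rewrite hQ.
congr (_, _); last exact: ePi.
have hPi y : (forall a, (a <= r.+1)%N -> dual v a y = 0) <->
    (forall a, (a <= r)%N -> dual v a y = 0) /\ Qform c th (v r) y = 0.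
  by rewrite PiS; split=> -[h h']; split=> //; [rewrite hQ|rewrite -hQ].
apply: xget_unique => /=.
  split.
  - move=> a ha; rewrite db ?(leq_ltn_trans ha hrN) //.
    by rewrite (_ : (a == r.+1) = false) //; apply/eqP => e; move: ha; rewrite e ltnn.
  - move=> y /hPi hy; rewrite QformC (Q_row hA); last 2 first.
    + by rewrite hr.
    + exact: hy.
    by rewrite /= or /= hy // hy // mul0r addr0.
  - by rewrite h4 ?ltnSn ?hr //= or eqxx.
move=> z [hz1 hz2 hz3]; apply/eqP; rewrite -subr_eq0; apply/eqP.
apply: (adapted_tail (s := r.+2) hA hnd) => //=.
- by rewrite negbK.
- move=> a; rewrite ltnS leq_eqVlt => /orP[/eqP ->|ha].
    by rewrite (linformB _ _ (dual_lin v _)) db // eqxx -hQ // hz3 subrr.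
  rewrite (linformB _ _ (dual_lin v _)) db ?hz1 ?(ltn_trans ha) //.
  by rewrite (_ : (a == r.+1) = false) ?subr0 //; apply/eqP => e; move: ha; rewrite e ltnn.
- move=> a /andP[ra aN].
  have hQz : Qform c th z (v a) = 0.
    apply: hz2; apply/hPi => b hb; rewrite db ?(leq_ltn_trans hb hr) //.
    by rewrite (_ : (b == a) = false) //; apply/eqP => e; move: hb; rewrite e leqNgt ra.
  rewrite (linformB _ _ (Qform_linl th (v a))) hQz h4 ?ra ?aN //.
  by rewrite /= or /= subrr.
Qed.

Lemma adapted_frame th v r : (0 < n)%N -> adapted th v -> nondeg th v -> (r < N)%N ->
  frame c r th = v r.
Proof. by move=> n0 hA hn hr; rewrite /frame (adapted_frame_flag n0 hA hn hr). Qed.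

End Frames.

(** * Equivariance of adapted frames *)

Section FrameEquivariance.
Local Open Scope ring_scope.
Variables (R : realType) (n : nat) (c : 'I_(n + n)).
Local Notation m := (n + n).-1.
Local Notation N := (n + n)%N.
Implicit Types (th : jet R m) (g : 'M[R]_N) (w : 'cV[R]_N).

Lemma symplectic_unit g : symplectic g -> g \in unitmx.
Proof.
move=> sg; rewrite unitmxE unitfE -det_tr; apply/negP => /det0P[v v0 hv].
have gv : g *m v^T = 0 by rewrite -[RHS]trmx0 -hv trmx_mul trmxK.
have hw w : omega v^T w = 0 by rewrite -sg gv /omega big1 // => i _; rewrite !mxE; ring.
case/eqP: v0; apply/rowP => k; rewrite mxE.
case: (split_ordP k) => i ->.
  have := hw (delta_mx (rshift n i) 0).
  rewrite /omega (bigD1 i) //= big1 ?addr0 => [|j ji]; rewrite !mxE !eqxx /=.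
    by rewrite eq_lrshift mulr1 mulr0 subr0.
  by rewrite eq_rshift (negbTE ji) eq_lrshift /= !mulr0 subr0.
have := hw (delta_mx (lshift n i) 0).
rewrite /omega (bigD1 i) //= big1 ?addr0 => [|j ji]; rewrite !mxE !eqxx /=.
  by rewrite eq_rlshift mulr1 mulr0 sub0r => /eqP; rewrite oppr_eq0 => /eqP.
by rewrite eq_lshift (negbTE ji) eq_rlshift /= !mulr0 subr0.
Qed.

(** The basis of the tangent space over the coordinate directions of the chart. *)
Definition tvec th (j : 'I_m) : 'cV[R]_N :=
  delta_mx (lift c j) 0 + th (inr U_(j)%MM) *: delta_mx c 0.

Lemma tvec_expand th w :
  w = dq c th w *: delta_mx c 0 + \sum_j w (lift c j) 0 *: tvec th j.
Proof.
apply/matrixP => k l; rewrite ord1 mxE summxE; case: (unliftP c k) => [i ->|->].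
  rewrite !mxE eqxx andbT [lift c i == c]eq_sym (negbTE (neq_lift _ _)) mulr0 add0r.
  rewrite (bigD1 i) //= big1 ?addr0 => [|j ji]; rewrite !mxE ?eqxx !andbT.
    by rewrite [lift c i == c]eq_sym (negbTE (neq_lift _ _)) mulr0 addr0 mulr1.
  rewrite [lift c i == c]eq_sym (negbTE (neq_lift _ _)) mulr0 addr0.
  by rewrite (inj_eq lift_inj) eq_sym (negbTE ji) mulr0.
have -> : \sum_j (w (lift c j) 0 *: tvec th j) c 0 = \sum_j th (inr U_(j)%MM) * w (lift c j) 0.
  apply: eq_bigr => j _; rewrite !mxE !eqxx andbT mulr1 (negbTE (neq_lift _ _)) add0r.
  by rewrite mulrC.
by rewrite !mxE !eqxx mulr1 /dq subrK.
Qed.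

Lemma dq_delta th : dq c th (delta_mx c 0) = 1.
Proof.
rewrite /dq mxE !eqxx big1 ?subr0 // => i _.
by rewrite mxE eq_sym (negbTE (neq_lift _ _)) mulr0.
Qed.

Lemma gtvec_lift g th i j : (g *m tvec th j) (lift c i) 0 = gJ c g th i j.
Proof.
by rewrite /tvec mulmxDr -scalemxAr -!colE !mxE; ring.
Qed.

Lemma gtvec_c g th j :
  (g *m tvec th j) c 0 = g c (lift c j) + g c c * th (inr U_(j)%MM).
Proof. by rewrite /tvec mulmxDr -scalemxAr -!colE !mxE; ring. Qed.

Lemma position_grow g th k : (g *m position c th) k 0 = grow c g k th.
Proof.
rewrite mxE (sum_chart c) /position chart_point_c; congr (_ + _).
by apply: eq_bigr => i _; rewrite chart_point_lift.
Qed.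

Lemma prolong_position k g th th' : prolong c k g th th' ->
  position c th' = g *m position c th.
Proof.
move=> hp; apply/matrixP => a b; rewrite ord1 position_grow.
case: (unliftP c a) => [i ->|->].
  by rewrite /position chart_point_lift; exact: prolong_base hp.
have /prolongP[f [f' [[h1 h1'] h2 h3 h4]]] := hp.
have [+ _] := h4; rewrite mevalB comp_mpoly_meval gcomp_meval => /eqP; rewrite subr_eq0 => /eqP.
rewrite (@grow_jeqk _ _ _ k _ _ _ th); last exact: jet_of_jeqk.
move=> <-; rewrite /position chart_point_c -h1' ?mdeg0 // mderivm0m.
by apply: meval_eq => i; rewrite h2 tnth_mktuple.
Qed.

(** First and second derivatives of f' o Phi = g_c(X, f(X)). *)
Lemma prolong_order1 k g th th' j : (0 < k)%N -> prolong c k g th th' ->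
  \sum_a th' (inr U_(a)%MM) * gJ c g th a j = g c (lift c j) + g c c * th (inr U_(j)%MM).
Proof.
move=> k0 /prolongP[f [f' [[h1 h1'] h2 h3 h4]]].
move: k0 h1 h1' h4; case: k => // k _ h1 h1' [_ /(_ j)[+ _]].
rewrite mderivB mevalB mderiv_comp raddf_sum /= => /eqP; rewrite subr_eq0 => /eqP.
rewrite mderiv_gcomp mevalD mevalM !mevalC -[f^`M(j)]mderivmU1m h1 ?mdeg1 // addrC => <-.
apply: eq_bigr => a _; rewrite mevalM comp_mpoly_meval tnth_mktuple mderiv_gcomp.
rewrite mevalD mevalM !mevalC -[f^`M(j)]mderivmU1m h1 ?mdeg1 // [gJ _ _ _ _ _]mxE addrC.
congr (_ * _); rewrite -h1' ?mdeg1 // mderivmU1m.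
by apply: meval_eq => i; rewrite h2 tnth_mktuple.
Qed.

Lemma prolong_order2 k g th th' i j : (1 < k)%N -> prolong c k g th th' ->
  \sum_a (\sum_b th' (inr (U_(a) + U_(b))%MM) * gJ c g th b i) * gJ c g th a j =
  (g c c - \sum_a th' (inr U_(a)%MM) * g (lift c a) c) * th (inr (U_(i) + U_(j))%MM).
Proof.
move=> k0 /prolongP[f [f' [[h1 h1'] h2 h3 h4]]].
have k0' : (0 < k)%N by exact: ltnW.
have hf1 l : (f^`M(l)).@[jbase th] = th (inr U_(l)%MM).
  by rewrite -mderivmU1m h1 ?mdeg1.
have hf2 : (f^`M(j)^`M(i)).@[jbase th] = th (inr (U_(i) + U_(j))%MM).
  by rewrite addmC -!mderivmU1m -mderivmDm h1 // mdegD !mdeg1.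
have hJ l a : ((tnth (Phi c g f) a)^`M(l)).@[jbase th] = gJ c g th a l.
  by rewrite tnth_mktuple mderiv_gcomp mevalD mevalM !mevalC hf1 mxE addrC.
have hJ2 a : ((tnth (Phi c g f) a)^`M(j)^`M(i)).@[jbase th] =
    g (lift c a) c * th (inr (U_(i) + U_(j))%MM).
  by rewrite tnth_mktuple mderiv_gcomp mderivD mderiv_mulC mderivC addr0 mevalM mevalC hf2.
have hg1 a : ((f'^`M(a)) \mPo Phi c g f).@[jbase th] = th' (inr U_(a)%MM).
  rewrite comp_mpoly_meval -h1' ?mdeg1 // mderivmU1m.
  by apply: meval_eq => l; rewrite h2 tnth_mktuple.
have hg2 a b : ((f'^`M(a)^`M(b)) \mPo Phi c g f).@[jbase th] = th' (inr (U_(a) + U_(b))%MM).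
  rewrite comp_mpoly_meval -h1' ?mdegD ?mdeg1 // mderivmDm !mderivmU1m.
  by apply: meval_eq => l; rewrite h2 tnth_mktuple.
have [_ /(_ j)[_ /(_ i)[+ _]]] : van (jbase th) 3 ((f' \mPo Phi c g f) - gcomp c g f c).
  by apply: van_le h4.
rewrite !mderivB mevalB mderiv_comp.
rewrite (big_morph _ (mderivD i) (mderiv0 _ i)) raddf_sum /= => /eqP; rewrite subr_eq0 => /eqP.
rewrite mderiv_gcomp mderivD mderiv_mulC mderivC addr0 mevalM mevalC hf2.
under eq_bigr do rewrite mderivM mevalD !mevalM hJ2 hg1 mulrA hJ.
rewrite big_split /= => e; rewrite mulrBl -e mulr_suml addrK.
apply: eq_bigr => a _; congr (_ * _); rewrite mderiv_comp raddf_sum /=.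
by apply: eq_bigr => b _; rewrite mevalM hg2 hJ.
Qed.

(** The image hypersurface has the defining function q o g^-1, up to a factor: here
    the factor lam, by which the second differential on tangent vectors and the value
    on the position vector are multiplied as well, so that Q is invariant. *)
Lemma prolong_dq k g th th' : (0 < k)%N -> prolong c k g th th' -> g \in unitmx ->
  exists2 lam, lam != 0 &
    lam = g c c - \sum_a th' (inr U_(a)%MM) * g (lift c a) c /\
    forall w, dq c th' (g *m w) = lam * dq c th w.
Proof.
move=> k0 hp ug; pose lam := g c c - \sum_a th' (inr U_(a)%MM) * g (lift c a) c.
have hlam : dq c th' (g *m delta_mx c 0) = lam.
  by rewrite /dq -colE mxE; congr (_ - _); apply: eq_bigr => a _; rewrite mxE.
have ht j : dq c th' (g *m tvec th j) = 0.
  rewrite /dq gtvec_c -(prolong_order1 j k0 hp); apply/eqP; rewrite subr_eq0; apply/eqP.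
  by apply: eq_bigr => a _; rewrite gtvec_lift.
have hw w : dq c th' (g *m w) = lam * dq c th w.
  rewrite {1}(tvec_expand th w) mulmxDr -scalemxAr (dq_lin c th') hlam mulmx_sumr.
  have -> : \sum_j g *m (w (lift c j) 0 *: tvec th j) =
            \sum_j w (lift c j) 0 *: (g *m tvec th j).
    by apply: eq_bigr => j _; rewrite scalemxAr.
  rewrite (linform_sum _ _ _ _ (dq_lin c th')) big1 ?addr0 1?mulrC // => j _.
  by rewrite ht mulr0.
exists lam => //; apply/eqP => l0.
have := hw (invmx g *m delta_mx c 0); rewrite l0 mul0r mulKVmx // dq_delta => /eqP.
by rewrite oner_eq0.
Qed.

Lemma prolong_Qform k g th th' w w' : (1 < k)%N -> prolong c k g th th' -> g \in unitmx ->
  dq c th w = 0 -> dq c th w' = 0 ->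
  Qform c th' (g *m w) (g *m w') = Qform c th w w'.
Proof.
move=> k1 hp ug hw hw'; have [lam l0 [elam hdq]] := prolong_dq (ltnW k1) hp ug.
rewrite /Qform (prolong_position hp) hdq.
suff -> : d2q c th' (g *m w) (g *m w') = lam * d2q c th w w'.
  by rewrite invfM mulrACA mulfV // mul1r.
have lift_g z a : dq c th z = 0 ->
    (g *m z) (lift c a) 0 = \sum_j gJ c g th a j * z (lift c j) 0.
  move=> hz; rewrite {1}(tvec_expand th z) hz scale0r add0r mulmx_sumr summxE.
  by apply: eq_bigr => j _; rewrite -scalemxAr mxE gtvec_lift mulrC.
rewrite /d2q mulrN; congr (- _).
under eq_bigr do under eq_bigr do rewrite !lift_g //.
transitivity (\sum_i \sum_j w (lift c i) 0 * w' (lift c j) 0 *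
   \sum_a (\sum_b th' (inr (U_(a) + U_(b))%MM) * gJ c g th b i) * gJ c g th a j).
  transitivity (\sum_i \sum_j \sum_a \sum_b w (lift c i) 0 * w' (lift c j) 0 *
     (th' (inr (U_(a) + U_(b))%MM) * gJ c g th b i * gJ c g th a j)); last first.
    apply: eq_bigr => i _; apply: eq_bigr => j _; rewrite mulr_sumr.
    by apply: eq_bigr => a _; rewrite mulr_suml mulr_sumr.
  transitivity (\sum_a \sum_b \sum_i \sum_j w (lift c i) 0 * w' (lift c j) 0 *
     (th' (inr (U_(a) + U_(b))%MM) * gJ c g th a i * gJ c g th b j)).
    apply: eq_bigr => a _; apply: eq_bigr => b _.
    rewrite [th' _ * _]mulr_sumr mulr_suml.
    apply: eq_bigr => i _; rewrite mulr_sumr; apply: eq_bigr => j _; ring.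
  rewrite exchange_big /=.
  transitivity (\sum_a \sum_i \sum_j \sum_b w (lift c i) 0 * w' (lift c j) 0 *
     (th' (inr (U_(a) + U_(b))%MM) * gJ c g th b i * gJ c g th a j)).
    apply: eq_bigr => a _; rewrite exchange_big; apply: eq_bigr => i _ /=.
    rewrite exchange_big; apply: eq_bigr => j _; apply: eq_bigr => b _.
    by rewrite [(U_(b) + _)%MM]addmC.
  rewrite exchange_big /=; apply: eq_bigr => i _.
  by rewrite exchange_big.
rewrite mulr_sumr; apply: eq_bigr => i _; rewrite mulr_sumr; apply: eq_bigr => j _.
by rewrite (prolong_order2 i j k1 hp) -elam; ring.
Qed.

Lemma adapted_prolong k g th th' v : (0 < n)%N -> (1 < k)%N -> prolong c k g th th' ->
  symplectic g -> adapted c th v -> nondeg c th v ->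
  adapted c th' (fun a => g *m v a) /\ nondeg c th' (fun a => g *m v a).
Proof.
move=> n0 k1 hp sg [[h0 h0'] h2 h3 h4] [nd1 nd2]; have ug := symplectic_unit sg.
have [lam l0 [elam hdq]] := prolong_dq (ltnW k1) hp ug.
have hQ a b : (0 < a < N)%N -> (0 < b < N)%N ->
    Qform c th' (g *m v a) (g *m v b) = Qform c th (v a) (v b).
  by move=> ha hb; apply: (prolong_Qform k1 hp ug); apply: h2.
have N0 : (0 < N)%N by rewrite addn_gt0 n0.
split.
  split; first by rewrite h0 (prolong_position hp) hdq -h0 mulf_neq0.
  - by move=> a ha; rewrite hdq h2 ?mulr0.
  - by move=> a b hab; rewrite sg h3.
  - move=> a b a0 /andP[ab bN]; rewrite hQ ?h4 ?ab ?bN ?a0 ?(ltn_trans ab bN) //.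
    by rewrite (ltn_trans a0 ab).
split=> [a oa a2 a1N|h2N].
  by rewrite /Qdiag !hQ ?a1N ?(ltnW a1N) ?(ltn_trans _ a2) //; exact: nd1.
rewrite /Qdiag hQ; first exact: nd2.
- by rewrite (ltn_trans _ h2N) //= ltn_predL.
- by rewrite (ltn_trans _ h2N) //= ltn_predL.
Qed.

End FrameEquivariance.

(** * Rationality of the frame in the 2-jet *)

Section RegularMatrices.
Local Open Scope ring_scope.
Variables (R : realType) (m k : nat) (t : jet R m).

Lemma regular_det d (A : jet R m -> 'M[R]_d) :
  (forall i j, regular k t (fun th => A th i j)) -> regular k t (fun th => \det (A th)).
Proof.
move=> h; apply: regular_sum => s; apply: regular_mul; first exact: regular_const.
by apply: regular_prod => i; apply: h.
Qed.

Lemma regular_adj d (A : jet R m -> 'M[R]_d) i j :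
  (forall i j, regular k t (fun th => A th i j)) ->
  regular k t (fun th => (\adj (A th)) i j).
Proof.
move=> h; under eq_fun do rewrite mxE /cofactor; apply: regular_mul.
  exact: regular_const.
by apply: regular_det => a b; under eq_fun do rewrite !mxE; apply: h.
Qed.

Lemma regular_invmx d (A : jet R m -> 'M[R]_d) i j : A t \in unitmx ->
  (forall i j, regular k t (fun th => A th i j)) ->
  regular k t (fun th => (invmx (A th)) i j).
Proof.
move=> hu h; have hd := regular_det h.
have d0 : \det (A t) != 0 by move: hu; rewrite unitmxE unitfE.
apply: (@regular_ext _ _ _ _ (fun th => (\det (A th))^-1 * (\adj (A th)) i j)).
  apply: znbhdS (regular_neq0 hd d0) => th hth.
  by rewrite /invmx unitmxE unitfE hth [RHS]mxE.
by apply: regular_mul; [exact: regular_inv|exact: regular_adj].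
Qed.

Definition vregular d (V : jet R m -> 'cV[R]_d) := forall i, regular k t (fun th => V th i 0).

Lemma vregular_eq d (V W : jet R m -> 'cV[R]_d) : (forall th, V th = W th) ->
  vregular V -> vregular W.
Proof. by move=> /funext ->. Qed.

Lemma vregular_mulmx d e (A : jet R m -> 'M[R]_(d, e)) (V : jet R m -> 'cV[R]_e) :
  (forall i j, regular k t (fun th => A th i j)) -> vregular V ->
  vregular (fun th => A th *m V th).
Proof.
move=> hA hV i; under eq_fun do rewrite mxE; apply: regular_sum => j.
by apply: regular_mul; [exact: hA|exact: hV].
Qed.

Lemma vregular_scale d x (V : jet R m -> 'cV[R]_d) : regular k t x -> vregular V ->
  vregular (fun th => x th *: V th).
Proof. by move=> hx hV i; under eq_fun do rewrite mxE; apply: regular_mul => //; exact: hV. Qed.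

End RegularMatrices.

Section RegularFrame.
Local Open Scope ring_scope.
Variables (R : realType) (n : nat) (c : 'I_(n + n)).
Local Notation m := (n + n).-1.
Local Notation N := (n + n)%N.
Implicit Types (th t : jet R m) (w y z x : 'cV[R]_N).

Lemma regular_omega t (V W : jet R m -> 'cV[R]_N) : vregular 2 t V -> vregular 2 t W ->
  regular 2 t (fun th => omega (V th) (W th)).
Proof. by move=> hV hW; apply: regular_sum => i; apply: regular_sub; apply: regular_mul; solve [exact: hV|exact: hW]. Qed.

Lemma regular_dq t (V : jet R m -> 'cV[R]_N) : vregular 2 t V ->
  regular 2 t (fun th => dq c th (V th)).
Proof.
move=> hV; apply: regular_sub => //; apply: regular_sum => i; apply: regular_mul => //.
by apply: regular_var; rewrite /= mdeg1.
Qed.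

Lemma vregular_position t : vregular 2 t (position c).
Proof.
move=> k; case: (unliftP c k) => [i ->|->].
  by under eq_fun do rewrite /position chart_point_lift; exact: regular_var.
under eq_fun do rewrite /position chart_point_c; apply: regular_var.
by rewrite /= mdeg0.
Qed.

Lemma regular_Qform t (V W : jet R m -> 'cV[R]_N) : dq c t (position c t) != 0 ->
  vregular 2 t V -> vregular 2 t W -> regular 2 t (fun th => Qform c th (V th) (W th)).
Proof.
move=> d0 hV hW; apply: regular_div => //; last exact/regular_dq/vregular_position.
apply: regular_opp; apply: regular_sum => i; apply: regular_sum => j.
apply: regular_mul => //; apply: regular_mul => //; apply: regular_var.
by rewrite /= mdegD !mdeg1.
Qed.

Lemma vregular_const t w : vregular 2 t (fun=> w).
Proof. move=> i; exact: regular_const. Qed.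

(** The vector representing a linear form with respect to omega. *)
Definition sharp (L : 'cV[R]_N -> R) : 'cV[R]_N :=
  \col_(k < N) (match fintype.split (k : 'I_(n + n)) with
          | inl i => L (delta_mx (rshift n i) 0)
          | inr i => - L (delta_mx (lshift n i) 0) end).

Lemma omega_sharp L y : linform L -> omega (sharp L) y = L y.
Proof.
move=> hL; rewrite (linform_delta y hL) big_split_ord /= addrC -big_split /=.
apply: eq_bigr => i _; rewrite !mxE (unsplitK (inl i)) (unsplitK (inr i)).
by ring.
Qed.

Lemma vregular_sharp t (L : jet R m -> 'cV[R]_N -> R) :
  (forall w, regular 2 t (fun th => L th w)) -> vregular 2 t (fun th => sharp (L th)).
Proof.
move=> h k; under eq_fun do rewrite mxE; case: (fintype.split k) => i //.
exact: regular_opp.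
Qed.

(** Projection along v_0, ..., v_(2r-1) onto their omega-orthogonal complement. *)
Definition proj r (v : nat -> 'cV[R]_N) y := y - \sum_(a < r.*2) dual v a y *: v a.

Lemma proj_lin r v k : linform (fun y => proj r v y k 0).
Proof.
move=> a y z; rewrite /proj !mxE !summxE mulrBr mulr_sumr.
have -> : \sum_(i < r.*2) (dual v i (a *: y + z) *: v i) k 0 =
  \sum_(i < r.*2) a * (dual v i y *: v i) k 0 + \sum_(i < r.*2) (dual v i z *: v i) k 0.
  by rewrite -big_split; apply: eq_bigr => i _; rewrite !mxE (dual_lin v i) /=; ring.
by ring.
Qed.

Lemma projD r v a y z : proj r v (a *: y + z) = a *: proj r v y + proj r v z.
Proof. by apply/matrixP => k l; rewrite ord1 [LHS](proj_lin r v k) !mxE. Qed.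

Lemma linform_proj r v L : linform L -> linform (fun y => L (proj r v y)).
Proof. by move=> h a y z; rewrite projD h. Qed.

Lemma dual_proj r v y a : darboux r.*2 v -> (a < r.*2)%N -> dual v a (proj r v y) = 0.
Proof.
move=> hv ha; rewrite /proj (linformB _ _ (dual_lin v a)) (linform_sum _ _ _ _ (dual_lin v a)).
rewrite (bigD1 (Ordinal ha)) //= big1 ?addr0 => [|b hb].
  by rewrite (dual_basis (r := r.*2)) ?odd_double // eqxx mulr1 subrr.
rewrite (dual_basis (r := r.*2)) ?odd_double //.
rewrite (_ : (a == b :> nat) = false) ?mulr0 //.
by apply/negbTE; apply: contra hb => /eqP e; apply/eqP/val_inj.
Qed.

Lemma dual0_omega r v y : (forall a, (a < r.*2)%N -> dual v a y = 0) <->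
  (forall a, (a < r.*2)%N -> omega (v a) y = 0).
Proof.
split=> h a ha.
  case: (boolP (odd a)) => oa.
    have a0 : (0 < a)%N by case: (a) oa.
    have := h a.-1 (leq_ltn_trans (leq_pred _) ha).
    rewrite /dual (_ : odd a.-1 = false); last by case: (a) oa => //= b /negbTE.
    by rewrite prednK // omegaC => /eqP; rewrite oppr_eq0 => /eqP.
  have ha1 : (a.+1 < r.*2)%N.
    rewrite ltn_neqAle ha andbT; apply/eqP => e.
    by have := odd_double r; rewrite -e /= oa.
  by have := h _ ha1; rewrite /dual /= oa.
rewrite /dual; case: ifPn => oa; first by rewrite h // (leq_ltn_trans (leq_pred _) ha).
have ha1 : (a.+1 < r.*2)%N.
  rewrite ltn_neqAle ha andbT; apply/eqP => e.
  by have := odd_double r; rewrite -e /= oa.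
by rewrite omegaC h ?oppr0.
Qed.

Lemma omega_proj r v y a : darboux r.*2 v -> (a < r.*2)%N -> omega (v a) (proj r v y) = 0.
Proof. by move=> hv; apply: (dual0_omega r v _).1 => b hb; exact: dual_proj. Qed.

Lemma proj_id r v y : (forall a, (a < r.*2)%N -> omega (v a) y = 0) -> proj r v y = y.
Proof.
move=> h; rewrite /proj big1 ?subr0 // => a _.
by rewrite ((dual0_omega r v y).2 h) ?scale0r.
Qed.

Lemma proj0 r v a : darboux r.*2 v -> (a < r.*2)%N -> proj r v (v a) = 0.
Proof.
move=> hv ha; rewrite /proj (bigD1 (Ordinal ha)) //= big1 ?addr0 => [|b hb].
  by rewrite (dual_basis (r := r.*2)) ?odd_double // eqxx scale1r subrr.
rewrite (dual_basis (r := r.*2)) ?odd_double //.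
rewrite (_ : (b == a :> nat) = false) ?scale0r //.
by apply/negbTE; apply: contra hb => /eqP e; apply/eqP/val_inj.
Qed.

Lemma proj_idem r v y : darboux r.*2 v -> proj r v (proj r v y) = proj r v y.
Proof. by move=> hv; apply: proj_id => a ha; exact: omega_proj. Qed.

Lemma vregular_proj t r (V : nat -> jet R m -> 'cV[R]_N) w :
  (forall a, (a < r.*2)%N -> vregular 2 t (V a)) ->
  vregular 2 t (fun th => proj r (V ^~ th) w).
Proof.
move=> h k; under eq_fun do rewrite /proj !mxE summxE.
apply: regular_sub; first exact: regular_const.
apply: regular_sum => a.
apply: (@regular_eq _ _ _ _ (fun th => dual (V ^~ th) a w * V a th k 0)) => [th|].
  by rewrite mxE.
apply: regular_mul; last by apply: h; exact: ltn_ord.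
have -> : (fun th => dual (V ^~ th) a w) =
    if odd a then (fun th => omega (V a.-1 th) w) else (fun th => omega w (V a.+1 th)).
  by apply/funext => th; rewrite /dual; case: ifP.
case: ifPn => oa.
  apply: regular_omega; last exact: vregular_const.
  by apply: h; exact: leq_ltn_trans (leq_pred _) (ltn_ord a).
apply: regular_omega; first exact: vregular_const.
apply: h; rewrite ltn_neqAle ltn_ord andbT; apply/eqP => e.
by have := odd_double r; rewrite -e /= oa.
Qed.

(** Q restricted to the complement, extended to V by the Euclidean form on the other
    summand. Its matrix is invertible if Q is nondegenerate on the complement, so that
    Q-orthogonality conditions on the complement are solved by inverting a matrix of
    fixed size with rational entries. *)
Definition Nform th r v y z : R :=
  Qform c th (proj r v y) (proj r v z)
  + \sum_k (y - proj r v y) k 0 * (z - proj r v z) k 0.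

Definition Nmx th r v : 'M[R]_N :=
  \matrix_(i, j) Nform th r v (delta_mx i 0) (delta_mx j 0).

Lemma Nform_linr th r v y : linform (Nform th r v y).
Proof.
move=> a z z'; rewrite /Nform projD (Qform_linr c th _).
have -> : \sum_k (y - proj r v y) k 0 * (a *: z + z' - (a *: proj r v z + proj r v z')) k 0 =
  a * (\sum_k (y - proj r v y) k 0 * (z - proj r v z) k 0)
  + \sum_k (y - proj r v y) k 0 * (z' - proj r v z') k 0.
  rewrite mulr_sumr -big_split; apply: eq_bigr => k _.
  by move: (proj r v y) (proj r v z) (proj r v z') => p q q'; rewrite !mxE /=; ring.
by ring.
Qed.

Lemma NformC th r v y z : Nform th r v y z = Nform th r v z y.
Proof.
by rewrite /Nform QformC; congr (_ + _); apply: eq_bigr => k _; rewrite mulrC.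
Qed.

Lemma Nform_linl th r v z : linform (fun y => Nform th r v y z).
Proof. by move=> a y y' /=; rewrite ![Nform th r v _ z]NformC Nform_linr. Qed.

Lemma Nmx_mul th r v z k : (Nmx th r v *m z) k 0 = Nform th r v (delta_mx k 0) z.
Proof.
rewrite mxE (linform_delta z (Nform_linr th r v _)); apply: eq_bigr => j _.
by rewrite mxE mulrC.
Qed.

(** Together with [Nsol]: the vector x of the complement such that Q(y, x) = Q(y, v_(2r-1))
    for all y in the complement. *)
Definition Nrhs th r v : 'cV[R]_N :=
  \col_k Qform c th (proj r v (delta_mx k 0)) (v (r.*2).-1).

Definition Nsol th r v : 'cV[R]_N := invmx (Nmx th r v) *m Nrhs th r v.

Definition next_sharp th r v : 'cV[R]_N :=
  sharp (fun y => Qform c th (proj r v y) (v (r.*2).-1)).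

(** The next two vectors of the frame. On the complement of v_0, ..., v_(2r-1), the
    form Q(v_(2r-1), -) is represented by x for Q, and by s for omega. So v_2r must be
    proportional to x, and v_(2r+1), which spans the kernel of omega on the kernel of
    this form, is proportional to s. *)
Definition extend th r (v : nat -> 'cV[R]_N) : nat -> 'cV[R]_N := fun a =>
  if (a < r.*2)%N then v a
  else if a == r.*2 then (Qform c th (v (r.*2).-1) (Nsol th r v))^-1 *: Nsol th r v
  else - next_sharp th r v.

(** The properties of the first 2r vectors of the frame, together with those
    of their omega-orthogonal complement. *)
Definition stage th r (v : nat -> 'cV[R]_N) :=
  [/\ v 0%N = position c th /\ dq c th (v 0%N) != 0,
      forall a, (0 < a < r.*2)%N -> dq c th (v a) = 0,
      darboux r.*2 v,
      forall a b, (0 < a)%N -> (a < b < r.*2)%N ->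
        Qform c th (v a) (v b) = (odd a && (b == a.+1))%:R
    & forall y, (forall a, (a < r.*2)%N -> omega (v a) y = 0) ->
        dq c th y = 0 /\ forall a, (0 < a < (r.*2).-1)%N -> Qform c th (v a) y = 0].

Lemma Nsol_spec th r v : darboux r.*2 v -> Nmx th r v \in unitmx ->
  (forall a, (a < r.*2)%N -> omega (v a) (Nsol th r v) = 0) /\
  forall y, (forall a, (a < r.*2)%N -> omega (v a) y = 0) ->
    Qform c th y (Nsol th r v) = Qform c th y (v (r.*2).-1).
Proof.
move=> hv hu; set x := Nsol th r v.
have hN y : Nform th r v y x = Qform c th (proj r v y) (v (r.*2).-1).
  rewrite (linform_delta y (Nform_linl th r v x)).
  rewrite (linform_delta y (linform_proj _ _ (Qform_linl c th _))).
  apply: eq_bigr => k _; congr (_ * _); rewrite -Nmx_mul /x /Nsol mulKVmx // mxE //.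
have hx : x = proj r v x.
  have := hN (x - proj r v x); rewrite /Nform.
  have -> : proj r v (x - proj r v x) = 0.
    rewrite -[x - _]addrC -scaleN1r projD scaleN1r proj_idem // addNr //.
  rewrite subr0 !(linform0 (Qform_linl c th _)) add0r => e.
  apply/eqP; rewrite -subr_eq0; apply/eqP/matrixP => k l; rewrite ord1 [RHS]mxE.
  have /psumr_eq0P hk : \sum_k (x - proj r v x) k 0 * (x - proj r v x) k 0 = 0 by exact: e.
  by have /eqP := hk (fun k _ => sqr_ge0 _) k isT; rewrite mulf_eq0 orbb => /eqP.
split=> [a ha|y hy]; first by rewrite hx omega_proj.
have := hN y; rewrite /Nform (proj_id hy) subrr -hx => <-.
by rewrite big1 ?addr0 // => k _; rewrite !mxE; ring.
Qed.

(** The relation Q(s, v_(2r-1)) = omega(s, s) = 0 makes -s orthogonal to v_(2r-1)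
    and to v_2r, and omega(s, x) = Q(x, v_(2r-1)) is the factor which normalizes v_2r. *)
Lemma stage_step th r v : (0 < r)%N -> stage th r v -> Nmx th r v \in unitmx ->
  Qform c th (v (r.*2).-1) (Nsol th r v) != 0 -> stage th r.+1 (extend th r v).
Proof.
move=> r0 [h1 h2 h3 h4 h5] hu q0.
have [hxZ hxQ] := Nsol_spec h3 hu.
set x := Nsol th r v in hxZ hxQ q0 *.
set q := Qform c th (v (r.*2).-1) x in q0 *.
set s := next_sharp th r v; pose u := (v (r.*2).-1).
have r20 : (0 < r.*2)%N by rewrite double_gt0.
have r2p : (r.*2).-1.+1 = r.*2 by rewrite prednK.
have odp : odd (r.*2).-1 by have := odd_double r; rewrite -r2p /= => /negbFE.
have hs y : omega s y = Qform c th (proj r v y) u.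
  by rewrite /s /next_sharp omega_sharp //; exact: linform_proj (Qform_linl c th _).
have hsZ a : (a < r.*2)%N -> omega (v a) s = 0.
  by move=> ha; rewrite omegaC hs proj0 // (linform0 (Qform_linl c th _)) oppr0.
have sQ : Qform c th s u = 0 by rewrite -{1}(proj_id hsZ) -hs omegavv.
have e0 a : (a < r.*2)%N -> extend th r v a = v a by rewrite /extend => ->.
have e1 : extend th r v r.*2 = q^-1 *: x by rewrite /extend ltnn eqxx.
have e2 : extend th r v (r.*2).+1 = - s.
  by rewrite /extend ltnNge leqnSn /= eq_sym (introF eqP (@n_Sn _)).
have hxZ' a : (a < r.*2)%N -> omega (v a) (q^-1 *: x) = 0.
  by move=> ha; rewrite (linformZ _ _ (omega_linr (v a))) hxZ ?mulr0.
have hsZ' a : (a < r.*2)%N -> omega (v a) (- s) = 0.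
  by move=> ha; rewrite (linformN _ (omega_linr (v a))) hsZ ?oppr0.
have lt3 a : (a < r.+1.*2)%N -> [\/ (a < r.*2)%N, a = r.*2 | a = (r.*2).+1].
  rewrite doubleS ltnS leq_eqVlt ltnS leq_eqVlt => /orP[/eqP ->|/orP[/eqP ->|ha]].
  - exact: Or33.
  - exact: Or32.
  - exact: Or31.
split.
- by rewrite e0.
- move=> a /andP[a0 /lt3[ha|->|->]].
  + by rewrite e0 // h2 // a0.
  + by rewrite e1; case: (h5 _ hxZ').
  + by rewrite e2; case: (h5 _ hsZ').
- move=> a b /andP[ab /lt3[hb|eb|eb]].
  + by rewrite !e0 ?(ltn_trans ab) // h3 // ab.
  + rewrite eb in ab *; rewrite e1 e0 // hxZ' //.
    case: (boolP (odd a)) => oa //=; rewrite (_ : (r.*2 == a.+1) = false) //.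
    by apply/eqP => e; have := odd_double r; rewrite e /= oa.
  + rewrite eb ltnS leq_eqVlt in ab *; case/orP: ab => [/eqP ->|ab].
      rewrite e1 e2 odd_double eqxx (linformZ _ _ (omega_linl _)).
      rewrite (linformN _ (omega_linr _)) omegaC opprK hs proj_id // QformC -/q mulVf //.
    rewrite e2 e0 // hsZ' // (_ : (r.*2.+1 == a.+1) = false) ?andbF //.
    by rewrite eqSS gtn_eqF.
- move=> a b a0 /andP[ab /lt3[hb|eb|eb]].
  + by rewrite !e0 ?(ltn_trans ab) // h4 // ab.
  + rewrite eb in ab *; rewrite e1 e0 // (linformZ _ _ (Qform_linr c th _)).
    have [ea|na] := eqVneq a (r.*2).-1.
      by rewrite ea r2p eqxx odp -/q mulVf.
    have ha : (0 < a < (r.*2).-1)%N by rewrite a0 ltn_neqAle na -ltnS r2p ab.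
    have [_ /(_ a ha) ->] := h5 _ hxZ; rewrite mulr0 (_ : (r.*2 == a.+1) = false) ?andbF //.
    by apply/eqP => e; case/eqP: na; rewrite e.
  + rewrite eb ltnS leq_eqVlt in ab *; rewrite e2 (linformN _ (Qform_linr c th _)).
    case/orP: ab => [/eqP ->|ab].
      rewrite e1 (linformZ _ _ (Qform_linl c th _)) QformC hxQ // sQ mulr0 oppr0.
      by rewrite odd_double.
    rewrite e0 // (_ : (r.*2.+1 == a.+1) = false) ?andbF; last by rewrite eqSS gtn_eqF.
    have [->|na] := eqVneq a (r.*2).-1; first by rewrite QformC sQ oppr0.
    have ha : (0 < a < (r.*2).-1)%N by rewrite a0 ltn_neqAle na -ltnS r2p ab.
    by have [_ /(_ a ha) ->] := h5 _ hsZ; rewrite oppr0.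
- move=> y hy.
  have hyZ a : (a < r.*2)%N -> omega (v a) y = 0.
    by move=> ha; rewrite -e0 // hy // doubleS; exact: leq_trans ha (leqW (leqnSn _)).
  have [dy Qy] := h5 _ hyZ; split=> // a.
  have Qu : Qform c th y u = 0.
    rewrite -{1}(proj_id hyZ) -hs; have := hy (r.*2).+1.
    rewrite e2 (linformN _ (omega_linl y)) doubleS ltnSn => /(_ isT)/eqP.
    by rewrite oppr_eq0 => /eqP.
  rewrite doubleS /= ltnS => /andP[a0]; rewrite leq_eqVlt => /orP[/eqP ->|ha].
    by rewrite e1 (linformZ _ _ (Qform_linl c th _)) QformC hxQ // Qu mulr0.
  rewrite e0 //; have [->|na] := eqVneq a (r.*2).-1; first by rewrite QformC.
  by apply: Qy; rewrite a0 ltn_neqAle na -ltnS r2p ha.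
Qed.

Lemma dual_basisN (w : nat -> 'cV[R]_N) a b : darboux N w -> (a < N)%N -> (b < N)%N ->
  dual w a (w b) = (a == b)%:R.
Proof. by apply: dual_basis; rewrite odd_dim. Qed.

Lemma dual_proj_darboux r (w : nat -> 'cV[R]_N) y a : darboux N w -> (r.*2 <= N)%N -> (r.*2 <= a < N)%N ->
  dual w a (proj r w y) = dual w a y.
Proof.
move=> hw hr /andP[ra aN]; rewrite /proj (linformB _ _ (dual_lin w a)).
rewrite (linform_sum _ _ _ _ (dual_lin w a)) big1 ?subr0 // => b _.
rewrite dual_basisN //; last exact: leq_trans (ltn_ord b) hr.
rewrite (_ : (a == b :> nat) = false) ?mulr0 //.
by apply/eqP => e; have := ltn_ord b; rewrite -e ltnNge ra.
Qed.

Lemma darbouxW r s v : (r <= s)%N -> @darboux R n s v -> darboux r v.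
Proof. by move=> rs h a b /andP[ab br]; apply: h; rewrite ab (leq_trans br). Qed.

(** At a jet carrying an adapted frame w the construction reproduces w: there
    x = w_2r / Q(w_2r, w_2r), and the complement is nondegenerate because the tail of w
    and w_2r itself are. *)
Lemma extend_adapted t r (w : nat -> 'cV[R]_N) : (0 < r)%N -> (r < n)%N -> adapted c t w -> nondeg c t w ->
  Qdiag c t w r.*2 != 0 ->
  [/\ Nmx t r w \in unitmx, Qform c t (w (r.*2).-1) (Nsol t r w) != 0,
      extend t r w r.*2 = w r.*2 & extend t r w (r.*2).+1 = w (r.*2).+1].
Proof.
move=> r0 rn hA hnd I0; have [_ _ hw h4] := hA.
have r20 : (0 < r.*2)%N by rewrite double_gt0.
have r2p : (r.*2).-1.+1 = r.*2 by rewrite prednK.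
have odp : odd (r.*2).-1 by have := odd_double r; rewrite -r2p /= => /negbFE.
have r2N : (r.*2.+1 < N)%N by rewrite addnn -doubleS leq_double.
have r2N' : (r.*2 < N)%N by exact: ltnW.
have hv : darboux r.*2 w by apply: darbouxW hw; exact: ltnW.
have p1 : (0 < (r.*2).-1)%N by case: (r) r0 => // k _; rewrite doubleS.
have pN : ((r.*2).-1 < N)%N by exact: leq_ltn_trans (leq_pred _) r2N'.
have d0 y : dual w 0 (proj r w y) = 0 by exact: dual_proj.
have Qp y : Qform c t (proj r w y) (w (r.*2).-1) = dual w r.*2 y.
  rewrite (Q_row hA) ?p1 ?pN // odp r2p r2N' dual_proj ?mul0r ?add0r //.
    by rewrite dual_proj_darboux ?leqnn // ltnW.
  by rewrite ltn_predL.
have Qe y : Qform c t (proj r w y) (w r.*2) = dual w r.*2 y * Qdiag c t w r.*2.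
  rewrite (Q_row hA) ?r20 ?r2N' // odd_double [X in _ + X]dual_proj ?addr0 //.
    by rewrite dual_proj_darboux ?leqnn // ltnW.
  by rewrite ltn_predL.
have prw a : (r.*2 <= a < N)%N -> proj r w (w a) = w a.
  move=> /andP[ra aN]; apply: proj_id; apply/dual0_omega => b hb.
  rewrite dual_basisN //; last exact: ltn_trans hb r2N'.
  by rewrite (_ : (b == a) = false) //; apply/eqP => e; move: hb; rewrite e ltnNge ra.
have hu : Nmx t r w \in unitmx.
  rewrite unitmxE unitfE; apply/negP => /det0P[v v0 hvN].
  have hN y : Nform t r w v^T y = 0.
    rewrite (linform_delta y (Nform_linr t r w _)) big1 // => k _.
    rewrite NformC -Nmx_mul.
    have -> : Nmx t r w = (Nmx t r w)^T by apply/matrixP => i j; rewrite !mxE NformC.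
    by rewrite -trmx_mul hvN !mxE mulr0.
  have pv0 : proj r w v^T = 0.
    have hQ a : (r.*2 <= a < N)%N -> Qform c t (proj r w v^T) (w a) = 0.
      move=> ha; have := hN (w a); rewrite /Nform prw // subrr big1 ?addr0 // => k _.
      by rewrite [X in _ * X]mxE mulr0.
    apply: (adapted_tail (s := r.*2.+1) hA hnd) => //.
    - by rewrite /= odd_double.
    - by case: (r) r0.
    - move=> a; rewrite ltnS leq_eqVlt => /orP[/eqP ->|ha]; last exact: dual_proj.
      have := hQ r.*2; rewrite leqnn r2N' Qe => /(_ isT)/eqP.
      rewrite mulf_eq0 (negbTE I0) orbF => /eqP <-.
      by rewrite dual_proj_darboux ?leqnn // ltnW.
    - by move=> a /andP[ra aN]; apply: hQ; rewrite aN ltnW.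
  have := hN v^T; rewrite /Nform pv0 (linform0 (Qform_linl c t _)) add0r subr0.
  move=> /psumr_eq0P hk; case/eqP: v0; apply/rowP => k; rewrite mxE.
  by have /eqP := hk (fun k _ => sqr_ge0 _) k isT; rewrite mulf_eq0 orbb mxE => /eqP.
have hsol : Nsol t r w = (Qdiag c t w r.*2)^-1 *: w r.*2.
  apply: (can_inj (mulKmx hu)); rewrite /Nsol mulKVmx //.
  apply/matrixP => k l; rewrite ord1 Nmx_mul mxE (linformZ _ _ (Nform_linr t r w _)).
  rewrite /Nform prw ?leqnn // Qp Qe subrr big1 ?addr0 => [|j _].
    by rewrite mulrCA mulVf // mulr1.
  by rewrite [X in _ * X]mxE mulr0.
have hq : Qform c t (w (r.*2).-1) (Nsol t r w) = (Qdiag c t w r.*2)^-1.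
  rewrite hsol (linformZ _ _ (Qform_linr c t _)) h4 ?p1 ?r2p ?eqxx ?odp ?mulr1 //.
  by rewrite leqnn r2N'.
split=> //.
- by rewrite hq invr_neq0.
- by rewrite /extend ltnn eqxx hq invrK hsol scalerA mulfV // scale1r.
rewrite /extend ltnNge leqnSn /= eq_sym (introF eqP (@n_Sn _)).
have key y : omega (- next_sharp t r w) y = omega (w r.*2.+1) y.
  rewrite (linformN _ (omega_linl y)) /next_sharp omega_sharp.
    by rewrite Qp /dual odd_double omegaC opprK.
  exact: linform_proj (Qform_linl c t _).
apply: (darboux_eq hw) => a aN; rewrite /dual; case: ifP => _; last exact: key.
by rewrite omegaC key -omegaC.
Qed.

(** The defining choices of the canonical frame are not given by formulas, so its
    rationality in the 2-jet is obtained by constructing an adapted frame two vectors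
    at a time with linear algebra; uniqueness of adapted frames then identifies both. *)
Lemma regular_adapted t (w : nat -> 'cV[R]_N) : (0 < n)%N -> adapted c t w -> nondeg c t w ->
  (forall r, (0 < r < n)%N -> Qdiag c t w r.*2 != 0) ->
  exists V : nat -> jet R m -> 'cV[R]_N,
    [/\ forall a, (a < N)%N -> vregular 2 t (V a),
        forall a, (a < N)%N -> V a t = w a
      & znbhd 2 t (fun th => adapted c th (V ^~ th) /\ nondeg c th (V ^~ th))].
Proof.
move=> n0 hA hnd hI; have [[hw0 dw0] hdq hw h4] := hA.
have dp0 : dq c t (position c t) != 0 by rewrite -hw0.
have N0 : (1 < N)%N by rewrite addnn -[1%N]/(0.*2.+1) ltn_Sdouble.
have : forall r, (r < n)%N -> exists V : nat -> jet R m -> 'cV[R]_N,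
    [/\ forall a, (a < r.+1.*2)%N -> vregular 2 t (V a),
        forall a, (a < r.+1.*2)%N -> V a t = w a
      & znbhd 2 t (fun th => stage th r.+1 (V ^~ th))].
  elim=> [|r IH] hr.
    pose V (a : nat) th : 'cV[R]_N := if a == 0%N then position c th
      else (- (dq c th (position c th))^-1) *: sharp (dq c th).
    have V1 y th : dq c th (position c th) != 0 ->
        omega (V 1%N th) y = - (dq c th y / dq c th (position c th)).
      move=> dth; rewrite /V /= (linformZ _ _ (omega_linl y)) omega_sharp; last exact: dq_lin.
      by rewrite mulNr mulrC.
    exists V; split.
    - move=> [|a] _; rewrite /V /=; first exact: vregular_position.
      apply: vregular_scale.
        by apply: regular_opp; apply: regular_inv => //; exact/regular_dq/vregular_position.
      by apply: vregular_sharp => u; apply: regular_dq; exact: vregular_const.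
    - move=> [|[|a]] // _.
      have key y : omega (V 1%N t) y = omega (w 1%N) y.
        rewrite V1 // (linform_expand y hw (dq_lin c t)).
        rewrite (bigD1 (Ordinal (ltnW N0))) //= big1 ?addr0 => [|b hb].
          by rewrite -hw0 mulfK // /dual /= -omegaC.
        rewrite hdq ?mulr0 // ltn_ord andbT lt0n.
        by apply: contra hb => /eqP e; apply/eqP/val_inj.
      apply: (darboux_eq hw) => a aN; rewrite /dual; case: ifP => _; last exact: key.
      by rewrite omegaC key -omegaC.
    - have : regular 2 t (fun th => dq c th (position c th)).
        exact/regular_dq/vregular_position.
      move=> /regular_neq0/(_ dp0); apply: znbhdS => th dth; split.
      + by [].
      + move=> [|[|a]] //= _; rewrite /V /= (linformZ _ _ (dq_lin c th)).
        have := omega_sharp (sharp (dq c th)) (dq_lin c th); rewrite omegavv => <-.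
        by rewrite mulr0.
      + move=> [|[|a]] [|[|b]] //=; rewrite ?ltnS ?ltn0 ?andbF // => _.
        by rewrite omegaC V1 // opprK -[V 0%N th]/(position c th) mulfV.
      + by move=> [|[|a]] [|[|b]] //=; rewrite ?ltnS ?ltn0 ?andbF.
      + move=> y /(_ 1%N isT); rewrite V1 // => /eqP; rewrite oppr_eq0 mulf_eq0.
        by rewrite invr_eq0 (negbTE dth) orbF => /eqP ->; split=> // -[|[|a]].
  have [V [hV1 hV2 hV3]] := IH (ltnW hr).
  set s := r.+1 in hV1 hV2 hV3 hr *.
  have hI' : Qdiag c t w s.*2 != 0 by apply: hI; rewrite hr.
  have [e1 e2 e3 e4] := extend_adapted (isT : (0 < s)%N) hr hA hnd hI'.
  have sp : ((s.*2).-1 < s.*2)%N by rewrite ltn_predL double_gt0.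
  (* the construction depends on the first vectors only *)
  have eproj v v' y : (forall a, (a < s.*2)%N -> v a = v' a) -> proj s v y = proj s v' y.
    move=> h; rewrite /proj; congr (_ - _); apply: eq_bigr => a _; rewrite h //.
    congr (_ *: _); rewrite /dual; case: ifPn => oa.
      by rewrite h // (leq_ltn_trans (leq_pred _) (ltn_ord a)).
    rewrite h // ltn_neqAle ltn_ord andbT; apply/eqP => e.
    by have := odd_double s; rewrite -e /= oa.
  have eN : Nmx t s (V ^~ t) = Nmx t s w.
    apply/matrixP => i j; rewrite !mxE /Nform !(eproj (V ^~ t) w) //.
  have eR : Nrhs t s (V ^~ t) = Nrhs t s w.
    by apply/matrixP => i j; rewrite !mxE hV2 // (eproj (V ^~ t) w).
  have eS : Nsol t s (V ^~ t) = Nsol t s w by rewrite /Nsol eN eR.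
  have eH : next_sharp t s (V ^~ t) = next_sharp t s w.
    rewrite /next_sharp hV2 //; congr (sharp _); apply/funext => y.
    by rewrite (eproj (V ^~ t) w).
  have eE a : (a < s.+1.*2)%N -> extend t s (V ^~ t) a = w a.
    move=> ha; have [hlt|hge] := ltnP a s.*2; first by rewrite /extend hlt hV2.
    have [ea|ne] := eqVneq a s.*2.
      by rewrite ea -[RHS]e3 /extend ltnn eqxx eS hV2.
    have ea : a = s.*2.+1.
      by apply/eqP; rewrite eqn_leq -ltnS -doubleS ha ltn_neqAle eq_sym ne hge.
    by rewrite ea -[RHS]e4 /extend ltnNge leqnSn (negbTE (_ : s.*2.+1 != s.*2)) ?eH // gtn_eqF.
  have rproj y : vregular 2 t (fun th => proj s (V ^~ th) y) by exact: vregular_proj.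
  have rN i j : regular 2 t (fun th => Nmx th s (V ^~ th) i j).
    under eq_fun do rewrite mxE; apply: regular_add; first exact: regular_Qform.
    apply: regular_sum => k.
    have subE x y l : (x - y) l 0 = x l 0 - y l 0 :> R by rewrite !mxE.
    apply: (@regular_eq _ _ _ _ (fun th =>
       (delta_mx i 0 k 0 - proj s (V ^~ th) (delta_mx i 0) k 0) *
       (delta_mx j 0 k 0 - proj s (V ^~ th) (delta_mx j 0) k 0))) => [th|].
      by rewrite !subE.
    by apply: regular_mul; apply: regular_sub; first [exact: regular_const|exact: rproj].
  have rR : vregular 2 t (fun th => Nrhs th s (V ^~ th)).
    move=> k; under eq_fun do rewrite mxE; apply: regular_Qform => //; exact: hV1.
  have rS : vregular 2 t (fun th => Nsol th s (V ^~ th)).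
    apply: vregular_mulmx => // i j; apply: regular_invmx => //; by rewrite eN.
  have rq : regular 2 t (fun th => Qform c th (V (s.*2).-1 th) (Nsol th s (V ^~ th))).
    by apply: regular_Qform => //; exact: hV1.
  have q0 : Qform c t (V (s.*2).-1 t) (Nsol t s (V ^~ t)) != 0 by rewrite eS hV2.
  exists (fun a th => extend th s (V ^~ th) a); split=> //.
    move=> a ha; have [hlt|hge] := ltnP a s.*2.
      by apply: vregular_eq (hV1 a hlt) => th; rewrite /extend hlt.
    have [ea|ne] := eqVneq a s.*2.
      apply: vregular_eq (vregular_scale (regular_inv q0 rq) rS) => th.
      by rewrite /extend ltnNge hge ea eqxx.
    apply: (@vregular_eq _ _ _ _ _ (fun th => - next_sharp th s (V ^~ th))) => [th|k].
      by rewrite /extend ltnNge hge (negbTE ne).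
    have neE x l : (- x) l 0 = - x l 0 :> R by rewrite !mxE.
    apply: (@regular_eq _ _ _ _ (fun th => - next_sharp th s (V ^~ th) k 0)) => [th|].
      by rewrite neE.
    apply: regular_opp; move: k; apply: vregular_sharp => u.
    by apply: regular_Qform => //; exact: hV1.
  have rdet := regular_neq0 (regular_det rN).
  have := znbhdI hV3 (znbhdI (rdet _) (regular_neq0 rq q0)).
  rewrite eN; move: e1; rewrite unitmxE unitfE => -> /(_ isT); apply: znbhdS => th [st [dth qth]].
  by apply: stage_step => //; rewrite unitmxE unitfE.
move=> /(_ n.-1); rewrite prednK // leqnn => /(_ isT)[V].
rewrite -addnn => -[hV1 hV2 hV3]; exists V; split=> //.
have rI a : (a < N)%N -> regular 2 t (fun th => Qdiag c th (V ^~ th) a).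
  by move=> ha; apply: regular_Qform => //; exact: hV1.
have eI a : (a < N)%N -> Qdiag c t (V ^~ t) a = Qdiag c t w a by move=> ha; rewrite /Qdiag hV2.
have [nd1 nd2] := hnd.
have z1 : znbhd 2 t (fun th => forall a : 'I_N, odd a -> (2 < a)%N -> (a.+1 < N)%N ->
     Qdiag c th (V ^~ th) a * Qdiag c th (V ^~ th) a.+1 != 1).
  apply: znbhd_forall => a; case: (boolP [&& odd a, 2 < a & a.+1 < N]%N); last first.
    by move=> h; apply: znbhdT => th o1 o2 o3; move: h; rewrite o1 o2 o3.
  move=> /and3P[o1 o2 o3].
  have := @regular_neq0 _ _ 2 t
    (fun th => Qdiag c th (V ^~ th) a * Qdiag c th (V ^~ th) a.+1 - 1).
  move=> h; have := h _ _; move=> {}h; apply: znbhdS (h _ _).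
  - by move=> th + _ _ _; rewrite subr_eq0.
  - by apply: regular_sub; [apply: regular_mul; exact: rI|exact: regular_const].
  - by rewrite subr_eq0 !eI //; exact: nd1.
have z2 : znbhd 2 t (fun th => (2 < N.-1)%N -> Qdiag c th (V ^~ th) N.-1 != 0).
  case: (boolP (2 < N.-1)%N) => h; last exact: znbhdT.
  have hN : (N.-1 < N)%N by rewrite ltn_predL ltnW.
  by apply: znbhdS (regular_neq0 (rI _ hN) _) => //; rewrite eI //; exact: nd2.
apply: znbhdS (znbhdI hV3 (znbhdI z1 z2)) => th [[s1 s2 s3 s4 s5] [y1 y2]].
move: s2 s3 s4; rewrite -addnn => s2 s3 s4; split; first by split.
split=> // a oa a2 aN; exact: (y1 (Ordinal (ltnW aN))).
Qed.

End RegularFrame.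

(** * A jet with a prescribed frame *)

Section BasePoint.
Local Open Scope ring_scope.
Variables (R : realType) (n : nat) (c : 'I_(n + n)).
Local Notation m := (n + n).-1.
Local Notation N := (n + n)%N.

Lemma omega_lshift i (y : 'cV[R]_N) : omega (delta_mx (lshift n i) 0) y = y (rshift n i) 0.
Proof.
rewrite /omega (bigD1 i) //= big1 ?addr0 => [|j ji]; rewrite !mxE !eqxx /=.
  by rewrite eq_rlshift mul1r mul0r subr0.
by rewrite eq_lshift (negbTE ji) eq_rlshift /= !mul0r subr0.
Qed.

Lemma omega_rshift i (y : 'cV[R]_N) : omega (delta_mx (rshift n i) 0) y = - y (lshift n i) 0.
Proof.
rewrite /omega (bigD1 i) //= big1 ?addr0 => [|j ji]; rewrite !mxE !eqxx /=.
  by rewrite eq_lrshift mul1r mul0r sub0r.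
by rewrite eq_rshift (negbTE ji) eq_lrshift /= !mul0r subr0.
Qed.

(** The standard symplectic basis, its pairs being permuted and, if necessary,
    exchanged up to sign, so that it starts with e_c. *)
Lemma darboux_basis_exists : exists w : nat -> 'cV[R]_N,
  [/\ darboux N w, w 0%N = delta_mx c 0 & forall a, (0 < a < N)%N -> w a c 0 = 0].
Proof.
have [i0 [s hs]] : exists (i0 : 'I_n) (s : bool), c = if s then rshift n i0 else lshift n i0.
  by case: (split_ordP c) => i ->; [exists i, false|exists i, true].
pose idx (a : nat) : 'I_n := tperm (insubd i0 0%N) i0 (insubd i0 a./2).
have hhalf a : (a < N)%N -> (a./2 < n)%N by rewrite addnn => h; rewrite ltn_half_double.
have n0 : (0 < n)%N by exact: leq_ltn_trans (ltn_ord i0).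
have idx_eq a b : (a < N)%N -> (b < N)%N -> (idx a == idx b) = (a./2 == b./2).
  move=> ha hb; rewrite /idx (inj_eq perm_inj) -val_eqE !val_insubd.
  by rewrite !hhalf.
have idx0 : idx 0%N = i0 by rewrite /idx tpermL.
pose e (b : bool) i : 'cV[R]_N := delta_mx (if b then rshift n i else lshift n i) 0.
have hoe b b' i j : omega (e b i) (e b' j) = (-1) ^+ b * ((b != b') && (i == j))%:R.
  case: b b' => [] [] /=; rewrite ?omega_rshift ?omega_lshift mxE eqxx andbT.
  - by rewrite eq_lrshift oppr0 mulr0.
  - by rewrite eq_lshift expr1 mulN1r.
  - by rewrite eq_rshift expr0 mul1r.
  - by rewrite eq_rlshift mulr0.
pose w a := (if s && odd a then -1 else 1) *: e (odd a (+) s) (idx a).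
have half_eq a b : (a < b)%N -> (a./2 == b./2) = (~~ odd a && (b == a.+1)).
  move=> ab; apply/eqP/andP => [h|[oa /eqP ->]].
    have ea := odd_double_half a; have eb := odd_double_half b.
    rewrite -h in eb; move: ab; rewrite -{1}ea -{1}eb ltn_add2r => ob.
    case: (odd a) (odd b) ob ea eb => [] [] // _ ea eb.
    by split=> //; rewrite -ea -eb add0n add1n.
  by rewrite -[a.+1./2]/(uphalf a) uphalf_half (negbTE oa).
exists w; split.
- move=> a b /andP[ab bN]; have aN := ltn_trans ab bN.
  rewrite /w (linformZ _ _ (omega_linl _)) (linformZ _ _ (omega_linr _)) hoe idx_eq // half_eq //.
  have [oa|oa] := boolP (odd a); first by rewrite /= andbF /= !mulr0.
  have [->|ne] := eqVneq b a.+1; last by rewrite !andbF /= !mulr0.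
  rewrite /= oa /=; case: (s) => /=; ring.
- by rewrite /w /= andbF scale1r idx0 /e hs.
- move=> a /andP[a0 aN]; have N0 : (0 < N)%N := ltn_trans a0 aN; rewrite /w mxE /e mxE andbT.
  suff -> : (c == if odd a (+) s then rshift n (idx a) else lshift n (idx a)) = false.
    by rewrite mulr0.
  rewrite hs; case: (s) => /=; case: (boolP (odd a)) => oa /=;
    rewrite ?eq_lrshift ?eq_rlshift // ?eq_rshift ?eq_lshift -idx0 idx_eq //.
  + by rewrite (half_eq 0%N a a0) /=; apply/eqP => e1; move: oa; rewrite e1.
  + by rewrite (half_eq 0%N a a0) /=; apply/eqP => e1; move: oa; rewrite e1.
Qed.

(** The monomial l^s: up to the multinomial coefficient, the coefficient at s of a power
    of the linear form l. *)
Definition mono (l : 'I_m -> R) (s : 'X_{1..m}) : R := \prod_i l i ^+ s i.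

Lemma mono0 l : mono l 0%MM = 1.
Proof. by rewrite /mono big1 // => i _; rewrite mnm0E expr0. Qed.

Lemma monoS l s i : mono l (s + U_(i))%MM = mono l s * l i.
Proof.
rewrite /mono; under eq_bigr do rewrite mnmDE exprD.
rewrite big_split /=; congr (_ * _).
rewrite (bigD1 i) //= mnm1E eqxx expr1 big1 ?mulr1 // => j ji.
by rewrite mnm1E eq_sym (negbTE ji) expr0.
Qed.

Lemma mono1 l i : mono l U_(i)%MM = l i.
Proof. by have := monoS l 0 i; rewrite add0m mono0 mul1r. Qed.

Lemma mono2 l i j : mono l (U_(i) + U_(j))%MM = l i * l j.
Proof. by rewrite monoS mono1. Qed.

Variable w : nat -> 'cV[R]_N.
Hypothesis hw : darboux N w.
Hypothesis hw0 : w 0%N = delta_mx c 0.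
Hypothesis hwc : forall a, (0 < a < N)%N -> w a c 0 = 0.

(** The linear form dual to w_a on the coordinate hyperplane tangent to the graph. *)
Definition coform (a : nat) (i : 'I_m) : R := dual w a (delta_mx (lift c i) 0).

(** The quadratic form with matrix I_a on the diagonal and 1 at the places (1,2),
    (3,4), ..., the cross terms being obtained by polarization. *)
Definition quad (I : nat -> R) (s : 'X_{1..m}) : R :=
  \sum_(1 <= a < N) I a * mono (coform a) s
  + \sum_(1 <= a < N | odd a && (a.+1 < N)%N)
      (mono (fun i => coform a i + coform a.+1 i) s - mono (coform a) s - mono (coform a.+1) s).

(** A graph with base point e_c and horizontal tangent space, whose second order part
    makes w adapted with Q(w_a, w_a) = I_a, and whose third order part is proportional
    to lam times the sum of the cubes of the coordinates with respect to w. *)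
Definition basejet (I : nat -> R) (lam : R) : jet R m := fun z =>
  match z with
  | inl _ => 0
  | inr s => if mdeg s == 0%N then 1 else if mdeg s == 1%N then 0
             else if mdeg s == 2%N then - quad I s
             else lam * \sum_(1 <= p < N) mono (coform p) s
  end.

Lemma coform_dual a (y : 'cV[R]_N) : (0 < a < N)%N ->
  \sum_i y (lift c i) 0 * coform a i = dual w a y.
Proof.
move=> /andP[a0 aN]; rewrite (linform_delta y (dual_lin w a)) (sum_chart c).
have N0 : (0 < N)%N by exact: ltn_trans aN.
rewrite -hw0 (dual_basisN hw) // (_ : (a == 0)%N = false) ?mulr0 ?add0r //.
by apply/negbTE; rewrite -lt0n.
Qed.

Lemma basejet_position I lam : position c (basejet I lam) = w 0%N.
Proof.
rewrite hw0; apply/matrixP => k l; rewrite ord1; case: (unliftP c k) => [i ->|->].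
  by rewrite /position chart_point_lift mxE eq_sym (negbTE (neq_lift _ _)).
by rewrite /position chart_point_c mxE !eqxx /= mdeg0.
Qed.

Lemma basejet_dq I lam y : dq c (basejet I lam) y = y c 0.
Proof.
by rewrite /dq big1 ?subr0 // => i _; rewrite /= mdeg1 mul0r.
Qed.

Lemma sum_mono2 (l : 'I_m -> R) (y z : 'cV[R]_N) :
  \sum_i \sum_j mono l (U_(i) + U_(j))%MM * y (lift c i) 0 * z (lift c j) 0 =
  (\sum_i y (lift c i) 0 * l i) * (\sum_i z (lift c i) 0 * l i).
Proof.
rewrite mulr_suml; apply: eq_bigr => i _; rewrite mulr_sumr; apply: eq_bigr => j _.
by rewrite mono2; ring.
Qed.

Definition Qmat (I : nat -> R) (y z : 'cV[R]_N) : R :=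
  \sum_(1 <= a < N) I a * (dual w a y * dual w a z)
  + \sum_(1 <= a < N | odd a && (a.+1 < N)%N)
      (dual w a y * dual w a.+1 z + dual w a.+1 y * dual w a z).

Lemma basejet_d2q I lam y z : d2q c (basejet I lam) y z = Qmat I y z.
Proof.
rewrite /d2q.
have e i j : basejet I lam (inr (U_(i) + U_(j))%MM) = - quad I (U_(i) + U_(j))%MM.
  by rewrite /= mdegD !mdeg1.
under eq_bigr do under eq_bigr do rewrite e !mulNr.
under eq_bigr do rewrite sumrN; rewrite sumrN opprK.
pose S l := \sum_i \sum_j mono l (U_(i) + U_(j))%MM * y (lift c i) 0 * z (lift c j) 0.
transitivity (\sum_(1 <= a < N) I a * S (coform a)
  + \sum_(1 <= a < N | odd a && (a.+1 < N)%N)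
      (S (fun i => coform a i + coform a.+1 i) - S (coform a) - S (coform a.+1))).
  rewrite /quad /S.
  under eq_bigr do under eq_bigr do rewrite !mulrDl.
  under eq_bigr do rewrite big_split; rewrite big_split /=; congr (_ + _).
    under eq_bigr do under eq_bigr do rewrite !mulr_suml.
    under eq_bigr do rewrite exchange_big.
    rewrite exchange_big /=; apply: eq_bigr => a _; rewrite mulr_sumr; apply: eq_bigr => i _.
    by rewrite mulr_sumr; apply: eq_bigr => j _; ring.
  under eq_bigr do under eq_bigr do rewrite !mulr_suml.
  under eq_bigr do rewrite exchange_big.
  rewrite exchange_big /=; apply: eq_bigr => a _; rewrite -!sumrB; apply: eq_bigr => i _.
  by rewrite -!sumrB; apply: eq_bigr => j _; ring.
rewrite /S; congr (_ + _); rewrite big_nat_cond [RHS]big_nat_cond.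
  apply: eq_bigr => a; rewrite andbT => ha; rewrite sum_mono2 !coform_dual //.
apply: eq_bigr => a /andP[/andP[a0 aN] /andP[oa a1N]].
have ha : (0 < a < N)%N by rewrite a0 aN.
have ha1 : (0 < a.+1 < N)%N by rewrite a1N.
have e2 (x : 'cV[R]_N) : \sum_i x (lift c i) 0 * (coform a i + coform a.+1 i) =
   dual w a x + dual w a.+1 x.
  rewrite -!coform_dual // -big_split; apply: eq_bigr => i _; by rewrite mulrDr.
by rewrite !sum_mono2 !e2 !coform_dual //; ring.
Qed.

Lemma basejet_dq0 I lam : dq c (basejet I lam) (position c (basejet I lam)) = 1.
Proof. by rewrite basejet_position basejet_dq hw0 mxE !eqxx. Qed.

Lemma basejet_Qform I lam y z : Qform c (basejet I lam) y z = Qmat I y z.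
Proof. by rewrite /Qform basejet_dq0 divr1 basejet_d2q. Qed.

Lemma Qmat_basis I a b : (0 < a)%N -> (a <= b < N)%N ->
  Qmat I (w a) (w b) = (a == b)%:R * I a + (odd a && (b == a.+1))%:R.
Proof.
move=> a0 /andP[ab bN]; have aN := leq_ltn_trans ab bN.
have N0 : (0 < N)%N by exact: ltn_trans aN.
rewrite /Qmat; congr (_ + _).
  rewrite (bigD1_seq a) /= ?iota_uniq ?mem_index_iota ?a0 ?aN //.
  rewrite big_seq_cond big1 ?addr0; last first.
    move=> d; rewrite mem_index_iota => /andP[/andP[d0 dN] da].
    by rewrite (dual_basisN hw dN aN) (negbTE da) mul0r mulr0.
  by rewrite (dual_basisN hw aN aN) (dual_basisN hw aN bN) eqxx mul1r mulrC.
rewrite big_nat_cond.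
have key d : (0 < d < N)%N && (odd d && (d.+1 < N)%N) ->
   dual w d (w a) * dual w d.+1 (w b) + dual w d.+1 (w a) * dual w d (w b) =
   (d == a)%:R * (odd a && (b == a.+1))%:R.
  move=> /andP[/andP[d0 dN] /andP[od d1N]].
  rewrite !(dual_basisN hw) //.
  have [e|ne] := eqVneq d a; last first.
    rewrite !mul0r add0r; have [e|] := eqVneq d b; last by rewrite mulr0.
    have [e'|] := eqVneq d.+1 a; last by rewrite mul0r.
    by move: ab; rewrite -e -e' ltnn.
  rewrite -e od /= eq_sym [d.+1 == d]gtn_eqF // mul0r addr0.
  by rewrite !mul1r.
rewrite (eq_bigr _ key).
have [/andP[oa /eqP eb]|h] := boolP (odd a && (b == a.+1)); last first.
  by rewrite big1 // => d _; rewrite mulr0.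
rewrite -big_nat_cond big_mkcond (bigD1_seq a) /= ?iota_uniq ?mem_index_iota ?a0 ?aN //.
rewrite oa -eb bN /= eqxx mul1r big1 ?addr0 // => d da.
by case: ifP => // _; rewrite (negbTE da) mul0r.
Qed.

Lemma basejet_Qdiag I lam a : (0 < a < N)%N -> Qdiag c (basejet I lam) w a = I a.
Proof.
move=> /andP[a0 aN]; rewrite /Qdiag basejet_Qform Qmat_basis ?leqnn // eqxx mul1r.
by rewrite [a == a.+1]ltn_eqF // andbF addr0.
Qed.

Lemma basejet_adapted I lam : (0 < n)%N -> adapted c (basejet I lam) w.
Proof.
move=> n0; have N0 : (0 < N)%N by rewrite addn_gt0 n0.
split.
- rewrite basejet_position; split=> //.
  by rewrite basejet_dq hw0 mxE !eqxx oner_neq0.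
- by move=> a ha; rewrite basejet_dq hwc.
- exact: hw.
- move=> a b a0 /andP[ab bN]; rewrite basejet_Qform Qmat_basis ?(ltnW ab) //.
  by rewrite (ltn_eqF ab) mul0r add0r.
Qed.

(** The derivative of a sum of cubes along w_k is a multiple of the square of the k-th
    coordinate, so the total derivative along w_k moves the second order part of the
    base jet in this direction only, with speed lam. *)
Lemma basejet_total I lam k s : (0 < k < N)%N -> mdeg s = 2%N ->
  \sum_i w k (lift c i) 0 * total_dir (basejet I lam) i (inr s) = lam * mono (coform k) s.
Proof.
move=> hk hs; have [k0 kN] := andP hk.
under eq_bigr => i _ do rewrite /= mdegD mdeg1 hs /= mulrCA.
rewrite -mulr_sumr; congr (_ * _).
under eq_bigr => i _ do rewrite mulr_sumr.
rewrite exchange_big /=.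
transitivity (\sum_(1 <= p < N) mono (coform p) s * dual w p (w k)).
  rewrite !big_nat; apply: eq_bigr => p hp.
  rewrite -coform_dual // mulr_sumr; apply: eq_bigr => i _; rewrite monoS; ring.
rewrite (bigD1_seq k) /= ?iota_uniq ?mem_index_iota //.
rewrite (dual_basisN hw kN kN) eqxx mulr1 big_seq_cond big1 ?addr0 // => p.
rewrite mem_index_iota => /andP[/andP[p0 pN] pk].
by rewrite (dual_basisN hw pN kN) (negbTE pk) mulr0.
Qed.

End BasePoint.

(** * The canonical frame at generic jets *)

Section GoodJets.
Local Open Scope ring_scope.
Variables (R : realType) (n : nat) (c : 'I_(n + n)).
Local Notation m := (n + n).-1.
Local Notation N := (n + n)%N.
Hypothesis n0 : (0 < n)%N.
Implicit Types (th t : jet R m) (g : 'M[R]_N).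

(** At these jets the canonical frame exists and is unique. *)
Definition good th := adapted c th (fun a => frame c a th) /\ nondeg c th (fun a => frame c a th).

Lemma adapted_eq th (v v' : nat -> 'cV[R]_N) : (forall a, (a < N)%N -> v a = v' a) ->
  adapted c th v -> adapted c th v'.
Proof.
move=> e [h1 h2 h3 h4]; have N0 : (0 < N)%N by rewrite addn_gt0 n0.
split; first by rewrite -e.
- by move=> a /andP[a0 aN]; rewrite -e // h2 // a0.
- by move=> a b /andP[ab bN]; rewrite -!e ?(ltn_trans ab) // h3 // ab.
- by move=> a b a0 /andP[ab bN]; rewrite -!e ?(ltn_trans ab) // h4 // ab.
Qed.

Lemma nondeg_eq th (v v' : nat -> 'cV[R]_N) : (forall a, (a < N)%N -> v a = v' a) ->
  nondeg c th v -> nondeg c th v'.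
Proof.
move=> e [h1 h2]; split=> [a oa a2 aN|hN].
  by rewrite /Qdiag -!e ?(ltnW aN) //; exact: h1.
by rewrite /Qdiag -!e ?ltn_predL ?addn_gt0 ?n0 //; exact: h2.
Qed.

Lemma adapted_good th v : adapted c th v -> nondeg c th v ->
  good th /\ forall a, (a < N)%N -> frame c a th = v a.
Proof.
move=> hA hn; have e a : (a < N)%N -> frame c a th = v a by exact: adapted_frame.
split=> //; split; [apply: adapted_eq hA|apply: nondeg_eq hn] => a ha; by rewrite e.
Qed.

Lemma good_prolong k g th th' : (1 < k)%N -> symplectic g -> prolong c k g th th' ->
  good th -> good th' /\ forall a, (a < N)%N -> frame c a th' = g *m frame c a th.
Proof.
move=> k1 sg hp [hA hn]; have [hA' hn'] := adapted_prolong n0 k1 hp sg hA hn.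
exact: adapted_good hA' hn'.
Qed.

Lemma frame_tangent th a : good th -> (0 < a < N)%N -> dq c th (frame c a th) = 0.
Proof. by move=> [[_ h _ _] _] ha; exact: h. Qed.

(** Tangent vectors transform by the Jacobian matrix of the induced map. *)
Lemma gmul_lift g th z i : dq c th z = 0 ->
  (g *m z) (lift c i) 0 = \sum_j gJ c g th i j * z (lift c j) 0.
Proof.
move=> hz; rewrite {1}(tvec_expand c th z) hz scale0r add0r mulmx_sumr summxE.
by apply: eq_bigr => j _; rewrite -scalemxAr mxE gtvec_lift mulrC.
Qed.

Lemma ltn_ordS (i : 'I_m) : (i.+1 < N)%N.
Proof. by have := ltn_ord i; rewrite -ltnS prednK // addn_gt0 n0. Qed.

Lemma I2_good k g th th' i : (1 < k)%N -> symplectic g -> prolong c k g th th' ->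
  good th -> I2 c i th' = I2 c i th.
Proof.
move=> k1 sg hp hth; have [_ e] := good_prolong k1 sg hp hth.
rewrite /I2 e ?ltn_ordS //.
by rewrite (prolong_Qform k1 hp (symplectic_unit sg)) ?frame_tangent ?ltn_ordS.
Qed.

(** Jets around which the frame is rational in the 2-jet. *)
Definition frame_regular t :=
  [/\ forall a, (a < N)%N -> vregular 2 t (fun th => frame c a th)
    & znbhd 2 t good].

Lemma frame_regular_adapted t w : adapted c t w -> nondeg c t w ->
  (forall r, (0 < r < n)%N -> Qdiag c t w r.*2 != 0) -> frame_regular t.
Proof.
move=> hA hn hI; have [V [h1 h2 h3]] := regular_adapted n0 hA hn hI.
split; last by apply: znbhdS h3 => th [hA' hn']; case: (adapted_good hA' hn').
move=> a ha k; apply: regular_ext (h1 a ha k); apply: znbhdS h3 => th [hA' hn'].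
by case: (adapted_good hA' hn') => _ ->.
Qed.

Lemma good_dq t : good t -> dq c t (position c t) != 0.
Proof. by move=> [[[<- ->]]]. Qed.

Lemma regular_I2 t i : frame_regular t -> regular 2 t (I2 c i).
Proof.
move=> [h1 h2]; apply: regular_Qform; try exact/h1/ltn_ordS.
exact: good_dq (znbhd_center h2).
Qed.

Lemma regular_frame_coef t i j : frame_regular t -> regular 2 t (fun th => frame_coef c j th i).
Proof. by move=> [h1 _]; apply: h1; exact: ltn_ordS. Qed.

Lemma regular_nabla k t j f : (0 < k)%N -> frame_regular t -> regular k t f ->
  regular k.+1 t (nabla c j f).
Proof.
move=> k0 ht hf; apply: regular_horizontal => // i.
by apply: regular_le (regular_frame_coef i j ht).
Qed.

Lemma diff_invariant_I2 t l i : (2 <= l)%N -> frame_regular t -> diff_invariant c l (@I2 R n c i).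
Proof.
move=> hl ht; have [P [D [h1 h2 h3 h4]]] := regular_I2 i ht.
have [_ [E [g1 g2 g3]]] := ht.
exists l, (fun th => P th * E th), (fun th => D th * E th); split=> //.
  split.
  - by apply: polynomial_on_le hl _; exact: polynomial_on_mul.
  - by apply: polynomial_on_le hl _; exact: polynomial_on_mul.
  - by exists t; exact: mulf_neq0.
  - move=> th; rewrite mulf_eq0 negb_or => /andP[d e]; rewrite h4 //.
    by field; rewrite d e.
move=> g th th' sg hp; rewrite mulf_eq0 negb_or => /andP[_ /g3 hth] _.
exact: I2_good sg hp hth.
Qed.

Lemma generic_good t : frame_regular t -> generic good.
Proof. by case=> _; exact: znbhd_generic. Qed.

Lemma frame_coef_invariant t j : frame_regular t -> invariant_derivation c (@frame_coef R n c j).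
Proof.
move=> ht; split.
  by exists 2%N => i; apply/rational_onP; exists t; exact: regular_frame_coef.
move=> g k f f' sg /rational_onP rf /rational_onP rf' hff'.
apply: horizontal_invariant hff'.
- exact: symplectic_unit.
- by exists k.
- by exists k.
apply: genericS (generic_good ht) => th hth th' hp i.
have [_ e] := good_prolong (isT : (1 < 2)%N) sg (hp 2%N) hth.
by rewrite /frame_coef e ?ltn_ordS // (gmul_lift _ _ (frame_tangent hth _)) ?ltn_ordS.
Qed.

End GoodJets.

Section FrameJets.
Local Open Scope ring_scope.
Variables (R : realType) (n : nat) (c : 'I_(n + n)).
Local Notation m := (n + n).-1.

Lemma frame_flag_jeqk th th' r : jeqk 2 th th' ->
  frame_flag c th r = frame_flag c th' r :> ('cV[R]_(n + n) * set 'cV[R]_(n + n)).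
Proof.
move=> h.
have hp : position c th = position c th'.
  rewrite /position h /= ?mdeg0 //; congr (chart_point _ _ _).
  by apply/funext => i; rewrite /jbase h.
have hdq : dq c th = dq c th'.
  apply/funext => y; rewrite /dq; congr (_ - _); apply: eq_bigr => i _.
  by rewrite h //= mdeg1.
have hd2q : d2q c th = d2q c th'.
  apply/funext => y; apply/funext => z; rewrite /d2q; congr (- _).
  apply: eq_bigr => i _; apply: eq_bigr => j _.
  by rewrite h //= mdegD !mdeg1.
have hQ : Qform c th = Qform c th' by rewrite /Qform hp hdq hd2q.
have hT : tangent c th = tangent c th' by rewrite /tangent hdq.
elim: r => [|r IH] /=; first by rewrite hp hT.
by rewrite IH hQ.
Qed.

Lemma I2_jeqk th th' i : jeqk 2 th th' -> I2 c i th = I2 c i th' :> R.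
Proof.
move=> h; rewrite /I2 /frame (frame_flag_jeqk _ h) /Qform.
have hp : position c th = position c th'.
  by have := congr1 fst (frame_flag_jeqk 0 h).
have hdq : dq c th = dq c th'.
  apply/funext => y; rewrite /dq; congr (_ - _); apply: eq_bigr => a _.
  by rewrite h //= mdeg1.
rewrite hp hdq; congr (_ / _); rewrite /d2q; congr (- _).
apply: eq_bigr => a _; apply: eq_bigr => b _.
by rewrite h //= mdegD !mdeg1.
Qed.

End FrameJets.

(** * Fields of rational functions *)

Section FieldClasses.
Local Open Scope ring_scope.
Variables (R : realType) (m : nat).
Implicit Types (f g : jet R m -> R) (th : jet R m).

(** Fields of functions, up to equality at generic jets. *)
Definition fclass (X : (jet R m -> R) -> Prop) :=
  [/\ forall a, X (fun=> a),
      forall f g, X f -> X g -> X (fun th => f th + g th),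
      forall f g, X f -> X g -> X (fun th => f th * g th),
      forall f, X f -> X (fun th => (f th)^-1)
    & forall f g, generic (fun th => f th = g th) -> X f -> X g].

Lemma ratfun_fclass : fclass (@ratfun R m).
Proof.
split; [exact: ratfun_const|exact: ratfun_add|exact: ratfun_mul|exact: ratfun_inv|].
by move=> f g; exact: ratfun_ext.
Qed.

Section Closure.
Variable X : (jet R m -> R) -> Prop.
Hypothesis hX : fclass X.

Lemma fclass_const a : X (fun=> a).
Proof. by case: hX. Qed.

Lemma fclass_add f g : X f -> X g -> X (fun th => f th + g th).
Proof. by case: hX => _ h _ _ _; exact: h. Qed.

Lemma fclass_mul f g : X f -> X g -> X (fun th => f th * g th).
Proof. by case: hX => _ _ h _ _; exact: h. Qed.

Lemma fclass_inv f : X f -> X (fun th => (f th)^-1).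
Proof. by case: hX => _ _ _ h _; exact: h. Qed.

Lemma fclass_ext f g : generic (fun th => f th = g th) -> X f -> X g.
Proof. by case: hX => _ _ _ _ h; exact: h. Qed.

Lemma fclass_eq f g : (forall th, f th = g th) -> X f -> X g.
Proof. by move=> /funext ->. Qed.

Lemma fclass_opp f : X f -> X (fun th => - f th).
Proof.
move=> hf; apply: (@fclass_eq (fun th => -1 * f th)); first by move=> th; rewrite mulN1r.
by apply: fclass_mul => //; exact: fclass_const.
Qed.

Lemma fclass_sub f g : X f -> X g -> X (fun th => f th - g th).
Proof. by move=> hf hg; apply: fclass_add => //; exact: fclass_opp. Qed.

Lemma fclass_sum (T : Type) (s : seq T) (p : pred T) (F : T -> jet R m -> R) :
  (forall i, X (F i)) -> X (fun th => \sum_(i <- s | p i) F i th).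
Proof.
move=> h; elim: s => [|i s hs].
  by under eq_fun do rewrite big_nil; exact: fclass_const.
under eq_fun do rewrite big_cons; case: (p i) => //.
exact: fclass_add.
Qed.

Lemma fclass_prod (T : Type) (s : seq T) (p : pred T) (F : T -> jet R m -> R) :
  (forall i, X (F i)) -> X (fun th => \prod_(i <- s | p i) F i th).
Proof.
move=> h; elim: s => [|i s hs].
  by under eq_fun do rewrite big_nil; exact: fclass_const.
under eq_fun do rewrite big_cons; case: (p i) => //.
exact: fclass_mul.
Qed.

Lemma fclass_det d (A : jet R m -> 'M[R]_d) :
  (forall i j, X (fun th => A th i j)) -> X (fun th => \det (A th)).
Proof.
move=> h; apply: fclass_sum => s; apply: fclass_mul; first exact: fclass_const.
by apply: fclass_prod => i; apply: h.
Qed.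

Lemma fclass_adj d (A : jet R m -> 'M[R]_d) i j :
  (forall i j, X (fun th => A th i j)) -> X (fun th => (\adj (A th)) i j).
Proof.
move=> h; under eq_fun do rewrite mxE /cofactor; apply: fclass_mul.
  exact: fclass_const.
by apply: fclass_det => a b; under eq_fun do rewrite !mxE; apply: h.
Qed.

Lemma fclass_meval n (A : {mpoly R[n]}) (F : 'I_n -> jet R m -> R) :
  (forall i, X (F i)) -> X (fun th => A.@[fun i => F i th]).
Proof.
move=> hF; elim/mpoly_alg_ind: A => [a|i|p q hp hq|p q hp hq].
- by under eq_fun do rewrite mevalC; exact: fclass_const.
- by under eq_fun do rewrite mevalXU; exact: hF.
- by under eq_fun do rewrite mevalD; exact: fclass_add.
- by under eq_fun do rewrite mevalM; exact: fclass_mul.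
Qed.

(** For the system A x = b, the matrix A^T A is invertible at t since A has a trivial
    kernel there; its determinant is then nonzero generically, and Cramer's rule for the
    normal equations A^T A x = A^T b expresses x in the field X. Uniqueness has to be
    checked at the single jet t only. *)
Lemma fclass_solve (U E : finType) k t (L : E -> jet R m -> (U -> R) -> R)
    (b : E -> jet R m -> R) (x : U -> jet R m -> R) :
  (forall e th y, L e th y = \sum_u y u * L e th (fun v => (v == u)%:R)) ->
  (forall e u, X (fun th => L e th (fun v => (v == u)%:R))) ->
  (forall e u, regular k t (fun th => L e th (fun v => (v == u)%:R))) ->
  (forall e, X (b e)) ->
  (forall e, generic (fun th => L e th (fun u => x u th) = b e th)) ->
  (forall y, (forall e, L e t y = 0) -> forall u, y u = 0) ->
  forall u, X (x u).
Proof.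
move=> hL hA rA hb hx ht u.
pose A th : 'M[R]_(#|E|, #|U|) :=
  \matrix_(e, v) L (enum_val e) th (fun w => (w == enum_val v)%:R).
pose M th := (A th)^T *m A th.
have hM i j : X (fun th => M th i j).
  under eq_fun do rewrite mxE; apply: fclass_sum => e.
  by under eq_fun do rewrite !mxE; apply: fclass_mul; exact: hA.
have rM i j : regular k t (fun th => M th i j).
  under eq_fun do rewrite mxE; apply: regular_sum => e.
  by under eq_fun do rewrite !mxE; apply: regular_mul; exact: rA.
have hLA th (y : U -> R) e : L e th y = (A th *m \col_v y (enum_val v)) (enum_rank e) 0.
  rewrite mxE hL (reindex_onto (@enum_val U U) (@enum_rank U)) /=; last first.
    by move=> v _; exact: enum_rankK.
  apply: eq_big => [v|v _]; first by rewrite enum_valK eqxx.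
  by rewrite !mxE enum_rankK mulrC.
have d0 : \det (M t) != 0.
  apply/negP => /det0P[v v0 hv].
  have hAv : v *m (A t)^T = 0.
    have hq : (v *m (A t)^T) *m (v *m (A t)^T)^T = 0.
      by rewrite trmx_mul trmxK !mulmxA -(mulmxA v) -[(A t)^T *m A t]/(M t) hv mul0mx.
    apply/rowP => e; rewrite [RHS]mxE.
    have := congr1 (fun K : 'M_1 => K 0 0) hq; rewrite [LHS]mxE [RHS]mxE => /psumr_eq0P h.
    have h' i : (v *m (A t)^T) 0 i * (v *m (A t)^T)^T i 0 = 0.
      by apply: h => // j _; rewrite [X in _ * X]mxE -expr2 sqr_ge0.
    by have /eqP := h' e; rewrite [X in _ * X]mxE mulf_eq0 orbb => /eqP.
  pose y (w : U) := v 0 (enum_rank w).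
  have hy e : L e t y = 0.
    rewrite hLA; have -> : \col_w y (enum_val w) = v^T.
      by apply/matrixP => i j; rewrite !mxE /y enum_valK ord1.
    by rewrite -[A t]trmxK -trmx_mul hAv !mxE.
  case/eqP: v0; apply/rowP => i; rewrite mxE.
  by have := ht y hy (enum_val i); rewrite /y enum_valK.
have hd : generic (fun th => \det (M th) != 0).
  exact: ratfun_neq0 (regular_det rM) d0.
have hall : generic (fun th => forall e, L e th (fun v => x v th) = b e th).
  exact: generic_forall.
pose y th := \sum_w (\adj (M th)) (enum_rank u) w * \sum_e A th e w * b (enum_val e) th.
apply: (@fclass_ext (fun th => (\det (M th))^-1 * y th)); last first.
  apply: fclass_mul; first by apply: fclass_inv; exact: fclass_det.
  apply: fclass_sum => w; apply: fclass_mul; first exact: fclass_adj.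
  apply: fclass_sum => e; apply: fclass_mul => //.
  by under eq_fun do rewrite mxE; exact: hA.
apply: genericS (genericI hd hall) => th [dth eqth].
pose xv : 'cV[R]_(#|U|) := \col_v x (enum_val v) th.
have -> : y th = (\adj (M th) *m ((A th)^T *m (A th *m xv))) (enum_rank u) 0.
  rewrite mxE; apply: eq_bigr => w _; congr (_ * _); rewrite mxE; apply: eq_bigr => e _.
  rewrite [X in _ = X * _]mxE; congr (_ * _).
  by rewrite -eqth hLA enum_valK.
rewrite !mulmxA -(mulmxA (\adj _)) mul_adj_mx mul_scalar_mx mxE mulrA mulVf // mul1r.
by rewrite mxE enum_rankK.
Qed.

End Closure.

Section RationalExpressions.
Variable S : set (jet R m -> R).
Hypothesis hS : forall f, S f -> ratfun f.

(** [rational_expression S] is the smallest field containing S. *)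
Lemma rexp_ind X : fclass X -> (forall f, S f -> X f) ->
  forall f, rational_expression S f -> X f.
Proof.
move=> hX hSX f [k [F [A [B [hF hf]]]]].
apply: (@fclass_ext X hX
  (fun th => A.@[fun s => F s th] * (B.@[fun s => F s th])^-1)).
  by apply: genericS hf => th [_ ->].
apply: fclass_mul => //; first by apply: fclass_meval => // i; exact/hSX/hF.
by apply: fclass_inv => //; apply: fclass_meval => // i; exact/hSX/hF.
Qed.

Lemma rexp_ratfun f : rational_expression S f -> ratfun f.
Proof. exact: (rexp_ind ratfun_fclass hS). Qed.

Lemma rexp_base f : S f -> rational_expression S f.
Proof.
move=> hf; exists 1%N, (fun=> f), 'X_ord0, 1; split=> //.
by apply: genericT => th; rewrite meval1 mevalXU divr1 oner_neq0.
Qed.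

Lemma rexp_op f g (opA opB : forall k, {mpoly R[k]} -> {mpoly R[k]} -> {mpoly R[k]} ->
    {mpoly R[k]} -> {mpoly R[k]}) (op : R -> R -> R) (qA qB : R -> R -> R -> R -> R) :
  (forall k (A B A' B' : {mpoly R[k]}) v,
     (opA k A B A' B').@[v] = qA A.@[v] B.@[v] A'.@[v] B'.@[v]) ->
  (forall k (A B A' B' : {mpoly R[k]}) v,
     (opB k A B A' B').@[v] = qB A.@[v] B.@[v] A'.@[v] B'.@[v]) ->
  (forall a b a' b', b != 0 -> b' != 0 ->
     qB a b a' b' != 0 /\ op (a / b) (a' / b') = qA a b a' b' / qB a b a' b') ->
  rational_expression S f -> rational_expression S g ->
  rational_expression S (fun th => op (f th) (g th)).
Proof.
move=> hA hB hop [k1 [F1 [A1 [B1 [hF1 hf]]]]] [k2 [F2 [A2 [B2 [hF2 hg]]]]].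
pose l (p : {mpoly R[k1]}) := p \mPo [tuple 'X_(lshift k2 i) | i < k1].
pose r (p : {mpoly R[k2]}) := p \mPo [tuple 'X_(rshift k1 i) | i < k2].
pose F i := match fintype.split i with inl j => F1 j | inr j => F2 j end.
have hl p th : (l p).@[fun i => F i th] = p.@[fun i => F1 i th].
  rewrite comp_mpoly_meval; apply: meval_eq => i.
  by rewrite tnth_mktuple mevalXU /F (unsplitK (inl i)).
have hr p th : (r p).@[fun i => F i th] = p.@[fun i => F2 i th].
  rewrite comp_mpoly_meval; apply: meval_eq => i.
  by rewrite tnth_mktuple mevalXU /F (unsplitK (inr i)).
exists (k1 + k2)%N, F, (opA _ (l A1) (l B1) (r A2) (r B2)), (opB _ (l A1) (l B1) (r A2) (r B2)).
split=> [i|]; first by rewrite /F; case: (fintype.split i).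
apply: genericS (genericI hf hg) => th [[b1 ->] [b2 ->]].
by rewrite hA hB !hl !hr; apply: hop.
Qed.

Lemma rexp_const a : rational_expression S (fun=> a).
Proof.
exists 0%N, (fun i : 'I_0 => fun=> 0), a%:MP, 1; split=> [[]//|].
by apply: genericT => th; rewrite meval1 mevalC divr1 oner_neq0.
Qed.

(** The denominator of an inverse must be nonzero generically, which is where the
    dichotomy for rational functions is used. *)
Lemma rexp_fclass : fclass (rational_expression S).
Proof.
have hext f g : generic (fun th => f th = g th) -> rational_expression S f ->
    rational_expression S g.
  move=> e [k [F [A [B [hF hf]]]]]; exists k, F, A, B; split=> //.
  by apply: genericS (genericI e hf) => th [-> ].
split=> //; first exact: rexp_const.
- move=> f g; apply: (@rexp_op f g (fun k A B A' B' => A * B' + A' * B) (fun k A B A' B' => B * B')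
    _ (fun a b a' b' => a * b' + a' * b) (fun a b a' b' => b * b')).
  + by move=> k A B A' B' v; rewrite mevalD !mevalM.
  + by move=> k A B A' B' v; rewrite !mevalM.
  + by move=> a b a' b' b0 b0'; rewrite mulf_neq0 //; split=> //; field; rewrite b0 b0'.
- move=> f g; apply: (@rexp_op f g (fun k A B A' B' => A * A') (fun k A B A' B' => B * B')
    _ (fun a b a' b' => a * a') (fun a b a' b' => b * b')).
  + by move=> k A B A' B' v; rewrite !mevalM.
  + by move=> k A B A' B' v; rewrite !mevalM.
  + by move=> a b a' b' b0 b0'; rewrite mulf_neq0 //; split=> //; field; rewrite b0 b0'.
- move=> f [k [F [A [B [hF hf]]]]].
  have rA : ratfun (fun th => A.@[fun s => F s th]).
    by apply: (fclass_meval ratfun_fclass) => i; exact/hS/hF.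
  case: (ratfun_dichotomy rA) => h0.
    apply: hext (rexp_const 0); apply: genericS (genericI h0 hf) => th [e [_ ->]].
    by rewrite e mul0r invr0.
  exists k, F, B, A; split=> //; apply: genericS (genericI h0 hf) => th [a0 [b0 ->]].
  by split=> //; rewrite invf_div.
Qed.

End RationalExpressions.
End FieldClasses.

(** * Structure equations of the frame *)

HB.lock Definition nablav (R : realType) (n : nat) (c : 'I_(n + n)) (j : 'I_(n + n).-1)
  (W : jet R (n + n).-1 -> 'cV[R]_(n + n)) (th : jet R (n + n).-1) : 'cV[R]_(n + n) :=
  \col_k nabla c j (fun th => W th k 0%R) th.

Section StructureEquations.
Local Open Scope ring_scope.
Variables (R : realType) (n : nat) (c : 'I_(n + n)).
Local Notation m := (n + n).-1.
Local Notation N := (n + n)%N.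
Hypothesis n0 : (0 < n)%N.
Implicit Types (th t : jet R m) (f g : jet R m -> R) (i j l : 'I_m).

(** The direction of the invariant derivation at th. *)
Definition dirv j th : jet R m := fun z => \sum_i frame_coef c j th i * total_dir th i z.

Lemma nabla_dd j f th : nabla c j f th = dd f th (dirv j th).
Proof. exact: horizontal_dd. Qed.

Lemma nabla_const j x th : nabla c j (fun=> x) th = 0.
Proof. by rewrite nabla_dd (cdiff_const _ _).2. Qed.

Lemma nabla_var j z th : nabla c j (fun th => th z) th = dirv j th z.
Proof. by rewrite nabla_dd (cdiff_var _ _).2. Qed.

Lemma nabla_add j f g th : cdiff f th -> cdiff g th ->
  nabla c j (fun th => f th + g th) th = nabla c j f th + nabla c j g th.
Proof. by move=> hf hg; rewrite !nabla_dd (cdiff_add hf hg).2. Qed.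

Lemma nabla_mul j f g th : cdiff f th -> cdiff g th ->
  nabla c j (fun th => f th * g th) th = f th * nabla c j g th + g th * nabla c j f th.
Proof. by move=> hf hg; rewrite !nabla_dd (cdiff_mul hf hg).2. Qed.

Lemma nabla_ext k j f g th : znbhd k th (fun th => f th = g th) -> cdiff f th ->
  nabla c j f th = nabla c j g th.
Proof. by move=> h hf; rewrite !nabla_dd (cdiff_ext h hf).2. Qed.

Lemma cdiff_opp f th : cdiff f th -> cdiff (fun th => - f th) th.
Proof.
move=> hf; have [h _] := cdiff_mul (cdiff_const (-1) th).1 hf.
by have -> : (fun th => - f th) = (fun th => -1 * f th) by apply/funext => s; rewrite mulN1r.
Qed.

Lemma nabla_opp j f th : cdiff f th -> nabla c j (fun th => - f th) th = - nabla c j f th.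
Proof.
move=> hf; have -> : (fun th => - f th) = (fun th => -1 * f th).
  by apply/funext => s; rewrite mulN1r.
by rewrite (nabla_mul _ (cdiff_const _ _).1 hf) nabla_const mulr0 addr0 mulN1r.
Qed.

Lemma cdiff_sum (T : Type) (s : seq T) (F : T -> jet R m -> R) th :
  (forall i : T, cdiff (F i) th) -> cdiff (fun th => \sum_(i <- s) F i th) th.
Proof.
move=> h; elim: s => [|i s IH].
  by under eq_fun do rewrite big_nil; exact: (cdiff_const _ _).1.
under eq_fun do rewrite big_cons; exact: (cdiff_add (h i) IH).1.
Qed.

Lemma nabla_sum j (T : Type) (s : seq T) (F : T -> jet R m -> R) th :
  (forall i : T, cdiff (F i) th) ->
  nabla c j (fun th => \sum_(i <- s) F i th) th = \sum_(i <- s) nabla c j (F i) th.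
Proof.
move=> h; elim: s => [|i s IH].
  by under eq_fun do rewrite big_nil; rewrite nabla_const big_nil.
under eq_fun do rewrite big_cons.
by rewrite (nabla_add _ (h i) (cdiff_sum s h)) IH big_cons.
Qed.

Definition cvdiff (W : jet R m -> 'cV[R]_N) th := forall k, cdiff (fun th => W th k 0) th.

Local Notation nabv := (nablav c).

Lemma nablavE j (W : jet R m -> 'cV[R]_N) th k :
  nabv j W th k 0 = nabla c j (fun th => W th k 0) th.
Proof. by rewrite unlock mxE. Qed.

Lemma cdiff_omega (W W' : jet R m -> 'cV[R]_N) th : cvdiff W th -> cvdiff W' th ->
  cdiff (fun th => omega (W th) (W' th)) th.
Proof.
move=> h h'; apply: cdiff_sum => i; apply: (cdiff_add _ _).1.
  exact: (cdiff_mul _ _).1.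
by apply: cdiff_opp; exact: (cdiff_mul _ _).1.
Qed.

Lemma nabla_omega j (W W' : jet R m -> 'cV[R]_N) th : cvdiff W th -> cvdiff W' th ->
  nabla c j (fun th => omega (W th) (W' th)) th =
  omega (nabv j W th) (W' th) + omega (W th) (nabv j W' th).
Proof.
move=> h h'; rewrite /omega.
have c1 (i : 'I_n) : cdiff (fun th => W th (lshift n i) 0 * W' th (rshift n i) 0) th.
  exact: (cdiff_mul _ _).1.
have c2 (i : 'I_n) : cdiff (fun th => W th (rshift n i) 0 * W' th (lshift n i) 0) th.
  exact: (cdiff_mul _ _).1.
rewrite (@nabla_sum j _ _ (fun (i : 'I_n) th => W th (lshift n i) 0 * W' th (rshift n i) 0
   - W th (rshift n i) 0 * W' th (lshift n i) 0)); last first.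
  by move=> i; apply: (cdiff_add _ _).1 => //; exact: cdiff_opp.
rewrite -big_split; apply: eq_bigr => i _ /=.
rewrite (nabla_add _ (c1 i) (cdiff_opp (c2 i))) (nabla_opp _ (c2 i)).
by rewrite (nabla_mul _ (h _) (h' _)) (nabla_mul _ (h _) (h' _)) !nablavE; ring.
Qed.

(** The coefficients of the equation of the tangent spaces are the first derivatives
    of the graph, so the product rule brings in its second differential. *)
Lemma nabla_dq j (W : jet R m -> 'cV[R]_N) th : cvdiff W th -> dq c th (frame c j.+1 th) = 0 ->
  nabla c j (fun th => dq c th (W th)) th =
  dq c th (nabv j W th) + d2q c th (W th) (frame c j.+1 th).
Proof.
move=> h hj; rewrite /dq.
have cu i : cdiff (fun th : jet R m => th (inr U_(i)%MM)) th by exact: (cdiff_var _ _).1.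
have cp i := (cdiff_mul (cu i) (h (lift c i))).1.
rewrite (nabla_add _ (h c) (cdiff_opp (cdiff_sum _ cp))) (nabla_opp _ (cdiff_sum _ cp)).
rewrite (nabla_sum _ _ cp) nablavE -addrA; congr (_ + _); rewrite /d2q -opprD; congr (- _).
rewrite -big_split; apply: eq_bigr => i _ /=.
rewrite (nabla_mul _ (cu i) (h _)) !nablavE; congr (_ + _).
rewrite nabla_var /dirv mulr_sumr; apply: eq_bigr => l _.
by rewrite /= /frame_coef; ring.
Qed.

Lemma nabv_position j th : dq c th (frame c j.+1 th) = 0 ->
  nabv j (position c) th = frame c j.+1 th.
Proof.
move=> hj; apply/matrixP => k l; rewrite ord1 nablavE; case: (unliftP c k) => [i ->|->].
  have -> : (fun th => position c th (lift c i) 0) = (fun th : jet R m => th (inl i)).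
    by apply/funext => s; rewrite /position chart_point_lift.
  rewrite nabla_var /dirv (bigD1 i) //= eqxx mulr1 big1 ?addr0 // => a ai.
  by rewrite eq_sym (negbTE ai) mulr0.
have -> : (fun th => position c th c 0) = (fun th : jet R m => th (inr 0%MM)).
  by apply/funext => s; rewrite /position chart_point_c.
rewrite nabla_var /dirv /= /frame_coef.
move/eqP: hj; rewrite /dq subr_eq0 => /eqP ->; apply: eq_bigr => i _.
by rewrite add0m mulrC.
Qed.

Lemma frame_regular_near t : frame_regular c t -> znbhd 2 t (frame_regular c).
Proof.
move=> [h1 h2].
have z1 : znbhd 2 t (fun th => forall ak : 'I_N * 'I_N,
    regular 2 th (fun th => frame c ak.1 th ak.2 0)).
  by apply: znbhd_forall => -[a k] /=; apply: regular_near; exact: h1.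
apply: znbhdS (znbhdI z1 (znbhd_point h2)) => th [y1 y2]; split=> // a ha k.
exact: (y1 (Ordinal ha, k)).
Qed.

Section AtNiceJet.
Variable th : jet R m.
Hypothesis hth : frame_regular c th.

Local Notation V a := (fun th => frame c a th).

Let gth : good c th.
Proof. by case: hth => _ /znbhd_center. Qed.

Lemma frame_cvdiff a : (a < N)%N -> cvdiff (V a) th.
Proof. by move=> ha k; case: hth => h _; exact: regular_cdiff (h a ha k). Qed.

(** The structure coefficients of the frame (with the position vector as V_0):
    the derivative of V_a along V_(j+1) is the sum of the [Gam j a b] V_b. *)
Definition Gam j a b (s : jet R m) : R :=
  dual (fun a => frame c a s) b (nabv j (V a) s).

Lemma nabv_expand j a : nabv j (V a) th = \sum_(b < N) Gam j a b th *: frame c b th.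
Proof. by apply: darboux_expand; case: gth => [[]]. Qed.

(** The derivative of the position vector along a tangent vector is this vector. *)
Lemma Gam0 j b : Gam j 0 b th = (b == j.+1)%:R \/ (N <= b)%N.
Proof.
have [hb|hb] := ltnP b N; [left|by right].
have [[_ htan hv _] _] := gth.
have e : nabv j (V 0%N) th = frame c j.+1 th.
  by rewrite -nabv_position // htan // ltn_ordS.
by rewrite /Gam e (dual_basisN hv) // ltn_ordS.
Qed.

(** The Gauss formula: the normal component of the derivative of a tangent field is
    the second fundamental form. It comes from differentiating dq(V_a) = 0. *)
Lemma Gam_normal j a : (0 < a < N)%N ->
  Gam j a 0 th = - Qform c th (frame c j.+1 th) (frame c a th).
Proof.
move=> ha; have [a0 aN] := andP ha; have [[[hp dq0] htan hv _] _] := gth.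
have hj : dq c th (frame c j.+1 th) = 0 by apply: htan; rewrite ltn_ordS.
have N0 : (0 < N)%N by exact: ltn_trans aN.
have := nabla_dq (frame_cvdiff aN) hj.
have -> : nabla c j (fun th => dq c th (frame c a th)) th = 0.
  rewrite -(nabla_const j 0 th); apply: esym; apply: (@nabla_ext 2); last exact: (cdiff_const _ _).1.
  by case: hth => _; apply: znbhdS => s [[_ h _ _] _]; rewrite h.
rewrite nabv_expand (linform_sum _ _ _ _ (dq_lin c th)) (bigD1 (Ordinal N0)) //= big1 => [|b hb].
  rewrite addr0 => e; rewrite /Qform -hp d2qC.
  have -> : Gam j a 0 th = Gam j a 0 th * dq c th (frame c 0 th) / dq c th (frame c 0 th).
    by rewrite mulfK.
  rewrite -mulNr; congr (_ / _); apply/eqP; rewrite -addr_eq0; apply/eqP; exact/esym.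
rewrite htan ?mulr0 // ltn_ord andbT lt0n.
by apply: contra hb => /eqP e; apply/eqP/val_inj.
Qed.

(** The values omega(V_a, V_d) being constant. *)
Lemma Gam_symplectic j a d : (a < N)%N -> (d < N)%N ->
  omega (nabv j (V a) th) (frame c d th) + omega (frame c a th) (nabv j (V d) th) = 0.
Proof.
move=> ha hd; rewrite -nabla_omega; try exact: frame_cvdiff.
have [x hx] : exists x : R, znbhd 2 th (fun s => omega (frame c a s) (frame c d s) = x).
  have [lt|gt|->] := ltngtP a d.
  - exists (~~ odd a && (d == a.+1))%:R; case: hth => _; apply: znbhdS => s [[_ _ h _] _].
    by rewrite h // lt.
  - exists (- (~~ odd d && (a == d.+1))%:R); case: hth => _; apply: znbhdS => s [[_ _ h _] _].
    by rewrite omegaC h // gt.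
  - by exists 0; apply: znbhdT => s; rewrite omegavv.
rewrite -(nabla_const j x th); apply: nabla_ext hx _.
by apply: cdiff_omega; exact: frame_cvdiff.
Qed.

Definition torsion i j b (s : jet R m) : R := Gam i j.+1 b s - Gam j i.+1 b s.

Lemma torsion0 i j : torsion i j 0 th = 0.
Proof. by rewrite /torsion !Gam_normal ?ltn_ordS // QformC subrr. Qed.

Lemma regular_frame_coef_at i j : regular 2 th (fun th => frame_coef c j th i).
Proof. exact: regular_frame_coef. Qed.

(** Total derivatives commute, so the commutator only involves the derivatives of the
    coefficients of the two fields. These are the components of nabla_i V_(j+1) -
    nabla_j V_(i+1), which has no component along V_0 by symmetry of Q. *)
Lemma nabla_comm k i j f : regular k th f ->
  nabla c i (nabla c j f) th - nabla c j (nabla c i f) th =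
  \sum_(l < m) torsion i j l.+1 th * nabla c l f th.
Proof.
move=> hf; have cf := regular_cdiff hf.
have cdt q : cdiff (dtot q f) th by exact: regular_cdiff (regular_dtot q hf).
have cfc q l : cdiff (fun s => frame_coef c l s q) th.
  exact: regular_cdiff (regular_frame_coef_at q l).
have ccp q l := (cdiff_mul (cfc q l) (cdt q)).1.
have e l l' : nabla c l (nabla c l' f) th =
   \sum_q (frame_coef c l' th q * nabla c l (dtot q f) th
           + dtot q f th * nabla c l (fun s => frame_coef c l' s q) th).
  have z : znbhd k th (fun s => \sum_q frame_coef c l' s q * dtot q f s = nabla c l' f s).
    by apply: znbhdS (regular_near hf) => s hs; rewrite [RHS]horizontalE //; exact: regular_cdiff hs.
  rewrite -(nabla_ext l z (cdiff_sum _ (fun q => ccp q l'))) (nabla_sum _ _ (fun q => ccp q l')).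
  by apply: eq_bigr => q _; rewrite (nabla_mul _ (cfc q l') (cdt q)).
have e2 l l' q : frame_coef c l' th q * nabla c l (dtot q f) th =
   \sum_p frame_coef c l' th q * frame_coef c l th p * dtot p (dtot q f) th.
  rewrite [nabla _ _ _ _]horizontalE // mulr_sumr; apply: eq_bigr => p _; ring.
rewrite !e !big_split /=.
have -> : \sum_q frame_coef c j th q * nabla c i (dtot q f) th =
          \sum_q frame_coef c i th q * nabla c j (dtot q f) th.
  under eq_bigr do rewrite e2; rewrite exchange_big /=; apply: eq_bigr => q _.
  rewrite e2; apply: eq_bigr => p _; rewrite (dtot_comm q p hf); ring.
rewrite opprD addrACA subrr add0r -sumrB.
have key q : nabla c i (fun s => frame_coef c j s q) th
    - nabla c j (fun s => frame_coef c i s q) th =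
    \sum_(l < m) torsion i j l.+1 th * frame_coef c l th q.
  have e3 a b : nabla c a (fun s => frame_coef c b s q) th =
     \sum_(d < N) Gam a b.+1 d th * frame c d th (lift c q) 0.
    have := congr1 (fun M : 'cV_N => M (lift c q) 0) (nabv_expand a b.+1).
    by rewrite nablavE summxE => ->; apply: eq_bigr => d _; rewrite mxE.
  rewrite !e3 -sumrB; under eq_bigr do rewrite -mulrBl -/(torsion i j _ th).
  have N0 : N = m.+1 by rewrite prednK // addn_gt0 n0.
  rewrite -(big_mkord xpredT (fun d => torsion i j d th * frame c d th (lift c q) 0)).
  rewrite [X in (\sum_(0 <= d < X) _)]N0 big_nat_recl // torsion0 mul0r add0r.
  by rewrite big_mkord.
transitivity (\sum_q dtot q f th * \sum_(l < m) torsion i j l.+1 th * frame_coef c l th q).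
  by apply: eq_bigr => q _; rewrite -mulrBr key.
under [RHS]eq_bigr do rewrite [nabla _ _ _ _]horizontalE // mulr_sumr.
rewrite exchange_big /=; apply: eq_bigr => q _; rewrite mulr_sumr.
by apply: eq_bigr => l _; ring.
Qed.

Lemma regular_nabv_frame j a k : (a < N)%N -> regular 3 th (fun s => nabv j (V a) s k 0).
Proof.
move=> ha; under eq_fun do rewrite nablavE; apply: regular_nabla => //.
by case: hth => h _; exact: h.
Qed.

Lemma regular_Gam j a b : (a < N)%N -> (b < N)%N -> regular 3 th (Gam j a b).
Proof.
move=> ha hb; have hfr d k : (d < N)%N -> regular 3 th (fun s => frame c d s k 0).
  by move=> hd; case: hth => h _; apply: regular_le (h d hd k).
have hno k := regular_nabv_frame j k ha.
have -> : Gam j a b = if odd b then (fun s => omega (frame c b.-1 s) (nabv j (V a) s))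
    else (fun s => omega (nabv j (V a) s) (frame c b.+1 s)).
  by apply/funext => s; rewrite /Gam /dual; case: ifP.
have hb1 : (b.-1 < N)%N by exact: leq_ltn_trans (leq_pred _) hb.
case: ifPn => ob; apply: regular_sum => i; apply: regular_sub; apply: regular_mul; auto.
all: apply: hfr; rewrite ltn_neqAle hb andbT; apply/eqP => e;
  by have := odd_dim n; rewrite -e /= ob.
Qed.

(** The coefficients of Q in the frame. *)
Definition Qfr j b (s : jet R m) : R := Qform c s (frame c j.+1 s) (frame c b s).

End AtNiceJet.

Section Codazzi.
Variable th : jet R m.
Hypothesis hth : frame_regular c th.

Local Notation V a := (fun th => frame c a th).

Let gth : good c th.
Proof. by case: hth => _ /znbhd_center. Qed.

(** The Codazzi equation: the component along V_0 of the commutator of nabla_i and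
    nabla_j applied to V_a, computed once by [nabla_comm] and once by differentiating
    nabla_j V_a = sum of the Gam V_b again. *)
Lemma codazzi i j a : (0 < a < N)%N ->
  \sum_(b < N | b != 0 :> nat) (Qfr j b th * Gam i a b th - Qfr i b th * Gam j a b th) =
  nabla c i (Qfr j a) th - nabla c j (Qfr i a) th
  - \sum_(l < m) torsion i j l.+1 th * Qfr l a th.
Proof.
move=> ha; have [a0 aN] := andP ha.
have N0 : (0 < N)%N by exact: ltn_trans aN.
have N1 : (1 < N)%N by exact: leq_ltn_trans a0 aN.
have [[_ _ hv _] _] := gth.
(* al is the coordinate along v_0, frozen at th *)
pose al (y : 'cV[R]_N) := dual (fun a => frame c a th) 0 y.
have al_lin : linform al by exact: dual_lin.
have near_exp l : znbhd 2 th (fun s => forall k, \sum_(b < N) Gam l a b s * frame c b s k 0 =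
    nabv l (V a) s k 0).
  case: hth => _; apply: znbhdS => s [[_ _ h _] _] k.
  rewrite (darboux_expand (nabv l (V a) s) h) summxE; apply: eq_bigr => b _; by rewrite mxE.
have cG l b : (b < N)%N -> cdiff (Gam l a b) th by move=> hb; apply: regular_cdiff (regular_Gam hth l aN hb).
have e l l' : nabv l (nabv l' (V a)) th =
    \sum_(b < N) (nabla c l (Gam l' a b) th *: frame c b th + Gam l' a b th *: nabv l (V b) th).
  apply/matrixP => k z; rewrite ord1 nablavE summxE.
  have ccp (b : 'I_N) : cdiff (fun s => Gam l' a b s * frame c b s k 0) th.
    by apply: (cdiff_mul _ _).1; [exact: cG|exact: (frame_cvdiff hth)].
  have zz : znbhd 2 th (fun s => \sum_(b < N) Gam l' a b s * frame c b s k 0 =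
      nabv l' (V a) s k 0) by apply: znbhdS (near_exp l') => s; apply.
  rewrite -(nabla_ext l zz (cdiff_sum _ ccp)) (nabla_sum _ _ ccp); apply: eq_bigr => b _.
  rewrite (nabla_mul _ (cG _ _ (ltn_ord b)) (frame_cvdiff hth (ltn_ord b) k)) !mxE nablavE; ring.
have ale l l' : al (nabv l (nabv l' (V a)) th) =
    nabla c l (Gam l' a 0) th + \sum_(b < N) Gam l' a b th * Gam l b 0 th.
  rewrite e; transitivity (\sum_(b < N) (nabla c l (Gam l' a b) th * al (frame c b th)
     + Gam l' a b th * al (nabv l (V b) th))).
    elim/big_ind2: _ => [|x y x' y' hx hy|b _]; first exact: linform0.
      by rewrite (linformD _ _ al_lin) hx hy.
    by rewrite (linformD _ _ al_lin) !(linformZ _ _ al_lin).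
  rewrite big_split /=; congr (_ + _).
  rewrite (bigD1 (Ordinal N0)) //= big1 ?addr0 => [|b hb].
    by rewrite /al (dual_basisN hv) // eqxx mulr1.
  rewrite /al (dual_basisN hv) // (_ : (0 == b :> nat)%N = false) ?mulr0 //.
  by apply/negbTE; apply: contra hb => /eqP e'; apply/eqP/val_inj.
have comm : al (nabv i (nabv j (V a)) th) - al (nabv j (nabv i (V a)) th) =
    \sum_(l < m) torsion i j l.+1 th * Gam l a 0 th.
  rewrite -(linformB _ _ al_lin).
  have -> : nabv i (nabv j (V a)) th - nabv j (nabv i (V a)) th =
      \sum_(l < m) torsion i j l.+1 th *: nabv l (V a) th.
    apply/matrixP => k z; rewrite ord1 summxE.
    have hreg : regular 2 th (fun s => frame c a s k 0) by case: hth => h _; exact: h.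
    have subE (x y : 'cV[R]_N) : (x - y) k 0 = x k 0 - y k 0 by rewrite !mxE.
    have scE x (y : 'cV[R]_N) : (x *: y) k 0 = x * y k 0 by rewrite mxE.
    have nvE2 l l' : nabv l (nabv l' (V a)) th k 0 =
        nabla c l (nabla c l' (fun s => frame c a s k 0)) th.
      by rewrite nablavE; congr (nabla c l _ th); apply/funext => s; rewrite nablavE.
    rewrite subE.
    rewrite (nvE2 i j) (nvE2 j i).
    rewrite (nabla_comm hth i j hreg).
    apply: eq_bigr => l _.
    rewrite scE.
    by rewrite nablavE.
  by rewrite (linform_sum _ _ _ _ al_lin).
have nG l l' : nabla c l (Gam l' a 0) th = - nabla c l (Qfr l' a) th.
  have cQ : cdiff (Qfr l' a) th.
    have hq : regular 2 th (Qfr l' a).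
      have [hf _] := hth; apply: regular_Qform; first exact: good_dq.
        by apply: hf; exact: ltn_ordS.
      exact: hf.
    exact: regular_cdiff hq.
  rewrite -(nabla_opp _ cQ); apply: (@nabla_ext 2); last exact: cG.
  apply: znbhdS (frame_regular_near hth) => s hs.
    exact: (@Gam_normal s hs l' a ha).
move: comm; rewrite !ale !nG => comm.
have eG0 l b : (b < N)%N -> Gam l b 0 th = if b == 0%N then 0 else - Qfr l b th.
  move=> hb; case: eqP => [->|/eqP b0].
    by have [->|] := Gam0 hth l 0; [|rewrite leqNgt N0].
  by rewrite (Gam_normal hth) // lt0n b0 hb.
rewrite big_mkcond /=.
have eS l l' : \sum_(b < N) Gam l' a b th * Gam l b 0 th =
    - \sum_(b < N) (if b != 0 :> nat then Qfr l b th * Gam l' a b th else 0).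
  rewrite -sumrN; apply: eq_bigr => b _; rewrite eG0 //.
  by case: eqP => _ /=; rewrite ?mulr0 ?oppr0 // mulrN mulrC.
have eT : \sum_(l < m) torsion i j l.+1 th * Gam l a 0 th =
   - \sum_(l < m) torsion i j l.+1 th * Qfr l a th.
  rewrite -sumrN; apply: eq_bigr => l _; rewrite eG0 // gtn_eqF // mulrN //.
have eD : \sum_(b < N) (if b != 0 :> nat then Qfr j b th * Gam i a b th - Qfr i b th * Gam j a b th else 0) =
   \sum_(b < N) (if b != 0 :> nat then Qfr j b th * Gam i a b th else 0)
   - \sum_(b < N) (if b != 0 :> nat then Qfr i b th * Gam j a b th else 0).
  by rewrite -sumrB; apply: eq_bigr => b _; case: ifP => _; rewrite ?subrr.
rewrite eD; move: comm; rewrite !eS eT.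
set s1 := \sum_(b < N) _; set s2 := \sum_(b < N) _; set s3 := \sum_(l < m) _.
by move=> E; lra.
Qed.

End Codazzi.

End StructureEquations.

(** * Rigidity of the structure equations *)

Section Rigidity.
Local Open Scope ring_scope.
Variables (R : realType) (N : nat) (I : nat -> R) (Y : nat -> nat -> nat -> R).
Hypothesis evenN : odd N = false.

(** The index d lowered by omega, in a Darboux basis. *)
Definition Ylow i a d : R := if odd d then Y i a d.-1 else - Y i a d.+1.

(** The value Q(v_j, Y_i v_a), for the matrix of Q in an adapted frame. *)
Definition QY j i a : R := I j * Y i a j
  + (if odd j then (if (j.+1 < N)%N then Y i a j.+1 else 0) else Y i a j.-1).

Hypothesis Y0l : forall i b, (0 < i < N)%N -> (b < N)%N -> Y i 0 b = 0.
Hypothesis Y0r : forall i a, (0 < i < N)%N -> (0 < a < N)%N -> Y i a 0 = 0.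
Hypothesis Ysym : forall i a d, (0 < i < N)%N -> (a < N)%N -> (d < N)%N ->
  Ylow i a d = Ylow i d a.
Hypothesis Ytor : forall i j d, (0 < i < N)%N -> (0 < j < N)%N -> (d < N)%N ->
  Y i j d = Y j i d.
Hypothesis Ycod : forall i j a, (0 < i < N)%N -> (0 < j < N)%N -> (0 < a < N)%N ->
  QY j i a = QY i j a.
Hypothesis I_odd : forall j, odd j -> (j.+1 < N)%N -> I j = 0.
Hypothesis I_last : (2 < N)%N -> I N.-1 != 0.

Let ltS a : ~~ odd a -> (a < N)%N -> (a.+1 < N)%N.
Proof.
move=> oa aN; rewrite ltn_neqAle aN andbT; apply/eqP => e.
by move: evenN; rewrite -e /= (negbTE oa).
Qed.

Let Y_low i a b : Y i a b = if odd b then - Ylow i a b.-1 else Ylow i a b.+1.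
Proof.
rewrite /Ylow; case: ifPn => ob.
  have b0 : (0 < b)%N by case: (b) ob.
  have -> : odd b.-1 = false by case: (b) ob b0 => //= k /negbTE.
  by rewrite prednK // opprK.
by rewrite /= ob.
Qed.

Let low_swap i a d : (0 < i < N)%N -> (0 < a < N)%N -> (d < N)%N -> Ylow i a d = Ylow a i d.
Proof.
move=> hi ha dN; rewrite /Ylow; case: ifPn => od; rewrite Ytor //.
  exact: leq_ltn_trans (leq_pred _) dN.
exact: ltS.
Qed.

(* With its last index lowered, Y is a symmetric tensor on the indices > 0; P d says
   that it vanishes as soon as one index is d. *)
Let P d := forall i a, (0 < i < N)%N -> (0 < a < N)%N -> Ylow i a d = 0.

Let P_first d : (0 < d < N)%N -> P d -> forall i a b, (0 < i < N)%N -> (0 < a < N)%N ->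
  (b < N)%N -> Y d a b = 0.
Proof.
move=> /andP[d0 dN] hP i a b hi ha bN.
have hd : (0 < d < N)%N by rewrite d0.
have a0N : (a < N)%N by case/andP: ha.
have key e : (e < N)%N -> Ylow d a e = 0.
  move=> eN; have [->|e0] := posnP e.
    rewrite Ysym // ?(ltn_trans d0) // /Ylow; case: ifPn => oa.
      by rewrite Y0l ?oppr0 // (leq_ltn_trans (leq_pred _)).
    by rewrite Y0l ?oppr0 // ltS.
  by rewrite low_swap // Ysym // hP // e0.
rewrite Y_low; case: ifPn => ob; first by rewrite key ?oppr0 // (leq_ltn_trans (leq_pred _)).
by rewrite key // ltS.
Qed.

Let QY_P j i a : (0 < j < N)%N -> P j -> (0 < i < N)%N -> (0 < a < N)%N -> QY j i a = 0.
Proof.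
move=> hj hP hi ha; rewrite Ycod // /QY; have [i0 iN] := andP hi.
rewrite (P_first hj hP hi) // mulr0 add0r; case: ifPn => oi.
  by case: ifP => // h; rewrite (P_first hj hP hi).
by rewrite (P_first hj hP hi) // (leq_ltn_trans (leq_pred _)).
Qed.

Let P1 : P 1.
Proof. by move=> i a hi ha; rewrite /Ylow /= Y0r. Qed.

(* Climbing from P 1: as I_j = 0 for odd j, the Codazzi equation at j only involves
   the component j + 1, that is, the lowered index j + 2. *)
Let P_odd k : (k.*2.+1 < N)%N -> P k.*2.+1.
Proof.
elim: k => [|k IH] h; first exact: P1.
have hk : (k.*2.+1 < N)%N by apply: ltn_trans h; rewrite doubleS.
have hk2 : (k.*2.+2 < N)%N by apply: ltn_trans h; rewrite doubleS.
have hP := IH hk; move=> i a hi ha.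
have := @QY_P k.*2.+1 i a; rewrite hk /= => /(_ isT hP hi ha).
rewrite /QY /= odd_double /= hk2 I_odd //=; last by rewrite odd_double.
by rewrite mul0r add0r Y_low /= odd_double /= -doubleS.
Qed.

Let P0 : P 0.
Proof.
move=> i a hi ha; have /andP[a0 aN] := ha; have N0 := ltn_trans a0 aN.
rewrite Ysym // /Ylow; case: ifPn => oa.
  by rewrite Y0l // (leq_ltn_trans (leq_pred _)).
by rewrite Y0l ?oppr0 // ltS.
Qed.

(* Descending from the last index: the Codazzi equation at d + 1 = N - 1 gives P d as
   I_(N-1) is nonzero; then the one at d + 2 gives P d from P (d + 2) and P (d + 3). *)
Let P_even k d : (d + k.*2 + 2 = N)%N -> odd d = false -> (1 < d)%N -> P d.
Proof.
elim: k d => [|k IH] d e od d1 i a hi ha.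
  have N2 : (2 < N)%N by rewrite -e addn0 addn2 ltnS ltnW.
  have eN : N.-1 = d.+1 by rewrite -e addn0 addn2.
  have dN : (d.+1 < N)%N by rewrite -e addn0 addn2.
  have hP : P d.+1.
    by have := @P_odd d./2; have := odd_double_half d; rewrite od add0n => -> /(_ dN).
  have := @QY_P d.+1 i a; rewrite dN /= => /(_ isT hP hi ha).
  have dN2 : (d.+2 < N)%N = false by rewrite -e addn0 addn2 ltnn.
  rewrite /QY /= od /= dN2 addr0 => /eqP.
  rewrite mulf_eq0 -eN (negbTE (I_last N2)) /= eN Y_low /= od /= oppr_eq0.
  by move/eqP.
have hP2 : P d.+2.
  apply: IH; rewrite ?negbK //=; last by rewrite od.
  by rewrite -e doubleS; lia.
have dN : (d.+2 < N)%N by rewrite -e doubleS; lia.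
have dN1 : (d.+3 < N)%N by apply: ltS dN; rewrite /= od.
have hP3 : P d.+3.
  have := @P_odd d.+2./2; have := odd_double_half d.+2; rewrite [odd _]/= od add0n => ->.
  by move=> /(_ dN1).
have := @QY_P d.+2 i a; rewrite dN /= => /(_ isT hP2 hi ha).
rewrite /QY /= od /= Y_low /= od /= hP3 // mulr0 add0r Y_low /= od /= => /eqP.
by rewrite oppr_eq0 => /eqP.
Qed.

(** The linear equations for the structure coefficients have at most one solution at
    a jet with these I_a. The homogeneous equations make a symmetric tensor out of Y
    (symplecticity and vanishing torsion), and the Codazzi equations let its vanishing
    propagate through the odd indices upwards, and then through the even ones
    downwards. *)
Lemma rigidity i a b : (0 < i < N)%N -> (a < N)%N -> (b < N)%N -> Y i a b = 0.
Proof.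
move=> hi aN bN; have [->|a0] := posnP a; first exact: Y0l.
have ha : (0 < a < N)%N by rewrite a0.
have half_lt d : (d < N)%N -> odd d = false -> (d + ((N - d)./2.-1).*2 + 2 = N)%N.
  move=> dN od; have h0 : (0 < N - d)%N by rewrite subn_gt0.
  have e : odd (N - d) = false by rewrite oddB ?evenN ?od //; exact: ltnW.
  have h2 := odd_double_half (N - d); rewrite e add0n in h2.
  have : (0 < (N - d)./2)%N by rewrite -double_gt0 h2.
  case E : (N - d)./2 h2 => [//|q] h2 _; rewrite doubleS in h2 => /=.
  by clear -h2 dN; lia.
rewrite Y_low; case: ifPn => ob.
  have b0 : (0 < b)%N by case: (b) ob.
  have ob1 : odd b.-1 = false by case: (b) ob b0 => //= q /negbTE.
  have [->|b1] := posnP b.-1; first by rewrite P0 ?oppr0.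
  have b1' : (1 < b.-1)%N by rewrite ltn_neqAle b1 andbT; apply: contraFneq ob1 => <-.
  have bN1 : (b.-1 < N)%N by exact: leq_ltn_trans (leq_pred _) bN.
  by rewrite (P_even (half_lt _ bN1 ob1)) ?oppr0.
have := @P_odd b./2; have := odd_double_half b; rewrite (negbTE ob) add0n => ->.
by move=> /(_ (ltS ob bN)) ->.
Qed.

End Rigidity.

(** * Derivatives of the basic invariants at the base jet *)

Section ChoiceOfBasePoint.
Local Open Scope ring_scope.
Variables (R : realType) (n : nat) (c : 'I_(n + n)).
Local Notation m := (n + n).-1.
Local Notation N := (n + n)%N.
Hypothesis n0 : (0 < n)%N.

Variable w : nat -> 'cV[R]_N.
Hypothesis hw : darboux N w.
Hypothesis hw0 : w 0%N = delta_mx c 0.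
Hypothesis hwc : forall a, (0 < a < N)%N -> w a c 0 = 0.

Local Notation base := (basejet c w).

Lemma basejet_frame I lam :
  (forall a, odd a -> (2 < a)%N -> (a.+1 < N)%N -> I a * I a.+1 != 1) ->
  ((2 < N.-1)%N -> I N.-1 != 0) ->
  [/\ adapted c (base I lam) w, nondeg c (base I lam) w
    & forall a, (a < N)%N -> frame c a (base I lam) = w a].
Proof.
move=> h1 h2; have hA := basejet_adapted hw hw0 hwc I lam n0.
have hn : nondeg c (base I lam) w.
  split=> [a oa a2 aN|hN].
    have a0 : (0 < a)%N by exact: ltn_trans a2.
    by rewrite !(basejet_Qdiag hw hw0) ?aN ?a0 ?(ltnW aN) //; exact: h1.
  rewrite (basejet_Qdiag hw hw0) ?h2 // (ltn_trans _ hN) //=.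
  by rewrite ltn_predL addn_gt0 n0.
by split=> //; case: (adapted_good n0 hA hn).
Qed.

(** Zero at the odd places but the last, as [rigidity] requires, and nonzero where the
    existence and the rationality of the frame require it. *)
Definition I0 (a : nat) : R := if odd a then (a == N.-1)%:R else 1.

(** A perturbation of I_k, realized by a line of jets. *)
Definition Ivar (k : nat) (x : R) (a : nat) : R := I0 a - x * (a == k)%:R.

Lemma odd_predN : odd N.-1.
Proof.
have e : N.-1.+1 = N by rewrite prednK // addn_gt0 n0.
by have := odd_dim n; rewrite -{1}e /= => /negbFE.
Qed.

Lemma Ivar_frame k x lam : `|x| < 1 ->
  [/\ adapted c (base (Ivar k x) lam) w, nondeg c (base (Ivar k x) lam) w
    & forall a, (a < N)%N -> frame c a (base (Ivar k x) lam) = w a].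
Proof.
move=> hx; have /andP[x1 x2] : -1 < x < 1 by rewrite -ltr_norml.
apply: basejet_frame => [a oa a2 aN|hN].
  have na : (a == N.-1) = false.
    by apply/eqP => e; move: aN; rewrite e prednK ?ltnn // addn_gt0 n0.
  rewrite /Ivar /I0 oa /= oa na /= sub0r.
  have [->|nk] := eqVneq a k.
    by rewrite [k.+1 == k]gtn_eqF // mulr0 subr0 !mulr1 lt_eqF //; lra.
  by rewrite mulr0 oppr0 mul0r eq_sym oner_neq0.
rewrite /Ivar /I0 odd_predN eqxx; have [_|_] := eqVneq N.-1 k; last by rewrite mulr0 subr0 oner_neq0.
by rewrite mulr1 mulr1n gt_eqF // subr_gt0.
Qed.

Lemma Ivar0 k : Ivar k 0 = I0.
Proof. by apply/funext => a; rewrite /Ivar mul0r subr0. Qed.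

Lemma base_frame lam :
  [/\ adapted c (base I0 lam) w, nondeg c (base I0 lam) w
    & forall a, (a < N)%N -> frame c a (base I0 lam) = w a].
Proof. by rewrite -(Ivar0 0); apply: Ivar_frame; rewrite normr0 ltr01. Qed.

Lemma base_regular lam : frame_regular c (base I0 lam).
Proof.
have [h1 h2 _] := base_frame lam.
apply: (frame_regular_adapted n0 h1 h2) => r /andP[r0 rn].
rewrite (basejet_Qdiag hw hw0) /I0 ?odd_double ?oner_neq0 //.
by rewrite double_gt0 r0 addnn ltn_double.
Qed.

Lemma ord_range (k : 'I_m) : (0 < k.+1 < N)%N.
Proof. by rewrite ltn_ordS. Qed.

Lemma I2_base k x lam (l : 'I_m) : `|x| < 1 -> I2 c l (base (Ivar k x) lam) = Ivar k x l.+1.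
Proof.
move=> hx; have [_ _ e] := Ivar_frame k lam hx.
by rewrite /I2 e ?ltn_ordS // -/(Qdiag _ _ _ _) (basejet_Qdiag hw hw0) ?ord_range.
Qed.

(** The square of the k-th coordinate, as a direction in the space of 2-jets. *)
Definition squarejet (k : nat) : jet R m := fun z =>
  if z is inr s then (if mdeg s == 2%N then mono (coform c w k) s else 0) else 0.

Lemma jeqk_line k x : (0 < k < N)%N ->
  jeqk 2 (jline (base I0 0) (squarejet k) x) (base (Ivar k x) 0).
Proof.
move=> /andP[k0 kN] [i|s] /= hs; first by rewrite /jline /= mulr0 addr0.
rewrite /jline /=; case: eqP => [->|h0] /=; first by rewrite mulr0 addr0.
case: eqP => [->|h1] /=; first by rewrite mulr0 addr0.
have -> : mdeg s = 2%N by move: hs h0 h1; case: (mdeg s) => [|[|[|]]].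
rewrite eqxx; suff -> : quad c w (Ivar k x) s = quad c w I0 s - x * mono (coform c w k) s by ring.
rewrite /quad addrAC; congr (_ + _).
under eq_bigr do rewrite /Ivar mulrBl.
rewrite sumrB; congr (_ - _).
rewrite (bigD1_seq k) /= ?iota_uniq ?mem_index_iota ?k0 ?kN // eqxx mulr1.
by rewrite big1 ?addr0 // => a ak; rewrite (negbTE ak) mulr0 mul0r.
Qed.

(** Along this direction the frame is constant and I_k varies linearly. *)
Lemma dd_I2_square (k l : 'I_m) : dd (I2 c l) (base I0 0) (squarejet k.+1) = - (l == k)%:R.
Proof.
have hr := regular_I2 n0 l (base_regular 0).
have [_ /(_ _ _ (dcurve_jline _ (squarejet k.+1))) hd] := regular_cdiff hr.
rewrite -(@derive_val _ _ _ _ _ _ _ hd).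
have hl : is_derive (0 : R) (1 : R)
   (cst (I0 l.+1) + (- (l == k)%:R) \*: id : R -> R) (- (l == k)%:R).
  by apply: is_derive_eq; rewrite add0r /GRing.scale /= mulr1.
apply: derive_val; apply: near_eq_is_derive hl.
near=> x; have hx : `|x| < 1.
  near: x; apply/nbhs_ballP; exists 1 => //= y.
  by rewrite /ball /= sub0r normrN.
rewrite (I2_jeqk c l (jeqk_line x (ord_range k))) I2_base // /Ivar !fctE /= eqSS.
by rewrite /GRing.scale /= -val_eqE /= mulNr mulrC.
Unshelve. all: by end_near.
Qed.

Definition dirw lam (k : nat) : jet R m := fun z =>
  \sum_i w k (lift c i) 0 * total_dir (base I0 lam) i z.

(** The coefficient lam of the third order part enters the matrix of the derivatives
    of the invariants only through - lam times the identity matrix. *)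
Lemma nabla_I2_base lam (k l : 'I_m) :
  nabla c k (I2 c l) (base I0 lam) =
  dd (I2 c l) (base I0 0) (dirw 0 k.+1) - lam * (l == k)%:R.
Proof.
have [_ _ e] := base_frame lam.
have hr := regular_I2 n0 l (base_regular 0).
have h0 : jeqk 2 (base I0 0) (base I0 lam).
  move=> [i|s] //= hs; case: ifP => // h0; case: ifP => // h1.
  by have -> : mdeg s = 2%N by move: hs h0 h1; case: (mdeg s) => [|[|[|]]].
have [_ _ hdd] := regular_jeqk hr h0.
rewrite nabla_dd -(hdd (fun z => lam * squarejet k.+1 z + dirw 0 k.+1 z)).
  by rewrite (regular_cdiff hr).1 dd_I2_square; ring.
have edir z : dirv c k (base I0 lam) z = dirw lam k.+1 z.
  by rewrite /dirv /dirw; apply: eq_bigr => i _; rewrite /frame_coef e ?ltn_ordS.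
move=> [i|s] hs; rewrite edir /=.
  by rewrite mulr0 add0r; apply: eq_bigr => a _.
have [h2|h2] := eqVneq (mdeg s) 2%N.
  rewrite /dirw !(basejet_total hw hw0) ?ord_range //=.
  by rewrite mul0r addr0.
rewrite mulr0 add0r; apply: eq_bigr => i _; rewrite /= mdegD mdeg1.
by move: hs h2 => /=; case: (mdeg s) => [|[|[|]]].
Qed.

(** The matrix in question is A - lam for a fixed A, so lam is chosen off the
    spectrum of A. *)
Lemma base_point_exists : exists lam, forall y : 'I_m -> R,
  (forall l, \sum_k y k * nabla c k (I2 c l) (base I0 lam) = 0) -> forall k, y k = 0.
Proof.
pose A : 'M[R]_m := \matrix_(k, l) dd (I2 c l) (base I0 0) (dirw 0 k.+1).
have [lam hlam] := poly_nonroot (monic_neq0 (char_poly_monic A)).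
exists lam => y hy k; pose v : 'rV[R]_m := \row_k y k.
have hv : v *m A = lam *: v.
  apply/rowP => l; rewrite !mxE; apply/eqP; rewrite -subr_eq0 -[X in _ == X](hy l); apply/eqP.
  under [RHS]eq_bigr do rewrite nabla_I2_base mulrBr.
  rewrite sumrB; congr (_ - _); first by apply: eq_bigr => i _; rewrite !mxE.
  rewrite (bigD1 l) //= eqxx big1 ?addr0 ?mulr1 1?mulrC // => i il.
  by rewrite eq_sym (negbTE il) !mulr0.
have [v0|v0] := eqVneq v 0; first by have := congr1 (fun u : 'rV_m => u 0 k) v0; rewrite !mxE.
have : eigenvalue A lam by apply/eigenvalueP; exists v.
by rewrite eigenvalue_root_char /root (negbTE hlam).
Qed.

End ChoiceOfBasePoint.

(** * The field generated by the invariants *)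

Section InvariantField.
Local Open Scope ring_scope.
Variables (R : realType) (n : nat) (c : 'I_(n + n)).
Local Notation m := (n + n).-1.
Local Notation N := (n + n)%N.
Hypothesis n0 : (0 < n)%N.
Implicit Types (f g : jet R m -> R) (th : jet R m).

Variable t : jet R m.
Hypothesis ht : frame_regular c t.

Lemma generic_frame_regular : generic (frame_regular c : jet R m -> Prop).
Proof. exact: znbhd_generic (frame_regular_near ht). Qed.

(** By the product and quotient rules. *)
Lemma rexp_nabla (S : set (jet R m -> R)) j : (forall f, S f -> ratfun f) ->
  (forall f, S f -> rational_expression S (nabla c j f)) ->
  forall f, rational_expression S f -> rational_expression S (nabla c j f).
Proof.
move=> hS hSn.
have hK := rexp_fclass hS.
suff H : forall f, rational_expression S f ->
    rational_expression S f /\ rational_expression S (nabla c j f) by move=> f /H[].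
apply: (rexp_ind (X := fun f => rational_expression S f /\ rational_expression S (nabla c j f)));
  last by move=> f hf; split; [exact: rexp_base|exact: hSn].
have hcd f : rational_expression S f -> generic (fun th => cdiff f th).
  move=> /(rexp_ratfun hS)/ratfun_generic; apply: genericS => th [k]; exact: regular_cdiff.
have hext f g : generic (fun th => f th = g th) -> rational_expression S f ->
    rational_expression S (nabla c j f) -> rational_expression S (nabla c j g).
  move=> e hf; apply: (fclass_ext hK); apply: genericS (genericI (generic_point e) (hcd _ hf)).
  by move=> th [[k z] hc]; apply: nabla_ext z hc.
split.
- move=> a; split; first exact: fclass_const.
  by apply: (fclass_eq _ (fclass_const hK 0)) => th; rewrite nabla_const.
- move=> f g [hf hf'] [hg hg']; split; first exact: fclass_add.
  apply: (fclass_ext hK) (fclass_add hK hf' hg').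
  by apply: genericS (genericI (hcd _ hf) (hcd _ hg)) => th [h1 h2]; rewrite nabla_add.
- move=> f g [hf hf'] [hg hg']; split; first exact: fclass_mul.
  apply: (fclass_ext hK) (fclass_add hK (fclass_mul hK hf hg') (fclass_mul hK hg hf')).
  by apply: genericS (genericI (hcd _ hf) (hcd _ hg)) => th [h1 h2]; rewrite nabla_mul.
- move=> f [hf hf']; split; first exact: fclass_inv.
  case: (ratfun_dichotomy (rexp_ratfun hS hf)) => h.
    apply: (hext (fun=> 0)); last 2 first.
    - exact: fclass_const.
    - by apply: (fclass_eq _ (fclass_const hK 0)) => th; rewrite nabla_const.
    by apply: genericS h => th ->; rewrite invr0.
  apply: (fclass_ext hK) (fclass_mul hK (fclass_opp hK (fclass_inv hK (fclass_mul hK hf hf))) hf').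
  apply: genericS (genericI (hcd _ hf) h) => th [h1 h2].
  by rewrite [RHS]nabla_dd (cdiff_inv h2 h1).2 nabla_dd expr2.
- move=> f g e [hf hf']; split; first exact: fclass_ext hf.
  exact: hext hf hf'.
Qed.

Definition gens : set (jet R m -> R) := fun F =>
  exists (J : seq 'I_m) (i : 'I_m), F = nablas c J (I2 c i).

Lemma gens_ratfun f : gens f -> ratfun f.
Proof.
move=> [J [i ->]]; exists (size J).+2, t; elim: J => [|j J IH]; first exact: regular_I2.
exact: regular_nabla.
Qed.

Local Notation KK := (rational_expression gens).

Let hK : fclass KK := rexp_fclass gens_ratfun.

Lemma gens_I2 i : KK (I2 c i).
Proof. by apply: rexp_base; exists [::], i. Qed.

Lemma gens_nabla j f : KK f -> KK (nabla c j f).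
Proof.
apply: rexp_nabla; first exact: gens_ratfun.
move=> _ [J [i ->]]; apply: rexp_base; by exists (j :: J), i.
Qed.

Lemma sum_delta (U : finType) (F : U -> R) u : \sum_v (v == u)%:R * F v = F u.
Proof.
rewrite (bigD1 u) //= eqxx mul1r big1 ?addr0 // => v vu.
by rewrite (negbTE vu) mul0r.
Qed.

Lemma sum_delta_expand (U : finType) (L : (U -> R) -> R) :
  (forall x y z, L (fun u => x * y u + z u) = x * L y + L z) ->
  forall y, L y = \sum_u y u * L (fun v => (v == u)%:R).
Proof.
move=> hL.
have L0 : L (fun=> 0) = 0.
  have := hL (-1) (fun=> 0) (fun=> 0).
  under eq_fun do rewrite mulr0 addr0.
  by rewrite mulN1r addNr.
move=> y; have -> : y = fun w => \sum_u y u * (w == u)%:R.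
  by apply/funext => w; under eq_bigr do rewrite mulrC eq_sym; rewrite sum_delta.
transitivity (\sum_u y u * L (fun v => (v == u)%:R)); last first.
  by apply: eq_bigr => u _; under eq_bigr do rewrite mulrC eq_sym; rewrite sum_delta.
elim: (index_enum U) => [|u s IH].
  by under eq_fun do rewrite big_nil; rewrite L0 big_nil.
by under eq_fun do rewrite big_cons; rewrite hL IH big_cons.
Qed.

Hypothesis sep : forall y : 'I_m -> R,
  (forall l, \sum_k y k * nabla c k (I2 c l) t = 0) -> forall k, y k = 0.

(** The equations [nabla_comm] for the basic invariants are linear in the torsion,
    with coefficients the matrix of the derivatives of the invariants, which is
    invertible at t. *)
Lemma gens_torsion i j (l : 'I_m) : KK (torsion c i j l.+1).
Proof.
pose L (l : 'I_m) (th : jet R m) (y : 'I_m -> R) := \sum_k y k * nabla c k (I2 c l) th.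
have Ld e th u : L e th (fun v => (v == u)%:R) = nabla c u (I2 c e) th.
  exact: sum_delta.
apply: (fclass_solve hK (k := 3) (t := t) (L := L)
  (b := fun l th => nabla c i (nabla c j (I2 c l)) th - nabla c j (nabla c i (I2 c l)) th)
  (x := fun k => torsion c i j k.+1)).
- by move=> e th y; apply: eq_bigr => u _; rewrite Ld.
- move=> e u; under eq_fun do rewrite Ld; exact/gens_nabla/gens_I2.
- by move=> e u; under eq_fun do rewrite Ld; apply: regular_nabla => //; exact: regular_I2.
- by move=> e; apply: (fclass_sub hK); exact/gens_nabla/gens_nabla/gens_I2.
- move=> e; apply: genericS generic_frame_regular => th hth.
  rewrite (nabla_comm n0 hth i j (regular_I2 n0 e hth)); reflexivity.
- exact: sep.
Qed.

(** Extended by 0 along the position vector, so as to sum over all of the frame. *)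
Definition Qfr0 j b (th : jet R m) : R := if b == 0%N then 0 else Qfr c j b th.

Lemma gens_Qfr0 j b : (b < N)%N -> KK (Qfr0 j b).
Proof.
move=> bN; have [->|b0] := posnP b; first exact: (fclass_const hK 0).
have [e|ne] := eqVneq b j.+1.
  by apply: (fclass_eq _ (gens_I2 j)) => th; rewrite /Qfr0 e.
have [x hx] : exists x : R, generic (fun th => x = Qfr0 j b th).
  have hg := generic_good ht.
  have hj := ltn_ordS n0 j.
  case: (ltngtP b j.+1) ne => // h _.
    exists (odd b && (j.+1 == b.+1))%:R; apply: genericS hg => th [[_ _ _ h4] _].
    by rewrite /Qfr0 (gtn_eqF b0) /Qfr QformC h4 // h.
  exists (odd j.+1 && (b == j.+2))%:R; apply: genericS hg => th [[_ _ _ h4] _].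
  by rewrite /Qfr0 (gtn_eqF b0) /Qfr h4 // h.
exact: fclass_ext hx (fclass_const hK x).
Qed.

Lemma gens_Qfr j b : (0 < b < N)%N -> KK (Qfr c j b).
Proof.
move=> /andP[b0 bN]; apply: (fclass_eq _ (gens_Qfr0 j bN)) => th.
by rewrite /Qfr0 gtn_eqF.
Qed.

Let N0 : (0 < N)%N.
Proof. by rewrite addn_gt0 n0. Qed.

Let m0 : (0 < m)%N.
Proof. by have := odd_predN n0; case: (m). Qed.

Let a0 : 'I_N := Ordinal N0.
Let j0 : 'I_m := Ordinal m0.

Let Yn (y : 'I_m * 'I_N * 'I_N -> R) (i a b : nat) : R :=
  y (insubd j0 i.-1, insubd a0 a, insubd a0 b).

Let YnE (F : 'I_m -> nat -> nat -> R) (i : 'I_m) a b : (a < N)%N -> (b < N)%N ->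
  Yn (fun u => F u.1.1 u.1.2 u.2) i.+1 a b = F i a b.
Proof.
move=> ha hb; rewrite /Yn /= !val_insubd ha hb; congr (F _ _ _).
by apply: val_inj; rewrite val_insubd ltn_ord.
Qed.

(* The left hand sides of five families of equations, numbered by the first index:
   derivative of the position vector, Gauss formula, symplecticity, torsion, Codazzi.
   The equations at a = 0 of the second and last families are void. *)
Let Leq (e : 'I_5 * 'I_m * 'I_m * 'I_N * 'I_N) (th : jet R m) (y : 'I_m * 'I_N * 'I_N -> R) : R :=
  let: (r, i, j, a, d) := e in
  match val r with
  | 0%N => Yn y i.+1 0 d
  | 1%N => if a == 0%N :> nat then 0 else Yn y i.+1 a 0
  | 2%N => Ylow (Yn y) i.+1 a d - Ylow (Yn y) i.+1 d a
  | 3%N => Yn y i.+1 j.+1 d - Yn y j.+1 i.+1 d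
  | _ => if a == 0%N :> nat then 0 else
      \sum_(b < N) (Qfr0 j b th * Yn y i.+1 a b - Qfr0 i b th * Yn y j.+1 a b)
  end.

Let beq (e : 'I_5 * 'I_m * 'I_m * 'I_N * 'I_N) (th : jet R m) : R :=
  let: (r, i, j, a, d) := e in
  match val r with
  | 0%N => (d == i.+1 :> nat)%:R
  | 1%N => - Qfr0 i a th
  | 2%N => 0
  | 3%N => if d == 0%N :> nat then 0 else torsion c i j d th
  | _ => if a == 0%N :> nat then 0 else
      nabla c i (Qfr c j a) th - nabla c j (Qfr c i a) th
      - \sum_(l < m) torsion c i j l.+1 th * Qfr c l a th
  end.

Let Leq_lin e th x y z :
  Leq e th (fun u => x * y u + z u) = x * Leq e th y + Leq e th z.
Proof.
case: e => [[[[[r hr] i] j] a] d]; rewrite /Leq /=.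
case: r hr => [|[|[|[|r]]]] hr //.
- by case: ifP => _ //; rewrite mulr0 addr0.
- by rewrite /Ylow /Yn; case: ifP => _; case: ifP => _; ring.
- by rewrite /Yn; ring.
- case: ifP => _; first by rewrite mulr0 addr0.
  rewrite mulr_sumr -big_split; apply: eq_bigr => b _ /=; rewrite /Yn; ring.
Qed.

Let beq_KK e : KK (beq e).
Proof.
case: e => [[[[[r hr] i] j] a] d]; rewrite /beq /=.
case: r hr => [|[|[|[|r]]]] hr.
- exact: fclass_const.
- by apply: (fclass_opp hK); exact: gens_Qfr0.
- exact: fclass_const.
- case: eqP => hd; first exact: (fclass_const hK 0).
  have d0 : (0 < d)%N by rewrite lt0n; apply/eqP.
  have hl : (d.-1 < m)%N by rewrite -ltnS !prednK.
  have -> : (d = (Ordinal hl).+1 :> nat) by rewrite /= prednK.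
  exact: gens_torsion.
- case: eqP => ha; first exact: (fclass_const hK 0).
  have ha' : (0 < a < N)%N by rewrite ltn_ord andbT lt0n; apply/eqP.
  apply: (fclass_sub hK); first by apply: (fclass_sub hK); exact/gens_nabla/gens_Qfr.
  by apply: (fclass_sum hK) => l; apply: (fclass_mul hK); [exact: gens_torsion|exact: gens_Qfr].
Qed.

Let regular_Qfr0 j (b : 'I_N) : regular 2 t (Qfr0 j b).
Proof.
rewrite /Qfr0; case: eqP => _; first exact: regular_const.
have [h1 h2] := ht; apply: regular_Qform; first exact: good_dq (znbhd_center h2).
  by apply: h1; exact: ltn_ordS.
exact: h1.
Qed.

Let Leq_coef e u : KK (fun th => Leq e th (fun v => (v == u)%:R)) /\
  regular 2 t (fun th => Leq e th (fun v => (v == u)%:R)).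
Proof.
have hc x : KK (fun=> x) /\ regular 2 t (fun=> x).
  by split; [exact: fclass_const|exact: regular_const].
case: e => [[[[[r hr] i] j] a] d]; rewrite /Leq /=.
case: r hr => [|[|[|[|r]]]] hr; try exact: hc.
case: (val a == 0%N); first exact: hc.
split.
  apply: (fclass_sum hK) => b; apply: (fclass_sub hK); apply: (fclass_mul hK);
    by [exact: gens_Qfr0|exact: (fclass_const hK)].
by apply: regular_sum => b; apply: regular_sub; apply: regular_mul;
  [exact: regular_Qfr0|exact: regular_const|exact: regular_Qfr0|exact: regular_const].
Qed.

Let omega_Gam i a d th : frame_regular c th -> (a < N)%N -> (d < N)%N ->
  omega (nablav c i (fun th => frame c a th) th) (frame c d th) =
  if odd d then Gam c i a d.-1 th else - Gam c i a d.+1 th.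
Proof.
move=> hth ha hd; rewrite /Gam /dual; case: ifPn => od.
  have -> : odd d.-1 = false by case: (d) od => //= q /negbTE.
  by rewrite prednK //; case: (d) od.
by rewrite /= od -omegaC.
Qed.

Let Leq_Gam e th : frame_regular c th ->
  Leq e th (fun u => Gam c u.1.1 u.1.2 u.2 th) = beq e th.
Proof.
move=> hth; case: e => [[[[[r hr] i] j] a] d]; rewrite /Leq /beq /=.
have G (k : 'I_m) x y : (x < N)%N -> (y < N)%N ->
    Yn (fun u => Gam c u.1.1 u.1.2 u.2 th) k.+1 x y = Gam c k x y th.
  exact: (YnE (fun i a b => Gam c i a b th)).
have GQ (k : 'I_m) x : (0 < x < N)%N -> Gam c k x 0 th = - Qfr0 k x th.
  by move=> hx; rewrite (Gam_normal n0 hth) // /Qfr0 gtn_eqF //; case/andP: hx.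
have hj (k : 'I_m) : (k.+1 < N)%N by exact: ltn_ordS.
case: r hr => [|[|[|[|r]]]] hr.
- by rewrite G //; case: (Gam0 n0 hth i d) => //; rewrite leqNgt ltn_ord.
- case: eqP => [->|/eqP ha]; first by rewrite /Qfr0 eqxx oppr0.
  by rewrite G // GQ // lt0n ha /=.
- have YG (x y : 'I_N) : Ylow (Yn (fun u => Gam c u.1.1 u.1.2 u.2 th)) i.+1 x y =
      omega (nablav c i (fun th => frame c x th) th) (frame c y th).
    rewrite omega_Gam // /Ylow; case: ifPn => oy; rewrite G //.
      exact: leq_ltn_trans (leq_pred _) (ltn_ord y).
    rewrite ltn_neqAle ltn_ord andbT; apply/eqP => e.
    by have := odd_dim n; rewrite -e /= oy.
  rewrite (YG a d) (YG d a); rewrite [X in _ - X]omegaC opprK.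
  exact: Gam_symplectic.
- rewrite !G //; case: eqP => [->|_ //].
  exact: (torsion0 n0 hth i j).
- case: eqP => [//|/eqP ha].
  have ha' : (0 < a < N)%N by rewrite lt0n ha /=.
  rewrite -(codazzi n0 hth i j ha') [RHS]big_mkcond /=; apply: eq_bigr => b _.
  rewrite /Qfr0 !G //; case: eqP => _ //=; by rewrite !mul0r subrr.
Qed.

Hypothesis I_odd : forall a, odd a -> (a.+1 < N)%N -> Qdiag c t (fun a => frame c a t) a = 0.

Let Qfr0_row i (z : nat -> R) :
  \sum_(b < N) Qfr0 i b t * z b =
  Qdiag c t (fun a => frame c a t) i.+1 * z i.+1
    + (if odd i.+1 then (if (i.+2 < N)%N then z i.+2 else 0) else z i).
Proof.
have [hA _] : good c t by case: ht => _ /znbhd_center.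
have [_ _ hv _] := hA.
pose y := \sum_(b < N) (if b == 0%N :> nat then 0 else z b) *: frame c b t.
have dy b : (b < N)%N -> dual (fun a => frame c a t) b y = if b == 0%N then 0 else z b.
  move=> hb; rewrite (linform_sum _ _ _ _ (dual_lin _ _)) (bigD1 (Ordinal hb)) //=.
  rewrite (dual_basisN hv) // eqxx mulr1 big1 ?addr0 // => d hd.
  rewrite (dual_basisN hv) // (_ : (b == d)%N = false) ?mulr0 //.
  by apply/negbTE; apply: contra hd => /eqP e; apply/eqP/val_inj.
have hi : (0 < i.+1 < N)%N by rewrite ltn_ordS.
transitivity (Qform c t y (frame c i.+1 t)).
  rewrite (linform_sum _ _ _ _ (Qform_linl c t _)); apply: eq_bigr => b _.
  by rewrite /Qfr0; case: eqP => _; rewrite ?mul0r // mulrC /Qfr QformC.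
have y0 : dual (fun a => frame c a t) 0 y = 0 by rewrite dy.
have [_ iN] := andP hi.
rewrite (Q_row hA hi y0) (dy _ iN) [_ * z _]mulrC; congr (_ + _); rewrite /=.
case: ifPn => oi; first by case: ifP => // h; rewrite dy.
rewrite (dy _ (ltnW iN)).
by case: eqP oi => // ->.
Qed.

(** The equations found for the structure coefficients have their other terms in
    the field generated by the invariants, and [rigidity] is the uniqueness of their
    solution at t. *)
Lemma gens_Gam j a b : (a < N)%N -> (b < N)%N -> KK (Gam c j a b).
Proof.
move=> ha hb.
suff H : forall u : 'I_m * 'I_N * 'I_N, KK (Gam c u.1.1 u.1.2 u.2).
  exact: H (j, Ordinal ha, Ordinal hb).
apply: (fclass_solve hK (k := 2) (t := t) (L := Leq) (b := beq)
  (x := fun u th => Gam c u.1.1 u.1.2 u.2 th)).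
- by move=> e th y; apply: sum_delta_expand => x u v; exact: Leq_lin.
- by move=> e u; case: (Leq_coef e u).
- by move=> e u; case: (Leq_coef e u).
- exact: beq_KK.
- by move=> e; apply: genericS generic_frame_regular => th; exact: Leq_Gam.
move=> y hy.
have hrange i : (0 < i < N)%N -> exists k : 'I_m, i = k.+1.
  case: i => // i hi; have hi' : (i < m)%N by rewrite -ltnS prednK.
  by exists (Ordinal hi').
have hE r (hr : (r < 5)%N) i j' a' d' : Leq (Ordinal hr, i, j', a', d') t y = 0 by exact: hy.
have hrig := @rigidity R N (Qdiag c t (fun a => frame c a t)) (Yn y) (odd_dim n).
suff Y0 : forall (i : 'I_m) a b, (a < N)%N -> (b < N)%N -> Yn y i.+1 a b = 0.
  have insN (x : 'I_N) : insubd a0 (val x) = x by apply: val_inj; rewrite val_insubd ltn_ord.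
  have insm (x : 'I_m) : insubd j0 (val x) = x by apply: val_inj; rewrite val_insubd ltn_ord.
  move=> [[i x] z]; rewrite -[RHS](Y0 i x z (ltn_ord x) (ltn_ord z)).
  by rewrite /Yn [_.+1.-1]/= (insN x) (insN z) (insm i).
have E0 r (hr : (r < 5)%N) (i j' : 'I_m) a' d' (ha' : (a' < N)%N) (hd' : (d' < N)%N) x :
    Leq (Ordinal hr, i, j', Ordinal ha', Ordinal hd') t y = x -> x = 0 by move=> <-; exact: hE.
clear hy hE.
move=> i a' b' ha' hb'; apply: hrig; rewrite ?ltn_ordS //.
- move=> k d /hrange[k' ->] hd.
  by apply: (E0 0%N isT k' i d d hd hd).
- move=> k d /hrange[k' ->] /andP[d0 hd].
  by apply: (E0 1%N isT k' i d d hd hd); rewrite /Leq /= gtn_eqF.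
- move=> k d d' /hrange[k' ->] hd hd'; apply/eqP; rewrite -subr_eq0; apply/eqP.
  by apply: (E0 2%N isT k' i d d' hd hd').
- move=> k k' d /hrange[q ->] /hrange[q' ->] hd; apply/eqP; rewrite -subr_eq0; apply/eqP.
  by apply: (E0 3%N isT q q' d d hd hd).
- move=> k k' d /hrange[q ->] /hrange[q' ->] /andP[d0 hd]; apply/eqP; rewrite -subr_eq0; apply/eqP.
  apply: (E0 4%N isT q q' d d hd hd).
  by rewrite /Leq /= gtn_eqF // sumrB (Qfr0_row q (Yn y q'.+1 d)) (Qfr0_row q' (Yn y q.+1 d)).
- move=> N2; have [_ [_ h]] : good c t by case: ht => _ /znbhd_center.
  by apply: h; clear -N2; lia.
Qed.

End InvariantField.

(** * Generation of the invariants *)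

Section Generation.
Local Open Scope ring_scope.
Variables (R : realType) (n : nat) (c : 'I_(n + n)).
Local Notation m := (n + n).-1.
Local Notation N := (n + n)%N.
Hypothesis n0 : (0 < n)%N.
Implicit Types (f : jet R m -> R) (th : jet R m).

Variable t : jet R m.
Hypothesis ht : frame_regular c t.

Local Notation gens := (@gens R n c).
Local Notation KK := (rational_expression gens).

Hypothesis Gam_KK : forall j a b, (a < N)%N -> (b < N)%N -> KK (Gam c j a b).

(** Unlike the invariants, the entries of the frame, which include those of the
    position vector, tell apart the jets of an orbit. *)
Definition gensF : set (jet R m -> R) := fun F => gens F \/
  exists a k, (a < N)%N /\ F = (fun th => frame c a th k 0).

Local Notation LL := (rational_expression gensF).

Lemma gensF_ratfun f : gensF f -> ratfun f.
Proof.
case=> [|[a [k [ha ->]]]]; first exact: (gens_ratfun n0 ht).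
by exists 2%N, t; case: ht => h _; exact: h.
Qed.

Let hL : fclass LL := rexp_fclass gensF_ratfun.

Lemma gens_gensF f : KK f -> LL f.
Proof. by apply: (rexp_ind hL) => g hg; apply: rexp_base; left. Qed.

Lemma gensF_frame a k : (a < N)%N -> LL (fun th => frame c a th k 0).
Proof. by move=> ha; apply: rexp_base; right; exists a, k. Qed.

(** The derivatives of the frame are combinations of the frame with structure
    coefficients. *)
Lemma gensF_nabla j f : LL f -> LL (nabla c j f).
Proof.
apply: rexp_nabla; first exact: gensF_ratfun.
move=> g [hg|[a [k [ha ->]]]].
  by apply: gens_gensF; apply: (gens_nabla n0 ht); exact: rexp_base.
apply: (fclass_ext hL (f := fun th => \sum_(b < N) Gam c j a b th * frame c b th k 0)).
  apply: genericS (generic_frame_regular ht) => th hth.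
  rewrite -nablavE (nabv_expand hth) summxE; apply: eq_bigr => b _; by rewrite mxE.
apply: (fclass_sum hL) => b; apply: (fclass_mul hL); last exact: gensF_frame.
by apply: gens_gensF; exact: Gam_KK.
Qed.

(** The frame spans the tangent space, which projects onto the space of the
    independent variables. *)
Lemma frame_coef_span th (y : 'I_m -> R) : good c th ->
  (forall j, \sum_q y q * frame_coef c j th q = 0) -> forall q, y q = 0.
Proof.
move=> [[[hp dq0] htan hv _] _] hy q.
pose l (z : 'cV[R]_N) := \sum_p y p * z (lift c p) 0.
have hl : linform l.
  move=> a z z'; rewrite /l mulr_sumr -big_split; apply: eq_bigr => p _.
  by rewrite !mxE /=; ring.
have lT : l (tvec c th q) = y q.
  rewrite /l (bigD1 q) //= big1 ?addr0 => [|p pq]; rewrite !mxE eqxx !andbT;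
    rewrite [lift c _ == c]eq_sym (negbTE (neq_lift _ _)) mulr0 addr0 ?eqxx ?mulr1 //.
  by rewrite (inj_eq lift_inj) (negbTE pq) mulr0.
have dT : dq c th (tvec c th q) = 0.
  rewrite /dq (bigD1 q) //= big1 ?addr0 => [|p pq]; rewrite !mxE eqxx !andbT.
    rewrite (negbTE (neq_lift _ _)) [lift c _ == c]eq_sym (negbTE (neq_lift _ _)) !eqxx.
    by rewrite mulr0 addr0 add0r mulr1n !mulr1 subrr.
  rewrite [lift c _ == c]eq_sym (negbTE (neq_lift _ _)) mulr0 addr0.
  by rewrite (inj_eq lift_inj) (negbTE pq) mulr0.
rewrite -lT (linform_expand _ hv hl) big1 // => -[[|a] ha] _ /=.
  have := linform_expand (tvec c th q) hv (dq_lin c th).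
  rewrite dT (bigD1 (Ordinal ha)) //= big1 ?addr0 => [/esym/eqP|[[//|b] hb] _]; last first.
    by rewrite htan ?mulr0.
  by rewrite mulf_eq0 (negbTE dq0) orbF => /eqP ->; rewrite mul0r.
have hj : (a < m)%N by rewrite -ltnS prednK // (leq_ltn_trans _ ha).
by have := hy (Ordinal hj); rewrite /frame_coef /= -/(l _) => ->; rewrite mulr0.
Qed.

(** The total derivatives are obtained from the nabla_j by inverting the matrix of
    the frame. *)
Lemma gensF_dtot q f : LL f -> LL (dtot q f).
Proof.
move=> hf.
pose L (j : 'I_m) th (y : 'I_m -> R) := \sum_q y q * frame_coef c j th q.
have Ld e th u : L e th (fun v => (v == u)%:R) = frame_coef c e th u by exact: sum_delta.
apply: (fclass_solve hL (k := 2) (t := t) (L := L) (b := fun j => nabla c j f)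
  (x := fun q => dtot q f)).
- by move=> e th y; apply: eq_bigr => u _; rewrite Ld.
- by move=> e u; under eq_fun do rewrite Ld; apply: gensF_frame; exact: ltn_ordS.
- by move=> e u; under eq_fun do rewrite Ld; exact: regular_frame_coef.
- by move=> e; exact: gensF_nabla.
- move=> e; apply: genericS (ratfun_generic (rexp_ratfun gensF_ratfun hf)) => th [k hk].
  rewrite [RHS](horizontalE _ (regular_cdiff hk)); apply: eq_bigr => p _; exact: mulrC.
- by move=> y; apply: frame_coef_span; case: ht => _ /znbhd_center.
Qed.

Lemma gensF_var z : LL (fun th => th z).
Proof.
have hp k : LL (fun th => position c th k 0) by apply: (@gensF_frame 0%N); rewrite addn_gt0 n0.
case: z => [i|s].
  by apply: (fclass_eq _ (hp (lift c i))) => th; rewrite /position chart_point_lift.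
rewrite -(wordofK s); elim: (wordof s) => [|i w IH].
  by apply: (fclass_eq _ (hp c)) => th; rewrite /position chart_point_c.
by apply: (fclass_eq _ (gensF_dtot i IH)) => th; rewrite dtot_var.
Qed.

(** The position vector belongs to the frame, and the other coordinates are its
    iterated total derivatives. *)
Lemma gensF_total k f : polynomial_on k f -> LL f.
Proof.
move: f; apply: polynomial_on_ind => [a|z _|f g hf hg|f g hf hg].
- exact: fclass_const.
- exact: gensF_var.
- exact: fclass_add.
- exact: fclass_mul.
Qed.

Lemma nablas_invariant (g : 'M[R]_N) J i : symplectic g ->
  generic (fun th => forall th', prolong_infty c g th th' ->
    nablas c J (I2 c i) th' = nablas c J (I2 c i) th).
Proof.
move=> sg; elim: J => [|j J IH].
  by apply: genericS (generic_good ht) => th hth th' hp; exact: (@I2_good _ _ _ n0 2) hth.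
have hr : rational_on (size J).+2 (@nablas R n c J (I2 c i)).
  have : regular (size J).+2 t (nablas c J (I2 c i)).
    by elim: (J) => [|j' J' IH']; [exact: regular_I2|exact: regular_nabla].
  by move=> h; apply/rational_onP; exists t.
have [_ /(_ g _ _ _ sg hr hr) H] := frame_coef_invariant n0 j ht.
apply: genericS (H _) => [th h th' hp|]; first exact/esym/h.
by apply: genericS IH => th h th' hp; exact/esym/h.
Qed.

Lemma darboux_transport (v w : nat -> 'cV[R]_N) : darboux N v -> darboux N w ->
  exists g : 'M[R]_N, symplectic g /\ forall a, (a < N)%N -> g *m v a = w a.
Proof.
move=> hv hw.
pose g : 'M[R]_N := \matrix_(k, l) \sum_(a < N) dual v a (delta_mx l 0) * w a k 0.
have gE y : g *m y = \sum_(a < N) dual v a y *: w a.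
  apply/matrixP => k z; rewrite ord1 mxE summxE.
  under eq_bigr do rewrite mxE mulr_suml.
  rewrite exchange_big /=; apply: eq_bigr => a _; rewrite mxE.
  rewrite (linform_delta y (dual_lin v a)) mulr_suml; apply: eq_bigr => l _; ring.
exists g; split=> [x y|a ha]; last first.
  rewrite gE (bigD1 (Ordinal ha)) //= (dual_basisN hv) // eqxx scale1r big1 ?addr0 // => b hb.
  rewrite (dual_basisN hv) // (_ : (b == a :> nat)%N = false) ?scale0r //.
  by apply/negbTE; apply: contra hb => /eqP e; apply/eqP/val_inj.
have e a b : (a < N)%N -> (b < N)%N -> omega (w a) (w b) = omega (v a) (v b).
  move=> ha hb; case: (ltngtP a b) => [lt|gt|->]; last by rewrite !omegavv.
    by rewrite hv ?hw ?lt.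
  by rewrite omegaC hw ?gt // -hv ?gt // -omegaC.
rewrite [in RHS](darboux_expand x hv) [in RHS](darboux_expand y hv) !gE.
rewrite !(linform_sum _ _ _ _ (omega_linl _)); apply: eq_bigr => a _; congr (_ * _).
by rewrite !(linform_sum _ _ _ _ (omega_linr _)); apply: eq_bigr => b _; rewrite e.
Qed.

(** For symplectic X, the function G X is th |-> F (X th): it is F itself for an
    invariant, and an entry of X times the frame for an entry of the frame. This
    formula makes sense for all X; if X depends on th and moves its frame to that of a
    fixed jet th1, it reduces to a function H, constant or invariant. *)
Lemma gensF_orbit F : gensF F -> exists (G : 'M[R]_N -> jet R m -> R) (A : jet R m -> Prop),
  [/\ forall th, G 1%:M th = F th,
      forall g, symplectic g ->
        generic (fun th => forall th', prolong_infty c g th th' -> F th' = G g th),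
      generic A, forall X th, A th -> cdiff (G X) th
    & forall th1, exists H, [/\ KK H, forall th, A th -> cdiff H th
      & forall X th, (forall a, (a < N)%N -> X *m frame c a th = frame c a th1) ->
          G X th = H th]].
Proof.
case=> [hF|[a [k [ha ->]]]].
  exists (fun=> F), (cdiff F); split=> //.
  - by move: hF => [J [i ->]] g sg; exact: nablas_invariant.
  - apply: genericS (ratfun_generic (gens_ratfun n0 ht hF)) => th [k hk].
    exact: regular_cdiff hk.
  - by move=> th1; exists F; split=> //; exact: rexp_base.
exists (fun X th => (X *m frame c a th) k 0), (frame_regular c); split.
- by move=> th; rewrite mul1mx.
- move=> g sg; apply: genericS (generic_good ht) => th hth th' hp.
  by have [_ e] := good_prolong n0 (isT : (1 < 2)%N) sg (hp 2%N) hth; rewrite e.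
- exact: (generic_frame_regular ht).
- move=> X th hth; under eq_fun do rewrite mxE; apply: cdiff_sum => l.
  by apply: (cdiff_mul (cdiff_const _ _).1 _).1; exact: (frame_cvdiff hth).
- move=> th1; exists (fun=> frame c a th1 k 0); split.
  + exact: rexp_const.
  + by move=> th _; exact: (cdiff_const _ _).1.
  + by move=> X th; apply: (fun h => congr1 (fun y : 'cV_N => y k 0) (h a ha)).
Qed.

Lemma cdiff_meval k (A : {mpoly R[k]}) (F : 'I_k -> jet R m -> R) th :
  (forall s, cdiff (F s) th) -> cdiff (fun th => A.@[fun s => F s th]) th.
Proof.
move=> hF; elim/mpoly_alg_ind: A => [a|i|p q hp hq|p q hp hq].
- by under eq_fun do rewrite mevalC; exact: (cdiff_const _ _).1.
- by under eq_fun do rewrite mevalXU; exact: hF.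
- by under eq_fun do rewrite mevalD; exact: (cdiff_add _ _).1.
- by under eq_fun do rewrite mevalM; exact: (cdiff_mul _ _).1.
Qed.

(** Write f = A / B in terms of the invariants and the frame. Invariance under a fixed
    g gives A(1) B(g) = A(g) B(1) at generic jets, hence, by [cdiff_generic0], at all
    jets where these functions are differentiable, whatever g. Now g may be chosen in
    terms of th, namely so as to move the frame to a fixed one: then A(g) and B(g) are
    polynomials in invariants and constants, with quotient f. *)
Lemma invariant_generated l f : diff_invariant c l f -> KK f.
Proof.
move=> [k0 [P [D [lk0 [hP hD [d hd] fE] finv]]]].
have hK := rexp_fclass (gens_ratfun n0 ht : forall f, gens f -> ratfun f).
have [k [F [A [B [hF hgen]]]]] : LL f.
  apply: (fclass_ext hL (f := fun th => P th * (D th)^-1)).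
    by exists l, D; split=> // [|th Dth]; [exists d|rewrite fE].
  by apply: (fclass_mul hL); [|apply: (fclass_inv hL)]; apply: gensF_total; eassumption.
have hDg : generic (fun th => D th != 0) by exists l, D; split=> //; exists d.
have [G hG] := choice (fun s => gensF_orbit (hF s)).
have [nice hnice] := choice hG.
(* The set of jets where this holds does not depend on g. *)
have hE (g : 'M[R]_N) th : symplectic g -> (forall s, nice s th) ->
    A.@[fun s => F s th] * B.@[fun s => G s g th] = A.@[fun s => G s g th] * B.@[fun s => F s th].
  move=> sg hth; apply/eqP; rewrite -subr_eq0; apply/eqP.
  have cdG X (K : {mpoly R[k]}) : cdiff (fun th => K.@[fun s => G s X th]) th.
    by apply: cdiff_meval => s; case: (hnice s) => _ _ _ h _; exact: h.
  have cdF (K : {mpoly R[k]}) : cdiff (fun th => K.@[fun s => F s th]) th.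
    have <- : (fun th => K.@[fun s => G s 1%:M th]) = (fun th => K.@[fun s => F s th]).
      by apply/funext => z; apply: meval_eq => s; case: (hnice s).
    exact: cdG.
  pose E th := A.@[fun s => F s th] * B.@[fun s => G s g th]
    + - (A.@[fun s => G s g th] * B.@[fun s => F s th]).
  apply: (@cdiff_generic0 _ _ E).
    apply: (cdiff_add _ (cdiff_opp _)).1; exact: (cdiff_mul _ _).1.
  have ug := symplectic_unit sg.
  have hall : generic (fun th => forall s, forall th', prolong_infty c g th th' -> F s th' = G s g th).
    by apply: generic_forall => s; case: (hnice s) => _ h _ _ _; exact: h.
  have := genericI (genericI (generic_gJ c ug) hall)
    (genericI (genericI hgen hDg) (generic_pull c ug (genericI hgen hDg))).
  apply: genericS => z [[dz hz] [[[Bz fz] Dz] hz']]; rewrite /E.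
  have hp := prolong_infty_Phimap dz.
  have [[Bz' fz'] Dz'] := hz' _ hp.
  have e := finv g z _ sg (hp k0) Dz Dz'.
  have eG K : K.@[fun s => F s (Phimap c g z)] = K.@[fun s => G s g z].
    by apply: meval_eq => s; exact: hz.
  move: e; rewrite fz fz' !eG => /eqP; rewrite eqr_div //; last by rewrite -eG.
  by move=> /eqP ->; rewrite subrr.
have hng : generic (fun th => forall s, nice s th).
  by apply: generic_forall => s; case: (hnice s).
have [th1 [[nice1 good1] [B1 _]]] := generic_ex (genericI (genericI hng (generic_good ht)) hgen).
have hH s : exists H, [/\ KK H, forall th, nice s th -> cdiff H th
      & forall X th, (forall a, (a < N)%N -> X *m frame c a th = frame c a th1) ->
          G s X th = H th].
  by case: (hnice s) => _ _ _ _ h; exact: h.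
have [H hH'] := choice hH.
have KH (K : {mpoly R[k]}) : KK (fun th => K.@[fun s => H s th]).
  by apply: (fclass_meval hK) => s; case: (hH' s).
(* At th1 the moving matrix is the identity, so the denominator has there the value
   B(1), which is nonzero. *)
have B0 : generic (fun th => B.@[fun s => H s th] != 0).
  case: (ratfun_dichotomy (rexp_ratfun (gens_ratfun n0 ht : forall f, gens f -> ratfun f) (KH B))) => // h0.
  have : B.@[fun s => H s th1] = 0.
    apply: (cdiff_generic0 (cdiff_meval _ _) h0) => s.
    by case: (hH' s) => _ h _; exact: h.
  have -> : B.@[fun s => H s th1] = B.@[fun s => F s th1].
    apply: meval_eq => s; case: (hH' s) => _ _ /(_ 1%:M) <- => [|a _]; last by rewrite mul1mx.
    by case: (hnice s).
  by move=> e; rewrite e eqxx in B1.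
apply: (fclass_ext hK (f := fun th => A.@[fun s => H s th] * (B.@[fun s => H s th])^-1)).
  apply: genericS (genericI (genericI hng (generic_good ht)) (genericI hgen B0)).
  move=> th [[nth gth] [[Bth ->] Hth]].
  have [[_ _ dth _] _] := gth; have [[_ _ dth1 _] _] := good1.
  have [g [sg hg]] := darboux_transport dth dth1.
  have := hE g th sg nth.
  have eH K : K.@[fun s => G s g th] = K.@[fun s => H s th].
    by apply: meval_eq => s; case: (hH' s) => _ _; apply.
  by rewrite !eH => e; apply/eqP; rewrite eqr_div // e.
by apply: (fclass_mul hK); [|apply: (fclass_inv hK)]; exact: KH.
Qed.

End Generation.

(** All genericity assumptions on the frame and its derivatives are checked at this
    jet. *)
Lemma separating_jet_exists (R : realType) (n : nat) (c : 'I_(n + n)) : (0 < n)%N ->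
  exists t : jet R (n + n).-1,
  [/\ frame_regular c t,
      forall y : 'I_(n + n).-1 -> R,
        (forall l, \sum_k y k * nabla c k (I2 c l) t = 0)%R -> forall k, y k = 0%R
    & forall a, odd a -> (a.+1 < n + n)%N -> Qdiag c t (fun a => frame c a t) a = 0%R].
Proof.
move=> n0; have [w [hw hw0 hwc]] := darboux_basis_exists R c.
have [lam hlam] := base_point_exists n0 hw hw0 hwc.
exists (basejet c w (I0 R n) lam); split=> [||a oa aN]; [exact: base_regular|exact: hlam|].
have [_ _ e] := base_frame n0 hw hw0 hwc lam.
have a0 : (0 < a)%N by case: (a) oa.
have aN' := ltnW aN.
rewrite /Qdiag e // -/(Qdiag _ _ _ _) (basejet_Qdiag hw hw0) ?a0 // /I0 oa.
by rewrite ltn_eqF // -ltnS prednK // (ltn_trans a0).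
Qed.

Theorem theorem5p1 (R : realType) (n : nat) (hn : (1 <= n)%N)
    (c : 'I_(n + n)) (l : nat) (hl : (2 <= l)%N) :
  [/\ forall i : 'I_(n + n).-1, diff_invariant c l (@I2 R n c i),
      forall j : 'I_(n + n).-1, invariant_derivation c (@frame_coef R n c j)
    & forall f : jet R (n + n).-1 -> R, diff_invariant c l f ->
        rational_expression
          (fun F => exists (J : seq 'I_(n + n).-1) (i : 'I_(n + n).-1),
                      F = nablas c J (I2 c i)) f].
Proof.
have [t [ht sep odd0]] := separating_jet_exists R c hn; split.
- by move=> i; exact: (diff_invariant_I2 hn i hl ht).
- by move=> j; exact: (frame_coef_invariant hn j ht).
- move=> f; apply: (invariant_generated hn ht) => j a b; exact: (gens_Gam hn ht sep odd0).
Qed.
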